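(* Let $(\Omega,\Sigma,\mu)$ be a $\sigma$-finite measure space and $\gamma=\mu(\Omega)\in(0,\infty]$. Let $\psi:[0,\gamma)\to[0,\infty)$ be a non-zero increasing concave function, continuous on $(0,\gamma)$, with $\psi(0)=0$, satisfying either condition (A) or condition (B). Then the Marcinkiewicz space $M_\psi(\mu)$ over $(\Omega,\Sigma,\mu)$ is a Grothendieck space.
   Context: For $f\in L_0(\mu)$, $f^*(t)=\inf\{s\ge0:\mu(\{|f|>s\})\le t\}$. $M_\psi(\mu)=\{f\in L_0(\mu):\|f\|_{M_\psi(\mu)}<\infty\}$, where $\|f\|_{M_\psi(\mu)}=\sup_{0<t<\gamma}\frac{1}{\psi(t)}\int_0^t f^*(s)\,ds$. Condition (A): $\gamma=\infty$ and $\liminf_{t\downarrow0}\psi(2t)/\psi(t)>1$ and $\liminf_{t\to\infty}\psi(2t)/\psi(t)>1$. Condition (B): $\gamma<\infty$ and $\liminf_{t\downarrow0}\psi(2t)/\psi(t)>1$. A Banach space $X$ is a Grothendieck space if every weak-$*$ convergent sequence in $X^*$ converges weakly. *)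

(* Defs.v *)
From HB Require Import structures.
From mathcomp Require Import all_boot all_order all_algebra.
From mathcomp Require Import all_classical all_reals all_analysis.
Set Implicit Arguments. Unset Strict Implicit. Unset Printing Implicit Defensive.
Import Order.TTheory GRing.Theory Num.Theory.
Import numFieldNormedType.Exports.
Local Open Scope classical_set_scope.
Local Open Scope ring_scope.

Section Marcinkiewicz.
Context {R : realType} {d : measure_display} {T : measurableType d}.
Variable mu : {measure set T -> \bar R}.

(* decreasing rearrangement f^*(t) = inf { s >= 0 : mu(|f| > s) <= t } (inf of empty set = +oo) *)
Definition drearr (f : T -> R) (t : R) : \bar R :=
  ereal_inf [set s%:E | s in [set s : R | (0 <= s)%R /\ (mu [set x | (s < `|f x|)%R] <= t%:E)%E]].

Definition gamma_itv : set R := [set t : R | 0 < t /\ (t%:E < mu setT)%E].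

Definition Mnorm (psi : R -> R) (f : T -> R) : \bar R :=
  ereal_sup [set ((psi t)^-1)%:E *
     (\int[lebesgue_measure]_(s in [set s : R | (0 < s < t)%R]) drearr f s)
     | t in gamma_itv]%E.

(* M_psi(mu): measurable (L_0) functions with finite Marcinkiewicz norm.
   Functions equal a.e. are identified implicitly: they have zero-norm difference. *)
Definition Mspace (psi : R -> R) : set (T -> R) :=
  [set f | measurable_fun setT f /\ (Mnorm psi f < +oo)%E].

Definition Mdual (psi : R -> R) : set ((T -> R) -> R) :=
  [set phi | (forall (a : R) f g, Mspace psi f -> Mspace psi g ->
                 phi (a \*: f \+ g) = a * phi f + phi g) /\
             exists C : R, forall f, Mspace psi f -> `|phi f| <= C * fine (Mnorm psi f)].

Definition Mdualnorm (psi : R -> R) (phi : (T -> R) -> R) : R :=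
  fine (ereal_sup [set `|phi f|%:E | f in [set f | Mspace psi f /\ (Mnorm psi f <= 1)%E]]).

Definition Mbidual (psi : R -> R) : set (((T -> R) -> R) -> R) :=
  [set Phi | (forall (a : R) phi chi, Mdual psi phi -> Mdual psi chi ->
                 Phi (a \*: phi \+ chi) = a * Phi phi + Phi chi) /\
             exists C : R, forall phi, Mdual psi phi -> `|Phi phi| <= C * Mdualnorm psi phi].

Definition Mpsi_Grothendieck (psi : R -> R) : Prop :=
  forall (phis : nat -> (T -> R) -> R) (phi : (T -> R) -> R),
    (forall n, Mdual psi (phis n)) -> Mdual psi phi ->
    (forall f, Mspace psi f -> phis n f @[n --> \oo] --> phi f) ->
    forall Phi, Mbidual psi Phi -> Phi (phis n) @[n --> \oo] --> Phi phi.

End Marcinkiewicz.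

Definition concave_on {R : realType} (A : set R) (psi : R -> R) : Prop :=
  forall x y (l : R), A x -> A y -> 0 <= l <= 1 ->
    l * psi x + (1 - l) * psi y <= psi (l * x + (1 - l) * y).

Definition liminf0_gt1 {R : realType} (psi : R -> R) : Prop :=
  exists2 c : R, 1 < c & \forall t \near 0^'+, c < psi (2 * t) / psi t.

Definition liminfoo_gt1 {R : realType} (psi : R -> R) : Prop :=
  exists2 c : R, 1 < c & \forall t \near +oo, c < psi (2 * t) / psi t.

(* Main.v *)
(** The growth conditions on [psi] make [M_psi] a quotient of an [l^oo]-sum of scaled copies of
    [L^1 /\ L^oo]: the unit ball consists, up to constants, of the sums [\sum_j b ^ (j + 1) * y_j]
    over [j : int] with [|y_j| <= 1] and [\int |y_j| <= level j], the [j]-th slice of [f] being its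
    restriction to [b ^ j < |f| <= b ^ (j + 1)].

    Let [phi_i] be weak-* null and suppose that [Phi (phi_i) >= e > 0] for some [Phi] in the bidual.
    By Helly's theorem there are [y_N] in the ball with [phi_i (y_N) >= e'] for all [i <= N]. The
    norms of the [phi_i] restricted to sets of scales are uniformly absolutely continuous by
    Rosenthal's lemma and the Vitali-Hahn-Saks argument, since elements with disjoint scales glue.
    By the parallelogram law the convex sets [{y | phi_i (y) >= e' for i <= N}] contain elements
    whose differences [z] are small in quadratic mean, for Lebesgue-type means on the scales as well
    as for finitely many [|phi_i|]. Up to parts that are small for all the [phi_i], such a [z] lives
    on a set [A] of small measure at every scale. Hence a sequence of such sets has its union [E]
    in the space, and on the order interval of [\1_E] a second Vitali-Hahn-Saks argument
    contradicts the lower bound for [phi_i (z)]. *)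
Require Import Defs.
From HB Require Import structures.
From mathcomp Require Import all_boot all_order all_algebra.
From mathcomp Require Import all_classical all_reals all_analysis.
From mathcomp Require Import measurable_realfun ring lra.
Set Implicit Arguments. Unset Strict Implicit. Unset Printing Implicit Defensive.
Import Order.TTheory GRing.Theory Num.Theory.
Import numFieldNormedType.Exports.
Local Open Scope classical_set_scope.
Local Open Scope ring_scope.

(** * Finitely additive set functions *)


(** The growth condition is used in the form [2 * psi1 t <= psi1 (N * t)]: the quotient [psi1 t / t]
    loses at most the factor [b = N / 2] when [t] grows by [N]. One more power of [b] in height then
    divides the admissible measure by [N], so the masses [b ^ j * level j] decay like [2 ^- j] at
    high scales. This makes the sum over the scales converge, and it makes the sum small in norm
    when all slices are uniformly small. The obstacle is that quadratic means cannot be made small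
    at infinitely many scales at once, but only on average against finitely many functionals. Hence
    a uniform continuity statement over sets of scales, which disposes of the exceptional scales,
    has to precede the one over subsets of [E]. Smallness in measure keeps [\1_E] in the ball, and
    smallness for the moduli of the first functionals feeds the second statement. Both statements
    come from one lemma on finitely additive contents. *)

Section VitaliHahnSaks.
Variables (R : realType) (U : Type) (F : set (set U)).
Variables (mu : nat -> set U -> R) (C : R).
Hypotheses (F0 : F set0)
  (FD : forall A B, F A -> F B -> F (A `\` B))
  (Fbigcup : forall A : nat -> set U, (forall n, F (A n)) -> F (\bigcup_n A n)).
Hypotheses (mu_ge0 : forall i A, F A -> 0 <= mu i A)
  (mu_setU : forall i A B, F A -> F B -> A `&` B = set0 ->
    mu i (A `|` B) = mu i A + mu i B)
  (mu_le : forall i A, F A -> mu i A <= C).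

Lemma setring_setU A B : F A -> F B -> F (A `|` B).
Proof.
move=> FA FB; rewrite -bigcup2E; apply: Fbigcup => -[|[|n]] //=.
Qed.

Lemma setring_setI A B : F A -> F B -> F (A `&` B).
Proof. by move=> FA FB; rewrite -setDD; apply: FD => //; exact: FD. Qed.

Lemma setring_bigcup (P : set nat) (A : nat -> set U) :
  (forall n, F (A n)) -> F (\bigcup_(n in P) A n).
Proof.
move=> FA; rewrite bigcup_mkcond; apply: Fbigcup => n.
by case: ifP.
Qed.

Lemma setring_bigcup_ord n (A : nat -> set U) :
  (forall n, F (A n)) -> F (\big[setU/set0]_(i < n) A i).
Proof.
move=> FA; elim: n => [|n IH]; first by rewrite big_ord0.
by rewrite big_ord_recr; exact: setring_setU.
Qed.

Lemma content_le i A B : F A -> F B -> A `<=` B -> mu i A <= mu i B.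
Proof.
move=> FA FB AB; rewrite -(setDUK AB) mu_setU ?setDIK//; last exact: FD.
by rewrite lerDl mu_ge0//; exact: FD.
Qed.

Lemma content_setD i A B : F A -> F B -> mu i A <= mu i (A `\` B) + mu i B.
Proof.
move=> FA FB; have FAB := FD FA FB; have FI := setring_setI FA FB.
rewrite -{1}(setDUK (@subIsetl _ A B)) mu_setU ?setDIK//; last exact: FD.
rewrite setDIr setDv set0U addrC lerD2l; exact: content_le.
Qed.

Lemma content_setU_le i A B : F A -> F B -> mu i (A `|` B) <= mu i A + mu i B.
Proof.
move=> FA FB; apply: (le_trans (content_setD i (setring_setU FA FB) FB)).
rewrite lerD2r; apply: content_le => //; first exact/FD/FB/setring_setU.
by rewrite setDUl setDv setU0; exact: subDsetl.
Qed.

Lemma content_bigcup_le i n (A : nat -> set U) : (forall n, F (A n)) ->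
  mu i (\big[setU/set0]_(k < n) A k) <= mu i set0 + \sum_(k < n) mu i (A k).
Proof.
move=> FA; elim: n => [|n IH]; first by rewrite !big_ord0 addr0.
rewrite !big_ord_recr/= addrA.
apply: (le_trans (content_setU_le i (setring_bigcup_ord n FA) (FA n))).
by rewrite lerD2r.
Qed.

Lemma content0 i : mu i set0 = 0.
Proof.
have := mu_setU i F0 F0 (setI0 _); rewrite setU0 => /eqP.
by rewrite -subr_eq0 opprD addrA subrr sub0r oppr_eq0 => /eqP.
Qed.

Lemma content_trivIset i (D : nat -> set U) n : (forall n, F (D n)) ->
  trivIset setT D -> mu i (\big[setU/set0]_(k < n) D k) = \sum_(k < n) mu i (D k).
Proof.
move=> FA tD; elim: n => [|n IH]; first by rewrite !big_ord0 content0.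
rewrite !big_ord_recr/= mu_setU ?IH//; first exact: setring_bigcup_ord.
rewrite -subset0 => x [] /=; rewrite -bigcup_mkord => -[k /= kn Dk] Dn.
by move: kn; rewrite (tD k n)// ?ltnn//; exists x.
Qed.

(* Rosenthal's lemma: split the indices into infinitely many infinite blocks; if no block
   works, one bad index per block gives a subsequence whose total masses drop by [e]. *)
Lemma rosenthal_subsequence (D : nat -> set U) (iota : nat -> nat) (e : R) :
  0 < e -> (forall n, F (D n)) -> trivIset setT D ->
  exists2 f : nat -> nat, injective f &
    forall k, mu (iota (f k)) (\bigcup_(l in [set l | l != k]) D (f l)) <= e.
Proof.
move=> e0 FDn tD.
have [n Cn] : exists n : nat, C <= n%:R * e.
  exists (Num.truncn (C / e)).+1; rewrite -ler_pdivrMr//.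
  by apply/ltW/truncnS_gt.
suff H : forall f : nat -> nat, injective f ->
    (forall k, mu (iota (f k)) (\bigcup_l D (f l)) <= n%:R * e) ->
    exists2 f' : nat -> nat, injective f' &
    forall k, mu (iota (f' k)) (\bigcup_(l in [set l | l != k]) D (f' l)) <= e.
  apply: (H id) => // k; apply: le_trans Cn; apply: mu_le.
  exact: setring_bigcup.
elim: n {Cn} => [|n IH] f finj fb.
  exists f => // k; apply: le_trans (ltW e0); rewrite -[leRHS](mul0r e).
  apply: le_trans (fb k); apply: content_le; try exact: setring_bigcup.
  by apply: bigcup_subset.
pose g (p q : nat) := f (pickle (p, q)).
have ginj p q p' q' : g p q = g p' q' -> (p, q) = (p', q').
  by move=> /finj /(pcan_inj pickleK).
have [[p hp]|hn] := pselect (exists p, forall q,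
    mu (iota (g p q)) (\bigcup_(l in [set l | l != q]) D (g p l)) <= e).
  by exists (g p) => // q q' /ginj [].
have /choice[q hq] : forall p, exists q,
    e < mu (iota (g p q)) (\bigcup_(l in [set l | l != q]) D (g p l)).
  move=> p; apply: contrapT => h; apply: hn; exists p => q.
  by rewrite leNgt; apply/negP => h'; apply: h; exists q.
have [||f' f'inj hf'] := IH (fun p => g p (q p)).
- by move=> p p' /ginj [].
- move=> p.
  set A := \bigcup_l _; set B := \bigcup_(l in [set l | l != q p]) D (g p l).
  have FA : F A by exact: setring_bigcup.
  have FB : F B by exact: setring_bigcup.
  have AB0 : A `&` B = set0.
    rewrite -subset0 => x [[p' _ Dx] [l /= lq Dl]].
    have /ginj[_ ql] := tD _ _ I I (ex_intro _ x (conj Dx Dl)).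
    have /ginj[pp _] := tD _ _ I I (ex_intro _ x (conj Dx Dl)).
    by move: lq; rewrite -ql pp eqxx.
  have := fb (pickle (p, q p)); rewrite -natr1 mulrDl mul1r => h.
  have := hq p; rewrite -/B => h2.
  rewrite -(lerD2r e); apply: le_trans h; apply: (@le_trans _ _ (mu (iota (g p (q p))) (A `|` B))).
    by rewrite mu_setU// lerD2l ltW.
  apply: content_le; [exact: setring_setU|exact: setring_bigcup|].
  by move=> x [[l _ Dl]|[l /= _ Dl]]; [exists (pickle (l, q l))|exists (pickle (p, l))].
- by exists f'.
Qed.

(** This takes the place of setwise convergence, which the contents do not have: they will be moduli
    of a weak-* null sequence. In the application [u i] is the value of the [i]-th functional at one
    element glued from near-optimal tests on the sets [D k]. *)
Hypothesis glue : forall (D : nat -> set U) (iota : nat -> nat) (e : R),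
  (forall k, F (D k)) -> trivIset setT D -> (forall k, e < mu (iota k) (D k)) ->
  exists2 u : nat -> R, u @ \oo --> 0 &
    forall k, e <= u (iota k)
                   + mu (iota k) (\bigcup_(l in [set l | l != k]) D l).

(** After Rosenthal's lemma the other sets weigh at most [e / 2], so [glue] leaves
    [e / 2 <= u (iota (f k))], and [u] tending to 0 confines the indices to those below some [i0].
    Finitely many bounded contents cannot carry infinitely many disjoint sets of mass above [e]; as
    [iota] may repeat values, the end sums over all the contents below [i0]. *)
Lemma exhaustive (D : nat -> set U) (iota : nat -> nat) (e : R) :
  0 < e -> (forall n, F (D n)) -> trivIset setT D ->
  ~ (forall k, e < mu (iota k) (D k)).
Proof.
move=> e0 FDn tD he.
have e20 : 0 < e / 2 by rewrite divr_gt0.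
have [f finj hf] := rosenthal_subsequence iota e20 FDn tD.
have tDf : trivIset setT (D \o f).
  move=> k l _ _ /= [x [Dk Dl]]; apply: finj.
  by apply: tD => //; exists x.
have [u u0 hu] := @glue (D \o f) (iota \o f) e (fun k => FDn (f k)) tDf (fun k => he (f k)).
have [i0 _ hi0] : \forall i \near \oo, u i < e / 2.
  by move/cvgrPdist_lt : u0 => /(_ _ e20); apply: filterS => i;
    rewrite sub0r normrN => /ltr_normlW.
have ib k : (iota (f k) < i0)%N.
  rewrite ltnNge; apply/negP => /hi0 /=; apply/negP; rewrite -leNgt.
  have := hu k; have := hf k => /=; lra.
pose s k := \sum_(i < i0) mu i (D (f k)).
have hs k : e < s k.
  apply: (lt_le_trans (he (f k))).
  rewrite /s (bigD1 (Ordinal (ib k)))//= lerDl sumr_ge0// => i _.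
  exact: mu_ge0.
have hS n : \sum_(k < n) s k <= i0%:R * C.
  rewrite exchange_big/= -[i0 in leRHS]card_ord mulr_natl -sumr_const.
  apply: ler_sum => i _; rewrite -(@content_trivIset i (D \o f) n) //; last by move=> k; exact: FDn.
  by apply: mu_le; apply: (@setring_bigcup_ord n (D \o f)) => k; exact: FDn.
have hn n : n%:R * e <= i0%:R * C.
  apply: le_trans (hS n); rewrite -[n in leLHS]card_ord mulr_natl -sumr_const.
  by apply: ler_sum => k _; exact/ltW/hs.
have := hn (Num.truncn (i0%:R * C / e)).+1.
by rewrite -ler_pdivlMr// leNgt truncnS_gt.
Qed.

(** Otherwise successive differences along a subsequence are disjoint, each of mass above [e] for
    some content, against [exhaustive]. *)
Lemma increasing_uniform_cauchy (G : nat -> set U) (e : R) :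
  0 < e -> (forall n, F (G n)) -> {homo G : m n / (m <= n)%N >-> m `<=` n} ->
  exists m, forall n i, (m <= n)%N -> mu i (G n `\` G m) <= e.
Proof.
move=> e0 FG Gnd; apply: contrapT => h.
have /choice[nx hnx] : forall m, exists ni, (m <= ni.1)%N /\ e < mu ni.2 (G ni.1 `\` G m).
  move=> m; apply: contrapT => h'; apply: h; exists m => n i mn.
  by rewrite leNgt; apply/negP => h''; apply: h'; exists (n, i).
pose m k := iter k (fun m => (nx m).1) 0%N.
have mle k l : (k <= l)%N -> (m k <= m l)%N.
  elim: l => [|l IH]; first by rewrite leqn0 => /eqP ->.
  rewrite leq_eqVlt => /orP[/eqP -> //|]; rewrite ltnS => /IH h1.
  by apply: (leq_trans h1); exact: (hnx (m l)).1.
apply: (@exhaustive (fun k => G (m k.+1) `\` G (m k)) (fun k => (nx (m k)).2) e) => //.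
- by move=> k; exact: FD.
- apply: ltn_trivIset => l k lk; rewrite -subset0 => x [[Gl _] [_ Gk]].
  by apply: Gk; apply: Gnd Gl; exact: mle.
- by move=> k; exact: (hnx (m k)).2.
Qed.

Lemma decreasing_uniform_cauchy (G : nat -> set U) (e : R) :
  0 < e -> (forall n, F (G n)) -> {homo G : m n / (m <= n)%N >-> n `<=` m} ->
  exists m, forall n i, (m <= n)%N -> mu i (G m `\` G n) <= e.
Proof.
move=> e0 FG Gni.
have [||m hm] := @increasing_uniform_cauchy (fun n => G 0%N `\` G n) _ e0.
- by move=> n; exact: FD.
- by move=> n m nm x [G0 Gn]; split => // /(Gni _ _ nm).
exists m => n i mn; apply: le_trans (hm n i mn); apply: content_le.
- exact: FD.
- by apply: FD; exact: FD.
- move=> x [Gm Gn]; split; first by split=> //; apply: Gni Gm.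
  by move=> [_]; apply.
Qed.

(** The contents are only finitely additive, so the limit superior of the [A k] is replaced by
    finite unions [H k] that absorb every [A l] with [l >= k] up to [d k], uniformly in [i]. The
    intersections [Rk k] of [H 0], ..., [H k] decrease and keep mass [e / 2] for some content. By
    the uniform Cauchy property one fixed content keeps [e / 4] on all late ones, whereas its mass
    on [H k] tends to 0. *)
Lemma uniform_absolute_continuity (A : nat -> set U) (e : R) :
  0 < e -> (forall k, F (A k)) ->
  (forall k i, (i <= k)%N -> mu i (A k) <= 2 ^- k) ->
  ~ (forall k, exists i, e <= mu i (A k)).
Proof.
move=> e0 FA small big.
pose G k m := \big[setU/set0]_(l < m) A (k + l)%N.
have FG k m : F (G k m) by exact: (@setring_bigcup_ord m (fun l => A (k + l)%N)).
have Gnd k : {homo G k : m n / (m <= n)%N >-> m `<=` n}.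
  move=> m n mn x; rewrite /G -!(bigcup_mkord _ (fun l => A (k + l)%N)) => -[l /= lm Al].
  by exists l => //=; exact: leq_trans mn.
(* The defects [d l] sum to at most [e / 2], half of the mass available on each [A k]. *)
pose d k : R := e / 4 * 2 ^- k.
have d0 k : 0 < d k by rewrite /d mulr_gt0// ?divr_gt0// invr_gt0 exprn_gt0.
have /choice[m hm] k := increasing_uniform_cauchy (d0 k) (FG k) (Gnd k).
pose H k := G k (m k).
have FH k : F (H k) by exact: FG.
have AH k l i : (k <= l)%N -> mu i (A l `\` H k) <= d k.
  move=> kl; apply: (@le_trans _ _ (mu i (G k (maxn (m k) (l - k).+1) `\` H k))).
    apply: content_le; [exact: FD|exact: FD|] => x [Al nH]; split => //.
    rewrite /G -(bigcup_mkord _ (fun l => A (k + l)%N)); exists (l - k)%N => /=.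
      by rewrite leq_max leqnn orbT.
    by rewrite subnKC.
  by apply: hm; exact: leq_maxl.
pose Rk k := \bigcap_(l in [set l | (l <= k)%N]) H l.
pose Q k := \big[setU/set0]_(l < k.+1) (A k `\` H l).
have RkE k : A k `\` Rk k = Q k.
  rewrite /Q -(bigcup_mkord k.+1 (fun l => A k `\` H l)).
  apply/seteqP; split => x [].
    move=> Ax /existsNP[l /not_implyP[/= lk nH]]; exists l => //=.
  by move=> l /= lk [Ax nH]; split => // h; exact/nH/h.
have FR k : F (Rk k).
  rewrite /Rk; elim: k => [|k IH].
    rewrite (_ : [set l | _] = [set 0%N]) ?bigcap_set1; first exact: FG.
    by apply/seteqP; split => l /=; rewrite leqn0 => /eqP.
  rewrite (_ : [set l | _] = [set l | (l <= k)%N] `|` [set k.+1]).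
    by rewrite bigcap_setU bigcap_set1; apply: setring_setI => //; exact: FG.
  apply/seteqP; split => l /=.
    by rewrite leq_eqVlt => /orP[/eqP ->|]; [right|left].
  by case=> [/leqW//|->].
have geo n : \sum_(l < n) (2 : R) ^- l <= 2.
  suff -> : \sum_(l < n) (2 : R) ^- l = 2 - 2 * 2 ^- n.
    by rewrite gerBl mulr_ge0// invr_ge0 exprn_ge0.
  elim: n => [|n IH]; first by rewrite big_ord0 expr0 invr1; lra.
  rewrite big_ord_recr/= IH exprS invfM; lra.
have QF i k : mu i (Q k) <= e / 2.
  have FAH l : F (A k `\` H l) by apply: FD => //; exact: FG.
  apply: (le_trans (content_bigcup_le i k.+1 FAH)); rewrite content0 add0r.
  apply: (@le_trans _ _ (\sum_(l < k.+1) d l)).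
    by apply: ler_sum => l _; apply: AH; rewrite -ltnS.
  rewrite -mulr_sumr; have := geo k.+1; nra.
have Rbig k : exists i, e / 2 <= mu i (Rk k).
  have [i hi] := big k; exists i.
  have := content_setD i (FA k) (FR k); rewrite RkE; have := QF i k; lra.
have Rni : {homo Rk : m n / (m <= n)%N >-> n `<=` m}.
  by move=> k l kl x Rx j /= jk; apply: Rx => /=; exact: leq_trans kl.
have e40 : 0 < e / 4 by rewrite divr_gt0.
have [k0 hk0] := decreasing_uniform_cauchy e40 FR Rni.
have [i hi] := Rbig k0.
have Rlow k : (k0 <= k)%N -> e / 4 <= mu i (Rk k).
  move=> kk; have := hk0 k i kk; have := content_setD i (FR k0) (FR k); lra.
have Rup k : (i <= k)%N -> mu i (Rk k) <= 2 * 2 ^- k.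
  move=> ik; apply: (@le_trans _ _ (mu i (H k))).
    by apply: content_le => // x; apply => /=.
  apply: (le_trans (content_bigcup_le i (m k) (fun l => FA (k + l)%N))).
  rewrite content0 add0r.
  apply: (@le_trans _ _ (\sum_(l < m k) 2 ^- k * 2 ^- l)).
    apply: ler_sum => l _; apply: (le_trans (small (k + l)%N i _)).
      exact: leq_trans (leq_addr _ _).
    by rewrite exprD invfM.
  rewrite -mulr_sumr [leRHS]mulrC; apply: ler_wpM2l (geo _).
  by rewrite invr_ge0 exprn_ge0.
have [n hn] : exists n : nat, (2 : R) ^- n < e / 8.
  exists (Num.truncn (8 / e)).+1; rewrite -[ltRHS]invrK ltf_pV2 ?posrE ?exprn_gt0 ?invr_gt0 ?divr_gt0//.
  rewrite invf_div; apply: (lt_le_trans (truncnS_gt _)).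
  by rewrite -natrX ler_nat ltnW// ltn_expl.
pose k := maxn (maxn k0 i) n.
have h1 := Rlow k; have h2 := Rup k.
have h3 : (2 : R) ^- k <= 2 ^- n.
  rewrite lef_pV2 ?posrE ?exprn_gt0// ler_weXn2l ?ler1n// leq_max leqnn orbT//.
have {}h1 := h1 (leq_trans (leq_maxl _ _) (leq_maxl _ _)).
have {}h2 := h2 (leq_trans (leq_maxr _ _) (leq_maxl _ _)).
lra.
Qed.

End VitaliHahnSaks.

(** * Moduli of functionals *)


(** [M] holds the nonnegative multipliers, [W] the test functions. There will be two instances:
    multipliers depending on the scale alone, tested on the unit ball, and nonnegative elements of
    the space, tested on functions bounded by 1. [test_avg] merges two tests into one, which makes
    the modulus additive. *)
Record modulus_axioms (R : realType) (U : Type) (M W : set (U -> R))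
    (phi : (U -> R) -> R) : Prop := ModulusAxioms {
  mult_ge0 : forall m, M m -> forall u, 0 <= m u;
  mult_add : forall m m', M m -> M m' -> M (fun u => m u + m' u);
  mult_sub : forall m m', M m -> M m' -> (forall u, m u <= m' u) ->
    M (fun u => m' u - m u);
  mult_scale : forall (c : R) m, 0 <= c -> M m -> M (fun u => c * m u);
  test_0 : W (fun=> 0);
  test_opp : forall y, W y -> W (fun u => - y u);
  test_avg : forall m m' y y', M m -> M m' -> W y -> W y' ->
    W (fun u => (m u * y u + m' u * y' u) / (m u + m' u));
  functional_add : forall m m' y y', M m -> M m' -> W y -> W y' ->
    phi (fun u => m u * y u + m' u * y' u) =
    phi (fun u => m u * y u) + phi (fun u => m' u * y' u);
  functional_scale : forall (c : R) m y, M m -> W y ->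
    phi (fun u => c * (m u * y u)) = c * phi (fun u => m u * y u);
  functional_bounded : forall m, M m ->
    exists C : R, forall y, W y -> phi (fun u => m u * y u) <= C }.

Section Modulus.
Variables (R : realType) (U : Type) (M W : set (U -> R)) (phi : (U -> R) -> R).
Hypothesis ax : modulus_axioms M W phi.
Let M_ge0 := mult_ge0 ax.
Let M_add := mult_add ax.
Let M_sub := mult_sub ax.
Let M_scale := mult_scale ax.
Let W_0 := test_0 ax.
Let W_opp := test_opp ax.
Let W_avg := test_avg ax.
Let phi_add := functional_add ax.
Let phi_scale := functional_scale ax.
Let phi_bounded := functional_bounded ax.

Definition modulus (m : U -> R) : R := sup [set phi (fun u => m u * y u) | y in W].

Lemma modulus_ub m y : M m -> W y -> phi (fun u => m u * y u) <= modulus m.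
Proof.
move=> Mm Wy; apply: ub_le_sup; last by exists y.
have [C hC] := phi_bounded Mm.
by exists C => _ [y' Wy' <-]; exact: hC.
Qed.

Lemma modulus_lub m c : (forall y, W y -> phi (fun u => m u * y u) <= c) ->
  modulus m <= c.
Proof.
move=> h; apply: ge_sup.
  by exists (phi (fun u => m u * 0)); exists (fun=> 0).
by move=> _ [y Wy <-]; exact: h.
Qed.

Lemma modulus_norm m y : M m -> W y -> `|phi (fun u => m u * y u)| <= modulus m.
Proof.
move=> Mm Wy; rewrite ler_norml modulus_ub// andbT lerNl -mulN1r -phi_scale//.
rewrite (_ : (fun u => _) = (fun u => m u * (- y u))).
  by apply: modulus_ub => //; exact: W_opp.
by apply/funext => u; rewrite mulN1r mulrN.
Qed.

Lemma modulus_ge0 m : M m -> 0 <= modulus m.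
Proof. by move=> Mm; exact: le_trans (normr_ge0 _) (modulus_norm Mm W_0). Qed.

Lemma modulusD m m' : M m -> M m' ->
  modulus (fun u => m u + m' u) = modulus m + modulus m'.
Proof.
move=> Mm Mm'; apply/eqP; rewrite eq_le; apply/andP; split.
  apply: modulus_lub => y Wy.
  rewrite (_ : (fun u => _) = (fun u => m u * y u + m' u * y u)).
    by rewrite phi_add// lerD// modulus_ub.
  by apply/funext => u; rewrite mulrDl.
rewrite -lerBrDl; apply: modulus_lub => y' Wy'.
rewrite lerBrDl -lerBrDr; apply: modulus_lub => y Wy.
rewrite lerBrDr -phi_add//.
rewrite (_ : (fun u => _) = (fun u => (m u + m' u) *
    ((m u * y u + m' u * y' u) / (m u + m' u)))).
  by apply: modulus_ub; [exact: M_add|exact: W_avg].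
(* Where [m + m'] vanishes both multipliers are 0 by nonnegativity, so the value 0 of the quotient
   is harmless there. *)
apply/funext => u; have [s0|s0] := eqVneq (m u + m' u) 0; last first.
  by rewrite [RHS]mulrC divfK.
rewrite s0 mul0r; move/eqP : s0; rewrite paddr_eq0 ?M_ge0//.
by move=> /andP[/eqP -> /eqP ->]; rewrite !mul0r addr0.
Qed.

Lemma modulus_le m m' : M m -> M m' -> (forall u, m u <= m' u) ->
  modulus m <= modulus m'.
Proof.
move=> Mm Mm' mm'; have MB := M_sub Mm Mm' mm'.
rewrite [leRHS](_ : _ = modulus (fun u => m u + (m' u - m u))).
  by rewrite modulusD// lerDl modulus_ge0.
by congr modulus; apply/funext => u; rewrite subrKC.
Qed.

Lemma modulusZ c m : 0 < c -> M m -> modulus (fun u => c * m u) = c * modulus m.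
Proof.
move=> c0 Mm.
have le_c (b : R) m' : 0 < b -> M m' -> modulus (fun u => b * m' u) <= b * modulus m'.
  move=> b0 Mm'; apply: modulus_lub => y Wy.
  under eq_fun do rewrite -mulrA.
  by rewrite phi_scale// ler_wpM2l ?modulus_ub// ltW.
apply/eqP; rewrite eq_le le_c//= -ler_pdivlMl//.
rewrite {1}(_ : m = (fun u => c^-1 * (c * m u))).
  by apply: le_c; [rewrite invr_gt0|apply: M_scale => //; exact: ltW].
by apply/funext => u; rewrite mulKf// gt_eqF.
Qed.

(** Additivity carries a pointwise parallelogram identity between multipliers over to the modulus,
    so moduli of squares behave as quadratic forms. *)
Lemma modulus_parallelogram m1 m2 m3 m4 : M m1 -> M m2 -> M m3 -> M m4 ->
  (forall u, 4 * m1 u + m2 u = 2 * m3 u + 2 * m4 u) ->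
  4 * modulus m1 + modulus m2 = 2 * modulus m3 + 2 * modulus m4.
Proof.
move=> M1 M2 M3 M4 e; have M4' := M_scale _ M1 => //.
rewrite -!modulusZ// -!modulusD//; try exact: M_scale.
by congr modulus; apply/funext => u; exact: e.
Qed.

End Modulus.

Section ModulusSequence.
Variables (R : realType) (U : Type) (M W : set (U -> R)) (phi : nat -> (U -> R) -> R).
Variables (F : set (set U)) (C : R).
Hypothesis ax : forall i, modulus_axioms M W (phi i).
Hypotheses (F0 : F set0)
  (FD : forall A B, F A -> F B -> F (A `\` B))
  (Fbigcup : forall A : nat -> set U, (forall n, F (A n)) -> F (\bigcup_n A n))
  (F_indic : forall A, F A -> M \1_A)
  (W_glue : forall (D : nat -> set U) (z : nat -> U -> R), (forall k, F (D k)) ->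
     trivIset setT D -> (forall k, W (z k)) ->
     exists2 y, W y & forall k u, D k u -> y u = z k u)
  (phi_cvg : forall A y, F A -> W y -> phi i (fun u => \1_A u * y u) @[i --> \oo] --> 0)
  (phi_le : forall i A y, F A -> W y -> phi i (fun u => \1_A u * y u) <= C).

(** Near-optimal tests on disjoint sets glue to a single [y], to which the convergence applies. The
    part of [y] off [D k] costs at most the modulus of the union of the other sets, which is what
    [glue] demands. *)
Lemma modulus_uniform_absolute_continuity (A : nat -> set U) (e : R) :
  0 < e -> (forall k, F (A k)) ->
  (forall k i, (i <= k)%N -> modulus W (phi i) \1_(A k) <= 2 ^- k) ->
  ~ (forall k, exists i, e <= modulus W (phi i) \1_(A k)).
Proof.
apply: (@uniform_absolute_continuity R U F (fun i A => modulus W (phi i) \1_A) C) => //.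
- by move=> i B FB; exact: (modulus_ge0 (ax i) (F_indic FB)).
- move=> i B D FB FD' BD0; rewrite -(modulusD (ax i)); [|exact: F_indic|exact: F_indic].
  congr modulus; apply/funext => u; rewrite !indicE !in_setU.
  have : ~ (B `&` D) u by rewrite BD0.
  case: (boolP (u \in B)) => [/set_mem uB|uB]; case: (boolP (u \in D)) => [/set_mem uD|uD] //= h;
    by rewrite ?addr0 ?add0r //; exfalso; exact: h.
- by move=> i B FB; apply: (modulus_lub (ax i)) => y; exact: phi_le.
- move=> D iota d FDk tD hd.
  have /choice[z hz] : forall k, exists z, W z /\ d < phi (iota k) (fun u => \1_(D k) u * z u).
    move=> k; have := hd k; rewrite /modulus => /sup_gt[].
      by exists (phi (iota k) (fun u => \1_(D k) u * 0)); exists (fun=> 0) => //; exact: test_0 (ax 0%N).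
    by move=> _ [z Wz <-] h; exists z.
  have [y Wy hy] := W_glue FDk tD (fun k => (hz k).1).
  exists (fun i => phi i (fun u => \1_(\bigcup_k D k) u * y u)).
    by apply: phi_cvg => //; exact: Fbigcup.
  move=> k; set E := \bigcup_(l in [set l | l != k]) D l.
  have FE : F E.
    rewrite /E bigcup_mkcond; apply: Fbigcup => n.
    by case: ifP.
  rewrite (_ : (fun u => _) = (fun u => \1_(D k) u * z k u + \1_E u * y u)).
    rewrite (functional_add (ax _))//; [|exact: F_indic|exact: F_indic|exact: (hz k).1].
    rewrite -addrA; apply: (le_trans (ltW (hz k).2)); rewrite lerDl.
    rewrite -lerBlDr sub0r lerNl.
    have := modulus_norm (ax (iota k)) (F_indic FE) Wy.
    by rewrite ler_norml lerNl => /andP[].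
  apply/funext => u; rewrite !indicE.
  have [Du|Du] := pselect (D k u).
    have Du' : (\bigcup_k D k) u by exists k.
    rewrite (mem_set Du) (mem_set Du') (hy k)// [u \in E]memNset ?mul0r ?addr0//.
    move=> [l /= /eqP lk Dl]; apply: lk; apply: tD => //.
    by exists u.
  rewrite [in X in _ = X + _]memNset// mul0r add0r; congr ((nat_of_bool _)%:R * _).
  apply/idP/idP => /set_mem[l _ Dl]; apply/mem_set; exists l => //=.
  by apply/eqP => lk; apply: Du; rewrite -lk.
Qed.

End ModulusSequence.

(** * Mazur- and Helly-type approximation in convex sets *)

Section MazurHelly.
Variable R : realType.

(* Midpoint-convex decreasing sets: near-minimisers of a quadratic form [q] are close by the
   parallelogram law. *)
Lemma decreasing_convex_near (V : Type) (add sub : V -> V -> V) (half : V -> V)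
    (q : V -> R) (S : nat -> set V) (B : R) :
  (forall v, S 0%N v -> 0 <= q v <= B) ->
  {homo S : m n / (m <= n)%N >-> n `<=` m} ->
  (forall n, S n !=set0) ->
  (forall n v w, S n v -> S n w -> S n (half (add v w))) ->
  (forall v w, S 0%N v -> S 0%N w ->
     4 * q (half (add v w)) + q (sub v w) = 2 * q v + 2 * q w) ->
  forall e, 0 < e -> exists m v, S m v /\
    forall n, (m <= n)%N -> exists2 w, S n w & q (sub w v) <= e.
Proof.
move=> qB Sni Sne Sconv par e e0.
pose d n := inf (q @` S n).
have S0 n v : S n v -> S 0%N v by apply: Sni.
have hlb n v : S n v -> d n <= q v.
  move=> Sv; apply: ge_inf; last by exists v.
  by exists 0 => _ [w /S0 /qB /andP[h _] <-].
have hadh n c : 0 < c -> exists2 v, S n v & q v < d n + c.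
  move=> c0; have [||_ [v Sv <-] h] := @inf_adherent _ (q @` S n) c.
  - exact: c0.
  - split; first by have [v Sv] := Sne n; exists (q v); exists v.
    by exists 0 => _ [w /S0 /qB /andP[h _] <-].
  by exists v.
have dB n : d n <= B.
  by have [v Sv] := Sne n; apply: (le_trans (hlb _ _ Sv)); have /andP[] := qB _ (S0 _ _ Sv).
have e80 : 0 < e / 8 by rewrite divr_gt0.
have hsup : has_sup (range d).
  by split; [exists (d 0%N); exists 0%N|exists B => _ [n _ <-]].
have [_ [m _ <-] hm] := sup_adherent e80 hsup.
have [v Sv qv] := hadh m _ e80.
exists m, v; split => // n mn.
have [w Sw qw] := hadh n _ e80.
exists w => //.
have := par _ _ (S0 _ _ Sw) (S0 _ _ Sv).
have := hlb m _ (Sconv m _ _ (Sni _ _ mn _ Sw) Sv).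
have : d n <= sup (range d) by apply: ub_le_sup; [exact: hsup.2|exists n].
lra.
Qed.

(** Minimising the squared distance from [v] takes the place of a separation theorem. From a
    near-minimiser [s], a step of length [t] towards an [s'] that nearly maximises the functional
    [v - s] gains at least [2 * t * (3 / 4 * e)] to first order and costs at most [t * e / 2] to
    second order. The net gain [t * e] exceeds the defect [t * e / 2] of [s]. *)
Lemma helly_approx (n : nat) (S : set ('I_n -> R)) (v : 'I_n -> R) (B : R) :
  S !=set0 ->
  (forall s i, S s -> `|s i| <= B) ->
  (forall s s' t, S s -> S s' -> 0 <= t <= 1 -> S (fun i => (1 - t) * s i + t * s' i)) ->
  (forall (u : 'I_n -> R) d, 0 < d ->
     exists2 s, S s & \sum_i u i * v i <= \sum_i u i * s i + d) ->
  forall e, 0 < e -> exists2 s, S s & \sum_i (v i - s i) ^+ 2 < e.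
Proof.
move=> [s0 Ss0] SB Sconv Ssup e e0; apply: contrapT => hn.
pose q s := \sum_i (v i - s i) ^+ 2.
have qe s : S s -> e <= q s.
  by move=> Ss; rewrite leNgt; apply/negP => h; apply: hn; exists s.
(* [D] bounds the squared distance between points of [S]; the step [t] is chosen for
   [t * D <= e / 2]. *)
pose D : R := n%:R * (2 * B) ^+ 2.
have D0 : 0 <= D by rewrite mulr_ge0// sqr_ge0.
pose t := e / (2 * D + e).
have De : 0 < 2 * D + e by lra.
have t0 : 0 < t by rewrite divr_gt0.
have t1 : t <= 1 by rewrite ler_pdivrMr// mul1r; lra.
have tD : t * D <= e / 2.
  by rewrite /t mulrAC ler_pdivrMr//; nra.
have lbq : has_lbound (q @` S) by exists e => _ [s Ss <-]; exact: qe.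
have [||_ [s Ss <-] hs] := @inf_adherent _ (q @` S) (t * e / 2).
- by rewrite divr_gt0// mulr_gt0.
- by split => //; exists (q s0); exists s0.
have [s' Ss' hs'] := Ssup (fun i => v i - s i) (e / 4) (divr_gt0 e0 (ltr0n _ 4)).
pose w i := s' i - s i.
have Ew : \sum_i (v i - s i) * w i = \sum_i (v i - s i) * s' i - \sum_i (v i - s i) * v i + q s.
  rewrite -sumrB -big_split/=; apply: eq_bigr => i _; rewrite /w; ring.
have Ew2 : \sum_i w i ^+ 2 <= D.
  rewrite /D -[n in leRHS]card_ord mulr_natl -sumr_const; apply: ler_sum => i _.
  rewrite -real_normK ?num_real// ler_sqr ?nnegrE//; last first.
    by rewrite mulr_ge0// (le_trans _ (SB _ i Ss)).
  by rewrite mulr_natl mulr2n; apply: (le_trans (ler_normB _ _)); apply: lerD; exact: SB.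
have Eq : q (fun i => (1 - t) * s i + t * s' i) =
    q s - 2 * t * \sum_i (v i - s i) * w i + t ^+ 2 * \sum_i w i ^+ 2.
  rewrite !mulr_sumr -sumrB -big_split/=; apply: eq_bigr => i _; rewrite /w; ring.
have : inf (q @` S) <= q (fun i => (1 - t) * s i + t * s' i).
  apply: ge_inf => //; eexists; last reflexivity.
  by apply: Sconv => //; rewrite t1 ltW.
rewrite Eq; have := qe _ Ss.
move: Ew hs hs' Ew2 tD.
set a := \sum_i _ * w i; set b := \sum_i w i ^+ 2; set I := inf _.
set c := \sum_i _ * s' i; set f := \sum_i _ * v i.
move=> Ew hs hs' Ew2 tD h1 h2.
have h3 : t * b <= e / 2 by apply: le_trans tD; rewrite ler_wpM2l// ltW.
have h4 : t * (t * b) <= t * (e / 2) by rewrite ler_wpM2l// ltW.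
have h5 : t * (3 / 4 * e) <= t * a by rewrite ler_wpM2l ?(ltW t0)//; lra.
have h6 : t ^+ 2 * b = t * (t * b) by ring.
have h7 : 0 < t * e by rewrite mulr_gt0.
lra.
Qed.

End MazurHelly.

(** * Balls over a family of scales *)


Section ScaledBall.
Context {R : realType} {d : measure_display} {T : measurableType d}.
Variables (mu : {measure set T -> \bar R}) (I : Type) (tau : I -> \bar R).
Hypothesis tau_ge0 : forall j, (0 <= tau j)%E.
Implicit Types (y : I * T -> R) (c : R).

Definition slice_measurable y := forall j, measurable_fun setT (fun x => y (j, x)).

Definition scaled_ball c : set (I * T -> R) := [set y : I * T -> R | forall j,
  [/\ measurable_fun setT (fun x => y (j, x)), forall x, `|y (j, x)| <= c &
      (\int[mu]_x `|y (j, x)|%:E <= c%:E * tau j)%E]].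

Definition scaled_space : set (I * T -> R) :=
  [set y : I * T -> R | exists2 c, 0 < c & scaled_ball c y].

Lemma measurable_norm_EFin (f : T -> R) : measurable_fun setT f ->
  measurable_fun setT (fun x => `|f x|%:E).
Proof. by move=> mf; apply/measurable_EFinP; exact: measurableT_comp. Qed.

Lemma scaled_ball_dom c y z : scaled_ball c y -> slice_measurable z ->
  (forall u, `|z u| <= `|y u|) -> scaled_ball c z.
Proof.
move=> By mz zy j; have [my yc iy] := By j; split => //.
  by move=> x; exact: le_trans (zy _) (yc x).
apply: le_trans iy; apply: ge0_le_integral => //; try exact: measurable_norm_EFin.
by move=> x _; rewrite lee_fin.
Qed.

Lemma scaled_ball_le c c' y : 0 <= c -> c <= c' -> scaled_ball c y -> scaled_ball c' y.
Proof.
move=> c0 cc By j; have [my yc iy] := By j; split => //.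
  by move=> x; exact: le_trans (yc x) cc.
by apply: (le_trans iy); apply: lee_wpmul2r => //; rewrite lee_fin.
Qed.

Lemma scaled_ball0 c : 0 <= c -> scaled_ball c (fun=> 0).
Proof.
move=> c0 j; split => [|x|]; first exact: measurable_cst.
  by rewrite normr0.
by rewrite normr0 integral0 mule_ge0// lee_fin.
Qed.

Lemma scaled_ballD c c' y y' : 0 <= c -> 0 <= c' -> scaled_ball c y ->
  scaled_ball c' y' -> scaled_ball (c + c') (fun u => y u + y' u).
Proof.
move=> c0 c'0 By By' j; have [my yc iy] := By j; have [my' yc' iy'] := By' j; split.
- exact: measurable_funD.
- by move=> x; apply: (le_trans (ler_normD _ _)); exact: lerD.
- apply: (@le_trans _ _ (\int[mu]_x (`|y (j, x)|%:E + `|y' (j, x)|%:E))%E).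
    apply: ge0_le_integral => //.
    + by apply: measurable_norm_EFin; exact: measurable_funD.
    + by apply: emeasurable_funD; exact: measurable_norm_EFin.
    + by move=> x _; rewrite -EFinD lee_fin; exact: ler_normD.
  rewrite ge0_integralD//; try exact: measurable_norm_EFin.
  by rewrite EFinD ge0_muleDl// ?lee_fin//; exact: leeD.
Qed.

Lemma scaled_ballZ c a y : scaled_ball c y ->
  scaled_ball (`|a| * c) (fun u => a * y u).
Proof.
move=> By j; have [my yc iy] := By j; split.
- exact: measurable_funM.
- by move=> x; rewrite normrM ler_wpM2l.
- under eq_integral do rewrite normrM EFinM.
  rewrite ge0_integralZl//; last exact: measurable_norm_EFin.
  by rewrite EFinM -muleA; apply: lee_wpmul2l.
Qed.

Lemma scaled_ballN c y : scaled_ball c y -> scaled_ball c (fun u => - y u).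
Proof.
move=> /(@scaled_ballZ _ (-1)); rewrite normrN normr1 mul1r.
by under eq_fun do rewrite mulN1r.
Qed.

Lemma scaled_ball_conv c y y' t : 0 <= c -> scaled_ball c y -> scaled_ball c y' ->
  0 <= t <= 1 -> scaled_ball c (fun u => (1 - t) * y u + t * y' u).
Proof.
move=> c0 By By' /andP[t0 t1].
have t10 : 0 <= 1 - t by rewrite subr_ge0.
have -> : c = `|1 - t| * c + `|t| * c by rewrite !ger0_norm//; ring.
by apply: scaled_ballD; [exact: mulr_ge0|exact: mulr_ge0|exact: scaled_ballZ|exact: scaled_ballZ].
Qed.

Lemma scaled_ball_slices c y : (forall j, exists2 z, scaled_ball c z &
  forall x, y (j, x) = z (j, x)) -> scaled_ball c y.
Proof.
move=> h j; have [z Bz yz] := h j.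
by have := Bz j; under eq_fun do rewrite -yz; under eq_integral do rewrite -yz;
  move=> [? zc ?]; split => // x; rewrite yz.
Qed.

Lemma scaled_ball_indic (E : set (I * T)) :
  (forall j, measurable [set x | E (j, x)]) ->
  (forall j, (mu [set x | E (j, x)] <= tau j)%E) -> scaled_ball 1 \1_E.
Proof.
move=> mE Etau j.
have e1 x : \1_E (j, x) = \1_[set x | E (j, x)] x :> R.
  by rewrite !indicE; congr (nat_of_bool _)%:R; apply/idP/idP => /set_mem h; apply/mem_set.
split.
- by under eq_fun do rewrite e1; exact: measurable_indic.
- by move=> x; rewrite indicE ger0_norm// lern1 leq_b1.
- under eq_integral do rewrite ger0_norm// e1.
  by rewrite mul1e integral_indic// setIT.
Qed.

(** Fatou's lemma on each slice. This closedness supplies the completeness that the uniform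
    boundedness principle needs. *)
Lemma scaled_ball_lim c (y : nat -> I * T -> R) z : (forall n, scaled_ball c (y n)) ->
  (forall u, y n u @[n --> \oo] --> z u) -> scaled_ball c z.
Proof.
move=> By yz j.
have mz : measurable_fun setT (fun x => z (j, x)).
  apply: (@measurable_fun_cvg _ _ _ setT (fun n x => y n (j, x))).
    by move=> n; have [] := By n j.
  by move=> x _; exact: yz.
have nyz u : `|y n u| @[n --> \oo] --> `|z u| by exact: cvg_norm.
split => //.
  move=> x; apply: (@cvgr_to_le _ _ _ _ (fun n => `|y n (j, x)|) _ _ (nyz _)).
  by apply: nearW => n; have [] := By n j.
rewrite (eq_integral (fun x => limn_einf (fun n => `|y n (j, x)|%:E))); last first.
  move=> x _; apply/esym; apply: (cvg_limn_einf_sup _).1.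
  by apply: cvg_EFin; [exact: nearW|exact: nyz].
apply: le_trans (fatou _ _ _ _) _ => //.
  by move=> n; apply: measurable_norm_EFin; have [] := By n j.
rewrite limn_einf_lim; apply: lime_le; first exact: is_cvg_einfs.
apply: nearW => n; apply: (@le_trans _ _ (\int[mu]_x `|y n (j, x)|%:E)%E).
  by apply: ereal_inf_lbound; exists n => /=.
by have [] := By n j.
Qed.

End ScaledBall.


(** * Uniform boundedness of weak-* null sequences *)

Section WeakStarNull.
Context {R : realType} {d : measure_display} {T : measurableType d}.
Variables (mu : {measure set T -> \bar R}) (I : Type) (tau : I -> \bar R).
Hypothesis tau_ge0 : forall j, (0 <= tau j)%E.
Local Notation B := (scaled_ball mu tau).
Local Notation Y := (scaled_space mu tau).
Variable phi : nat -> (I * T -> R) -> R.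
Hypotheses (phi_linear : forall i (a : R) y z, Y y -> Y z ->
    phi i (fun u => a * y u + z u) = a * phi i y + phi i z)
  (phi_bounded : forall i, exists C : R, forall y, B 1 y -> `|phi i y| <= C)
  (phi_cvg0 : forall y, B 1 y -> phi i y @[i --> \oo] --> 0).
Lemma scaled_spaceW c y : 0 <= c -> B c y -> Y y.
Proof.
move=> c0 By; exists (c + 1); first by rewrite ltr_pwDr.
by apply: scaled_ball_le By => //; rewrite lerDl.
Qed.

Lemma scaled_spaceD y z : Y y -> Y z -> Y (fun u => y u + z u).
Proof.
move=> [c c0 By] [c' c'0 Bz]; exists (c + c'); first exact: addr_gt0.
by apply: scaled_ballD => //; exact: ltW.
Qed.

Lemma scaled_spaceZ a y : Y y -> Y (fun u => a * y u).
Proof.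
move=> [c c0 By]; apply: (@scaled_spaceW (`|a| * c)); last exact: scaled_ballZ.
by rewrite mulr_ge0// ltW.
Qed.

Lemma scaled_space0 : Y (fun=> 0).
Proof. by apply: (@scaled_spaceW 1) => //; exact: scaled_ball0. Qed.

Lemma scaled_functional0 i : phi i (fun=> 0) = 0.
Proof.
have := phi_linear i 1 scaled_space0 scaled_space0.
rewrite (_ : (fun _ => 1 * 0 + 0) = (fun=> 0)); first lra.
by apply/funext => u; rewrite mulr0 addr0.
Qed.

Lemma scaled_functionalD i y z : Y y -> Y z ->
  phi i (fun u => y u + z u) = phi i y + phi i z.
Proof.
move=> Yy Yz; rewrite -[X in X + _]mul1r -phi_linear//.
by under [in RHS]eq_fun do rewrite mul1r.
Qed.

Lemma scaled_functionalZ i a y : Y y -> phi i (fun u => a * y u) = a * phi i y.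
Proof.
move=> Yy; rewrite -[RHS]addr0 -(scaled_functional0 i) -phi_linear//; last exact: scaled_space0.
by under [in RHS]eq_fun do rewrite addr0.
Qed.

Lemma scaled_functionalB i y z : Y y -> Y z ->
  phi i (fun u => y u - z u) = phi i y - phi i z.
Proof.
move=> Yy Yz; rewrite -[X in _ - X]mul1r -mulNr -scaled_functionalZ//.
rewrite -scaled_functionalD//; last exact: scaled_spaceZ.
by under [in RHS]eq_fun do rewrite mulN1r.
Qed.

Lemma scaled_functional_le i C c y : (forall y, B 1 y -> `|phi i y| <= C) ->
  0 < c -> B c y -> `|phi i y| <= c * C.
Proof.
move=> hC c0 By.
have /hC : B 1 (fun u => c^-1 * y u).
  have -> : 1 = `|c^-1| * c by rewrite gtr0_norm ?invr_gt0// mulVf// gt_eqF.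
  exact: scaled_ballZ.
rewrite scaled_functionalZ; last by exists c.
by rewrite normrM gtr0_norm ?invr_gt0// ler_pdivrMl.
Qed.

(* The sign of each term makes the partial sums as large as the new term, and the tail of the
   geometric series is too small to undo this. *)
Lemma uniform_boundedness : exists2 C : R, 0 < C & forall i y, B 1 y -> `|phi i y| <= C.
Proof.
apply: contrapT => hn.
pose N i := sup [set `|phi i y| | y in B 1].
have hN i y : B 1 y -> `|phi i y| <= N i.
  move=> By; apply: ub_le_sup; last by exists y.
  by have [C hC] := phi_bounded i; exists C => _ [z Bz <-]; exact: hC.
(* What is added after the [k]-th term has norm at most [rho k / 3]. With [N] the norm of the chosen
   functional, at least [rho k * N / 3] of the gain [rho k * (2 / 3 * N)] survives, and the lower
   bound for [N] makes this at least [k]. *)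
have /choice[f hf] : forall k : nat, exists iy : nat * (I * T -> R),
    [/\ B 1 iy.2, 2 / 3 * N iy.1 < `|phi iy.1 iy.2| & 3 * k%:R * 4 ^+ k.+1 < N iy.1].
  move=> k; pose A : R := 3 * k%:R * 4 ^+ k.+1 + 1.
  have A0 : 0 < A by rewrite ltr_pwDr// !mulr_ge0// exprn_ge0.
  have [i [y0 By0 iy0]] : exists i, exists2 y, B 1 y & A < `|phi i y|.
    apply: contrapT => h; apply: hn; exists A => // i y By.
    by rewrite leNgt; apply/negP => h'; apply: h; exists i, y.
  have AN : A < N i by exact: lt_le_trans iy0 (hN _ _ By0).
  have : 2 / 3 * N i < N i by move: A0 AN; lra.
  move=> /sup_gt[|_ [y By <-] hy].
    by exists (`|phi i y0|), y0.
  by exists (i, y); split => //=; move: AN; rewrite /A; lra.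
pose i k := (f k).1; pose y k := (f k).2.
pose rho k : R := 4 ^- k.+1.
have rho0 k : 0 < rho k by rewrite invr_gt0 exprn_gt0.
pose sg k (x : I * T -> R) : R :=
  if rho k * `|phi (i k) (y k)| <= `|phi (i k) (fun u => x u + rho k * y k u)| then 1 else -1.
have sg1 k x : `|sg k x| = 1 by rewrite /sg; case: ifP; rewrite ?normrN normr1.
pose X := fun n => iteri n (fun k x => (fun u => x u + rho k * (sg k x * y k u))) (fun=> 0).
have XS k : X k.+1 = (fun u => X k u + rho k * (sg k (X k) * y k u)) by [].
have By k : B 1 (y k) by have [] := hf k.
have Bz k : B 1 (fun u => sg k (X k) * y k u).
  by have := scaled_ballZ (sg k (X k)) (By k); rewrite sg1 mulr1.
have Brz k : B (rho k) (fun u => rho k * (sg k (X k) * y k u)).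
  by have := scaled_ballZ (rho k) (Bz k); rewrite ger0_norm ?(ltW (rho0 k))// mulr1.
(* The radius is the exact sum of [rho l] over [m <= l < m + n]. *)
have Xtail m n : B (4 ^- m / 3 * (1 - 4 ^- n)) (fun u => X (m + n)%N u - X m u).
  elim: n => [|n IH].
    rewrite addn0 expr0 invr1 subrr mulr0; under eq_fun do rewrite subrr.
    exact: scaled_ball0.
  rewrite addnS XS.
  have -> : (fun u => X (m + n)%N u + rho (m + n)%N * (sg (m + n)%N (X (m + n)%N) * y (m + n)%N u) - X m u)
     = (fun u => (X (m + n)%N u - X m u) + rho (m + n)%N * (sg (m + n)%N (X (m + n)%N) * y (m + n)%N u)).
    by apply/funext => u; rewrite addrAC.
  have -> : 4 ^- m / 3 * (1 - 4 ^- n.+1) = 4 ^- m / 3 * (1 - 4 ^- n) + rho (m + n)%N :> R.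
    rewrite /rho !exprS exprD !invfM; field.
    by rewrite !expf_neq0.
  apply: scaled_ballD => //; last exact: ltW.
  rewrite mulr_ge0 ?divr_ge0 ?invr_ge0 ?exprn_ge0// subr_ge0.
  by rewrite invf_le1 ?exprn_gt0// exprn_ege1// ler1n.
have Xtail' m n : B (4 ^- m / 3) (fun u => X (m + n)%N u - X m u).
  apply: scaled_ball_le (Xtail m n) => //.
    rewrite mulr_ge0 ?divr_ge0 ?invr_ge0 ?exprn_ge0// subr_ge0.
    by rewrite invf_le1 ?exprn_gt0// exprn_ege1// ler1n.
  by rewrite ler_piMr ?divr_ge0 ?invr_ge0 ?exprn_ge0// gerBl invr_ge0 exprn_ge0.
have Xcvg u : cvgn (fun n => X n u).
  pose v k := rho k * (sg k (X k) * y k u).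
  have -> : (fun n => X n u) = series v.
    apply/funext; elim => [|n IH]; first by rewrite /series/= big_geq.
    by rewrite XS IH /series/= big_nat_recr.
  apply: normed_cvg; apply: (@series_le_cvg _ _ (geometric 4^-1 4^-1)).
  - by move=> n /=.
  - by move=> n /=; rewrite mulr_ge0// ?exprn_ge0 ?invr_ge0.
  - move=> n /=; rewrite /v -exprS exprVn -/(rho n).
    case: u @v => j x; have [_ h _] := Brz n j; exact: h.
  - apply: is_cvg_geometric_series; rewrite ger0_norm ?invr_ge0//.
    by rewrite invf_lt1// ltr1n.
pose x u := limn (fun n => X n u).
have Bx m : B (4 ^- m / 3) (fun u => x u - X m u).
  apply: (@scaled_ball_lim _ _ _ _ _ _ _ (fun n u => X (m + n)%N u - X m u)).
    by move=> n; exact: Xtail'.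
  move=> u; apply: cvgB; last exact: cvg_cst.
  rewrite (_ : (fun n => X (m + n)%N u) = [sequence X (n + m)%N u]_n).
    by rewrite (cvg_shiftn m (fun n => X n u)); exact: Xcvg.
  by apply/funext => n; rewrite addnC.
have B1x : B 1 x.
  have B3 : B (4 ^- 0 / 3) x by have := Bx 0%N; under eq_fun do rewrite subr0.
  by apply: scaled_ball_le B3 => //; rewrite expr0 invr1; lra.
have YX m : Y (X m).
  have := Xtail' 0%N m; rewrite add0n; under eq_fun do rewrite subr0.
  by apply: scaled_spaceW; rewrite expr0 invr1 divr_ge0.
have hk k : k%:R <= `|phi (i k) x|.
  have [_ h1 h2] := hf k; rewrite -/(i k) -/(y k) in h1 h2.
  have h3 : rho k * `|phi (i k) (y k)| <= `|phi (i k) (X k.+1)|.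
    have Yy : Y (y k) by apply: (@scaled_spaceW 1).
    have Yry : Y (fun u => rho k * y k u) by exact: scaled_spaceZ.
    rewrite XS /sg; case: ifPn => [h|].
      by under [in leRHS]eq_fun do rewrite mul1r.
    rewrite -ltNge; under [in leRHS]eq_fun do rewrite mulN1r mulrN.
    rewrite scaled_functionalD// scaled_functionalB// scaled_functionalZ// => h.
    (* The absolute values for the two signs add up to at least twice the new term; as the sign [1]
       failed, the sign [-1] succeeds. *)
    have : 2 * (rho k * `|phi (i k) (y k)|) <=
      `|phi (i k) (X k) + rho k * phi (i k) (y k)| + `|phi (i k) (X k) - rho k * phi (i k) (y k)|.
      rewrite -[X in X * _]normr_nat -[X in _ * (X * _)]ger0_norm ?(ltW (rho0 k))// -!normrM.
      rewrite -[X in _ + X]normrN; apply: le_trans (ler_normD _ _).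
      by rewrite le_eqVlt; apply/orP; left; apply/eqP; congr `|_|; ring.
    lra.
  have h4 : `|phi (i k) (fun u => x u - X k.+1 u)| <= rho k / 3 * N (i k).
    by apply: scaled_functional_le; [exact: hN|rewrite divr_gt0|exact: Bx].
  rewrite scaled_functionalB// in h4; last by exact: (@scaled_spaceW 1).
  have h5 := lerB_normD (phi (i k) (X k.+1)) (phi (i k) x - phi (i k) (X k.+1)).
  have h6 : rho k * (2 / 3 * N (i k)) <= rho k * `|phi (i k) (y k)|.
    by rewrite ler_wpM2l ?ltW.
  have h7 : k%:R <= rho k * N (i k) / 3.
    rewrite ler_pdivlMr// /rho [leRHS]mulrC ler_pdivlMr ?exprn_gt0//; lra.
  rewrite subrKC in h5; lra.
have [M hM] : exists M : R, forall n, `|phi n x| <= M.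
  have /cvg_seq_bounded : cvgn (fun n => phi n x) by apply/cvg_ex; exists 0; exact: phi_cvg0.
  move=> [M [_ hM]]; exists (M + 1) => n; apply: (hM (M + 1)) => //.
  by rewrite ltrDl.
have := le_trans (hk (Num.truncn M).+1) (hM _).
by rewrite leNgt truncnS_gt.
Qed.

End WeakStarNull.


(** * Quadratic means of the slices *)

Section QuadraticMean.
Context {R : realType} {d : measure_display} {T : measurableType d}.
Variables (mu : {measure set T -> \bar R}) (I : Type) (tau : I -> \bar R).
Hypothesis tau_ge0 : forall j, (0 <= tau j)%E.
Local Notation B := (scaled_ball mu tau).
Local Notation Y := (scaled_space mu tau).

(* [0] when [tau j] is [0] (the slice vanishes almost everywhere) or [+oo] (no constraint). *)
Definition quad_mean (y : I * T -> R) (j : I) : R :=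
  if (0 < tau j < +oo)%E then (\int[mu]_x (y (j, x)) ^+ 2) / fine (tau j) else 0.

Lemma slice_sq_le c y j : 0 <= c -> B c y ->
  (\int[mu]_x ((y (j, x)) ^+ 2)%:E <= (c * c)%:E * tau j)%E.
Proof.
move=> c0 /(_ j)[my yc iy]; rewrite EFinM -muleA.
apply: (@le_trans _ _ (c%:E * \int[mu]_x `|y (j, x)|%:E)%E); last first.
  by apply: lee_wpmul2l => //; rewrite lee_fin.
rewrite -ge0_integralZl//; last exact: measurable_norm_EFin.
apply: ge0_le_integral => //.
- by move=> x _; rewrite lee_fin sqr_ge0.
- by apply/measurable_EFinP; exact: measurable_funX.
- by apply: emeasurable_funM => //; exact: measurable_norm_EFin.
- move=> x _; rewrite -EFinM lee_fin -real_normK ?num_real// expr2.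
  by rewrite ler_wpM2r.
Qed.

Lemma slice_sq_integrable y j : Y y -> (tau j < +oo)%E ->
  mu.-integrable setT (EFin \o (fun x => (y (j, x)) ^+ 2)).
Proof.
move=> [c c0 By] tj; apply/integrableP; split.
  by apply/measurable_EFinP/measurable_funX; have [] := By j.
under eq_integral do rewrite /= ger0_norm ?sqr_ge0//.
apply: (le_lt_trans (slice_sq_le j (ltW c0) By)).
by rewrite lte_mul_pinfty// lee_fin mulr_ge0// ltW.
Qed.

Lemma Rintegral_slice_sq y j : Y y -> (tau j < +oo)%E ->
  (\int[mu]_x ((y (j, x)) ^+ 2)%:E)%E = (\int[mu]_x (y (j, x)) ^+ 2)%:E.
Proof.
move=> Yy tj; rewrite /Rintegral fineK//.
exact: (integrable_fin_num measurableT (slice_sq_integrable Yy tj)).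
Qed.

Lemma quad_mean_bound c y j : 0 < c -> B c y -> 0 <= quad_mean y j <= c * c.
Proof.
move=> c0 By; rewrite /quad_mean; case: ifPn => [/andP[t0 ty]|_]; last first.
  by rewrite lexx mulr_ge0// ltW.
have tf : tau j \is a fin_num by rewrite ge0_fin_numE// ltW.
have ft0 : 0 < fine (tau j) by rewrite fine_gt0// t0 ty.
apply/andP; split.
  by apply: divr_ge0 (ltW ft0); apply: Rintegral_ge0 => x _; rewrite sqr_ge0.
rewrite ler_pdivrMr// -lee_fin -Rintegral_slice_sq//; last by exists c.
by rewrite EFinM fineK//; exact: slice_sq_le (ltW c0) By.
Qed.

Lemma quad_mean_parallelogram v w j : Y v -> Y w ->
  4 * quad_mean (fun u => 2^-1 * (v u + w u)) j + quad_mean (fun u => v u - w u) j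
  = 2 * quad_mean v j + 2 * quad_mean w j.
Proof.
move=> Yv Yw; rewrite /quad_mean; case: ifPn => [/andP[t0 ty]|_]; last by ring.
rewrite !mulrA -!mulrDl; congr (_ / _).
have Yh : Y (fun u => 2^-1 * (v u + w u)).
  by apply: scaled_spaceZ => //; exact: scaled_spaceD.
have Yb : Y (fun u => v u - w u).
  have YN : Y (fun u => - w u).
    by have := scaled_spaceZ tau_ge0 (-1) Yw; under eq_fun do rewrite mulN1r.
  exact: (scaled_spaceD Yv YN).
have ih := slice_sq_integrable Yh ty; have ib := slice_sq_integrable Yb ty.
have iv := slice_sq_integrable Yv ty; have iw := slice_sq_integrable Yw ty.
rewrite -!RintegralZl// -!RintegralD//.
- by apply: eq_Rintegral => x _; field.
- exact: (integrableZl measurableT 2 iv).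
- exact: (integrableZl measurableT 2 iw).
- exact: (integrableZl measurableT 4 ih).
Qed.

Lemma quad_mean_markov y j (c e : R) : Y y -> 0 < c -> 0 < e -> quad_mean y j <= c ^+ 2 * e ->
  (mu [set x | (c < `|y (j, x)|)%R] <= e%:E * tau j)%E.
Proof.
move=> Yy c0 e0 qe; have [b b0 By] := Yy.
have my : measurable_fun setT (fun x => y (j, x)) by have [] := By j.
set A := [set x | _].
have mA : measurable A.
  rewrite (_ : A = [set: T] `&` (fun x => `|y (j, x)|) @^-1` `]c, +oo[); last first.
    by apply/seteqP; split => x /=; rewrite in_itv/= andbT => //; case.
  by apply: (measurableT_comp _ my).
have h : ((c ^+ 2)%:E * mu A <= \int[mu]_x ((y (j, x)) ^+ 2)%:E)%E.
  rewrite -(setIT A) -integral_indic// -ge0_integralZl//.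
  - apply: ge0_le_integral => //.
    + by move=> x _; rewrite -EFinM lee_fin mulr_ge0// sqr_ge0.
    + by apply: emeasurable_funM => //; apply/measurable_EFinP; exact: measurable_indic.
    + by apply/measurable_EFinP; exact: measurable_funX.
    + move=> x _; rewrite -EFinM lee_fin indicE; have [xA|xA] := boolP (x \in A).
        have cy : c < `|y (j, x)| by exact: set_mem xA.
        by rewrite mulr1 -[leRHS]real_normK ?num_real// ler_sqr ?nnegrE//; exact: ltW.
      by rewrite mulr0 sqr_ge0.
  - by apply/measurable_EFinP; exact: measurable_indic.
  - by rewrite lee_fin sqr_ge0.
have c20 : 0 < c ^+ 2 by rewrite exprn_gt0.
rewrite -(@lee_pmul2l _ (c ^+ 2)%:E)//; apply: (le_trans h).
move: qe; rewrite /quad_mean; case: ifPn => [/andP[t0 ty] qe|].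
  have tf : tau j \is a fin_num by rewrite ge0_fin_numE// ltW.
  have ft0 : 0 < fine (tau j) by rewrite fine_gt0// t0 ty.
  rewrite Rintegral_slice_sq// muleA -EFinM -(fineK tf) -EFinM lee_fin.
  by rewrite -ler_pdivrMr.
(* In the degenerate cases the value 0 of [quad_mean] says nothing: for [tau j = 0] the integral of
   the square vanishes, and for [tau j = +oo] the right-hand side is infinite. *)
rewrite negb_and -!leNgt => /orP[t0|ty] _.
  have t00 : tau j = 0%E by apply/eqP; rewrite eq_le t0 tau_ge0.
  by have := slice_sq_le j (ltW b0) By; rewrite t00 !mule0.
have -> : tau j = +oo%E by apply/eqP; rewrite -leye_eq.
by rewrite !gt0_muley ?leey ?lte_fin.
Qed.

End QuadraticMean.


(** * Weak-* null sequences on the ball *)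

Section WeakStarNullBall.
Context {R : realType} {d : measure_display} {T : measurableType d}.
Variables (mu : {measure set T -> \bar R}) (I : Type) (tau : I -> \bar R).
Hypothesis tau_ge0 : forall j, (0 <= tau j)%E.
Local Notation B := (scaled_ball mu tau).
Local Notation Y := (scaled_space mu tau).
Variable phi : nat -> (I * T -> R) -> R.
Hypotheses (phi_linear : forall i (a : R) y z, Y y -> Y z ->
    phi i (fun u => a * y u + z u) = a * phi i y + phi i z)
  (phi_bounded : forall i, exists C : R, forall y, B 1 y -> `|phi i y| <= C)
  (phi_cvg0 : forall y, B 1 y -> phi i y @[i --> \oo] --> 0).
(** A uniformly small [y] need not be a small multiple of an element of the ball, since its integral
    bounds need not improve. It acts like one after synthesis, where the low scales sum
    geometrically and the high scales contribute little; hence the formulation through the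
    functionals. *)
Hypothesis phi_small : forall e : R, 0 < e -> exists2 e' : R, 0 < e' &
  forall y, B 1 y -> (forall u, `|y u| <= e') ->
  exists2 z, B 1 z & forall i, phi i y = e * phi i z.

Implicit Types (m y z : I * T -> R) (c e : R).

Let phiD := scaled_functionalD phi_linear.
Let phiZ := scaled_functionalZ tau_ge0 phi_linear.
Let phiB := scaled_functionalB tau_ge0 phi_linear.
Let YW := @scaled_spaceW R d T mu I tau tau_ge0.

Definition scale_mult : set (I * T -> R) := [set m | exists a : I -> R,
  (exists c, forall j, 0 <= a j <= c) /\ m = (fun u => a u.1)].

Definition space_mult : set (I * T -> R) := [set m | (forall u, 0 <= m u) /\ Y m].

Definition unit_tests : set (I * T -> R) :=
  [set y | slice_measurable y /\ forall u, `|y u| <= 1].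

Lemma scale_mult_ball (a : I -> R) c y : 0 <= c -> (forall j, 0 <= a j <= c) -> B 1 y ->
  B c (fun u => a u.1 * y u).
Proof.
move=> c0 ac By; apply: scaled_ball_slices => j; have /andP[a0 acj] := ac j.
exists (fun u => a j * y u) => //.
have := scaled_ballZ (a j) By; rewrite mulr1 ger0_norm//.
exact: scaled_ball_le.
Qed.

Lemma scale_mult_space m y : scale_mult m -> B 1 y -> Y (fun u => m u * y u).
Proof.
move=> [a [[c ac] ->]] By; apply: (@YW `|c|) => //; apply: scale_mult_ball => // j.
by have /andP[-> h] := ac j; exact: le_trans h (ler_norm _).
Qed.

Lemma slice_measurableM m y : slice_measurable m -> slice_measurable y ->
  slice_measurable (fun u => m u * y u).
Proof. by move=> mm my j; exact: measurable_funM. Qed.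

Lemma scaled_ball_measurable c y : B c y -> slice_measurable y.
Proof. by move=> By j; have [] := By j. Qed.

Lemma scaled_ball_test c m y : B c m -> unit_tests y -> B c (fun u => m u * y u).
Proof.
move=> Bm [my y1]; apply: (scaled_ball_dom Bm).
  by apply: slice_measurableM => //; exact: scaled_ball_measurable Bm.
by move=> u; rewrite normrM ler_piMr.
Qed.

Lemma space_mult_space m y : space_mult m -> unit_tests y -> Y (fun u => m u * y u).
Proof. by move=> [_ [c c0 Bm]] Wy; exists c => //; exact: scaled_ball_test. Qed.

Lemma scaled_functional_bounded i : exists2 C : R, 0 <= C &
  forall c y, 0 < c -> B c y -> `|phi i y| <= c * C.
Proof.
have [C hC] := phi_bounded i; exists C; first by apply: le_trans (hC _ (scaled_ball0 _ _ ler01)).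
by move=> c y c0 By; exact: (scaled_functional_le tau_ge0 phi_linear hC).
Qed.

Lemma scale_modulus_axioms i : modulus_axioms scale_mult (B 1) (phi i).
Proof.
split.
- by move=> _ [a [[c ac] ->]] u; have /andP[] := ac u.1.
- move=> _ _ [a [[c ac] ->]] [a' [[c' ac'] ->]]; exists (fun j => a j + a' j); split => //.
  exists (c + c') => j; have /andP[? ?] := ac j; have /andP[? ?] := ac' j.
  by rewrite addr_ge0// lerD.
- move=> _ _ [a [[c ac] ->]] [a' [[c' ac'] ->]] aa.
  (* If [T] is empty, the inequality between the multipliers says nothing about [a] and [a']; the
     truncation at 0 covers this case. *)
  exists (fun j => Num.max 0 (a' j - a j)); split.
    exists c' => j; have /andP[a0 _] := ac j; have /andP[a'0 ac1] := ac' j.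
    by rewrite le_max lexx/= ge_max (le_trans a'0 ac1)/= (le_trans _ ac1)// gerBl.
  by apply/funext => u; rewrite max_r// subr_ge0.
- move=> b _ b0 [a [[c ac] ->]]; exists (fun j => b * a j); split => //.
  by exists (b * c) => j; have /andP[a0 h] := ac j; rewrite mulr_ge0//= ler_wpM2l.
- exact: scaled_ball0.
- by move=> y; exact: scaled_ballN.
- move=> _ _ y y' [a [[c ac] ->]] [a' [[c' ac'] ->]] By By'.
  apply: scaled_ball_slices => j; have /andP[a0 _] := ac j; have /andP[a'0 _] := ac' j.
  have [s0|s0] := eqVneq (a j + a' j) 0.
    exists (fun=> 0); first exact: scaled_ball0.
    by move=> x /=; rewrite s0 invr0 mulr0.
  exists (fun u => (1 - a' j / (a j + a' j)) * y u + a' j / (a j + a' j) * y' u).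
    apply: scaled_ball_conv => //; rewrite divr_ge0 ?addr_ge0//= ler_pdivrMr ?mul1r ?lerDr//.
    by rewrite lt_neqAle eq_sym s0 addr_ge0.
  by move=> x /=; field.
- by move=> m m' y y' Mm Mm' By By'; apply: phiD; exact: scale_mult_space.
- by move=> c m y Mm By; apply: phiZ; exact: scale_mult_space.
- move=> _ [a [[c ac] ->]]; have [C C0 hC] := scaled_functional_bounded i.
  exists ((`|c| + 1) * C) => y By; apply: le_trans (ler_norm _) _; apply: hC.
    by rewrite ltr_wpDl.
  apply: scale_mult_ball => //.
  move=> j; have /andP[-> h] := ac j; apply: (le_trans h); apply: le_trans (ler_norm _) _.
  by rewrite lerDl.
Qed.

Lemma space_modulus_axioms i : modulus_axioms space_mult unit_tests (phi i).
Proof.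
split.
- by move=> m [].
- move=> m m' [m0 Ym] [m'0 Ym']; split; last exact: scaled_spaceD.
  by move=> u; exact: addr_ge0.
- move=> m m' [m0 Ym] [m'0 [c c0 Bm']] mm'; split; first by move=> u; rewrite subr_ge0.
  exists c => //; apply: (scaled_ball_dom Bm').
    move=> j; apply: measurable_funB; first exact: (scaled_ball_measurable Bm').
    by have [b b0 Bm] := Ym; exact: (scaled_ball_measurable Bm).
  by move=> u; rewrite !ger0_norm ?subr_ge0// gerBl.
- move=> c m c0 [m0 Ym]; split; last exact: scaled_spaceZ.
  by move=> u; exact: mulr_ge0.
- split; last by move=> u; rewrite normr0.
  by move=> j; exact: measurable_cst.
- move=> y [my y1]; split; last by move=> u; rewrite normrN.
  by move=> j; exact: measurable_funN.
- move=> m m' y y' [m0 [c c0 /scaled_ball_measurable Bm]].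
  move=> [m'0 [c' c'0 /scaled_ball_measurable Bm']] [my y1] [my' y'1]; split.
    (* Measurability of the quotient comes from that of the power of exponent -1, which agrees with
       the inverse on nonnegative numbers, 0 included. *)
    move=> j; have -> : (fun x => (m (j, x) * y (j, x) + m' (j, x) * y' (j, x)) / (m (j, x) + m' (j, x)))
      = (fun x => (m (j, x) * y (j, x) + m' (j, x) * y' (j, x)) * (m (j, x) + m' (j, x)) `^ (-1)).
      by apply/funext => x; rewrite powR_inv1// addr_ge0.
    apply: measurable_funM.
      by apply: measurable_funD; exact: measurable_funM.
    have ms : measurable_fun setT (fun x => m (j, x) + m' (j, x)) by exact: measurable_funD.
    exact: (measurableT_comp (measurable_powR (-1)) ms).
  move=> u; have [s0|s0] := eqVneq (m u + m' u) 0; first by rewrite s0 invr0 mulr0 normr0.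
  have s1 : 0 < m u + m' u by rewrite lt_neqAle eq_sym s0 addr_ge0.
  rewrite normrM normfV (ger0_norm (ltW s1)) ler_pdivrMr// mul1r.
  apply: (le_trans (ler_normD _ _)); rewrite !normrM !(ger0_norm (m0 u), ger0_norm (m'0 u)).
  by apply: lerD; rewrite ler_piMr.
- by move=> m m' y y' Mm Mm' By By'; apply: phiD; exact: space_mult_space.
- by move=> c m y Mm By; apply: phiZ; exact: space_mult_space.
- move=> m [_ [c c0 Bm]]; have [C C0 hC] := scaled_functional_bounded i.
  exists (c * C) => y Wy; apply: le_trans (ler_norm _) _; apply: hC => //.
  exact: scaled_ball_test.
Qed.

(** [lmod i] is the lattice modulus of [phi i] on nonnegative elements of the space; [nmod i] is its
    analogue for bounded weights on the scales. *)
Local Notation nmod i := (modulus (B 1) (phi i)).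
Local Notation lmod i := (modulus unit_tests (phi i)).

Lemma scale_mult_indic (J : set I) : scale_mult \1_[set u | J u.1].
Proof.
exists \1_J; split; last by apply/funext => u; rewrite !indicE; congr (nat_of_bool _)%:R;
  apply/idP/idP => /set_mem h; apply/mem_set.
by exists 1 => j; rewrite indicE ler0n lern1 leq_b1.
Qed.

Lemma indic_le1 (U : Type) (A : set U) (u : U) : `|\1_A u| <= 1 :> R.
Proof. by rewrite indicE ger0_norm// lern1 leq_b1. Qed.

Lemma scale_indic_ball (J : set I) y : B 1 y -> B 1 (fun u => \1_[set u | J u.1] u * y u).
Proof.
move=> By; have [a [_ ae]] := scale_mult_indic J; rewrite ae.
apply: (scaled_ball_dom By).
  by move=> j /=; apply: measurable_funM => //; exact: (scaled_ball_measurable By).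
move=> u; have := indic_le1 [set u | J u.1] u; rewrite ae => h.
by rewrite normrM ler_piMl.
Qed.

(* [nmod i \1_J] is the norm of [phi i] restricted to the scales in [J]; elements of the ball on
   disjoint sets of scales glue to an element of the ball. *)
Lemma scale_uniform_continuity (e : R) : 0 < e -> exists k : nat, forall J : set I,
  (forall i, (i <= k)%N -> nmod i \1_[set u | J u.1] <= 2 ^- k) ->
  forall i, nmod i \1_[set u | J u.1] <= e.
Proof.
move=> e0; apply: contrapT => hn.
have [C C0 hC] := uniform_boundedness tau_ge0 phi_linear phi_bounded phi_cvg0.
have /choice[J hJ] : forall k, exists J : set I,
    (forall i, (i <= k)%N -> nmod i \1_[set u | J u.1] <= 2 ^- k) /\ exists i, e <= nmod i \1_[set u | J u.1].
  move=> k; apply: contrapT => h; apply: hn; exists k => J hJ i.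
  rewrite leNgt; apply/negP => h'; apply: h; exists J; split => //.
  by exists i; exact: ltW.
pose F : set (set (I * T)) := [set D | exists J : set I, D = [set u | J u.1]].
apply: (@modulus_uniform_absolute_continuity _ _ _ _ _ F C scale_modulus_axioms
  _ _ _ _ _ _ _ (fun k => [set u | J k u.1]) e e0 _ (fun k => (hJ k).1)
  (fun k => (hJ k).2)).
- by exists set0.
- by move=> _ _ [A ->] [A' ->]; exists (A `\` A').
- move=> A /choice[A' hA]; exists (\bigcup_n A' n).
  by apply/seteqP; split => u [n _]; [rewrite hA; exists n|exists n => //; rewrite hA].
- by move=> _ [A ->]; exact: scale_mult_indic.
- move=> D z /choice[A hA] tD Bz.
  pose y (u : I * T) : R := if pselect (exists k, D k u) is left h then z (projT1 (cid h)) u else 0.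
  have yE k u : D k u -> y u = z k u.
    move=> Du; rewrite /y; case: pselect => [h|]; last by move=> []; exists k.
    case: cid => l Dl /=; congr (z _ _).
    by apply: tD => //; exists u.
  exists y => //; apply: scaled_ball_slices => j.
  have [[k Ak]|hk] := pselect (exists k, A k j).
    by exists (z k) => // x; apply: yE; rewrite hA.
  exists (fun=> 0); first exact: scaled_ball0.
  move=> x; rewrite /y; case: pselect => // -[k Dk]; exfalso; apply: hk; exists k.
  by move: Dk; rewrite hA.
- by move=> _ y [A ->] By; apply: phi_cvg0; exact: scale_indic_ball.
- move=> i _ y [A ->] By; apply: le_trans (ler_norm _) _; apply: hC.
  exact: scale_indic_ball.
- by move=> k; exists (J k).
Qed.

Lemma slice_measurable_indic (D : set (I * T)) :
  (forall j, measurable [set x | D (j, x)]) -> slice_measurable (\1_D : I * T -> R).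
Proof.
move=> mD j; have -> : (fun x => \1_D (j, x) : R) = \1_[set x | D (j, x)].
  by apply/funext => x; rewrite !indicE; congr (nat_of_bool _)%:R;
    apply/idP/idP => /set_mem h; apply/mem_set.
exact: measurable_indic.
Qed.

(** As [\1_E] is in the ball, so is every unit test cut off to a measurable subset of [E]. Tests on
    disjoint pieces therefore glue inside the order interval of [\1_E], where the weak-* convergence
    applies. *)
Lemma space_uniform_continuity (E : set (I * T)) (A : nat -> set (I * T)) (e : R) :
  0 < e -> (forall j, measurable [set x | E (j, x)]) -> B 1 \1_E ->
  (forall k j, measurable [set x | A k (j, x)]) -> (forall k, A k `<=` E) ->
  (forall k i, (i <= k)%N -> lmod i \1_(A k) <= 2 ^- k) ->
  ~ (forall k, exists i, e <= lmod i \1_(A k)).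
Proof.
move=> e0 mE BE mA AE.
have [C C0 hC] := uniform_boundedness tau_ge0 phi_linear phi_bounded phi_cvg0.
pose F : set (set (I * T)) := [set D | D `<=` E /\ forall j, measurable [set x | D (j, x)]].
have Find D : F D -> B 1 \1_D.
  move=> [DE mD]; apply: (scaled_ball_dom BE); first exact: slice_measurable_indic.
  move=> u; rewrite !indicE !ger0_norm// ler_nat.
  have [/set_mem /DE h|//] := boolP (u \in D).
  by rewrite mem_set.
have FB D y : F D -> unit_tests y -> B 1 (fun u => \1_D u * y u).
  by move=> FD Wy; apply: scaled_ball_test => //; exact: Find.
apply: (@modulus_uniform_absolute_continuity _ _ _ _ _ F C space_modulus_axioms) => //.
- split; first exact: sub0set.
  by move=> j; rewrite (_ : [set x | _] = set0).
- move=> D D' [DE mD] [_ mD']; split; first by move=> u [/DE].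
  by move=> j; apply: (measurableD (mD j) (mD' j)).
- move=> D FD; split; first by move=> u [n _] /(FD n).1.
  move=> j; rewrite (_ : [set x | _] = \bigcup_n [set x | D n (j, x)]).
    by apply: bigcup_measurable => n _; exact: (FD n).2.
  by apply/seteqP; split => x [n _]; exists n.
- move=> D FD; split; last by exists 1 => //; exact: Find.
  by move=> u; rewrite indicE.
- move=> D z FD tD Wz.
  pose y (u : I * T) : R := if pselect (exists k, D k u) is left h then z (projT1 (cid h)) u else 0.
  have yE k u : D k u -> y u = z k u.
    move=> Du; rewrite /y; case: pselect => [h|]; last by move=> []; exists k.
    case: cid => l Dl /=; congr (z _ _).
    by apply: tD => //; exists u.
  exists y => //; split; last first.
    move=> u; rewrite /y; case: pselect => [h|_]; last by rewrite normr0.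
    exact: (Wz _).2.
  (* By disjointness the partial sums are eventually constant at each point, so the glued test is a
     pointwise limit of measurable functions. *)
  move=> j; apply: (@measurable_fun_cvg _ _ _ setT
    (fun n x => \sum_(k < n) \1_(D k) (j, x) * z k (j, x))).
    move=> n; apply: measurable_sum => k; apply: measurable_funM.
      by apply: slice_measurable_indic; exact: (FD k).2.
    exact: (Wz k).1.
  move=> x _; have [[k Dk]|hk] := pselect (exists k, D k (j, x)).
    rewrite (yE k)//; apply: (@cvg_near_cst).
    exists k.+1 => // n /= kn; apply/eqP.
    rewrite (bigD1 (Ordinal kn))//= indicE mem_set// mul1r big1 ?addr0// => l /eqP lk.
    rewrite indicE memNset ?mul0r// => Dl; apply: lk; apply/val_inj => /=.
    by apply: tD => //; exists (j, x).
  rewrite (_ : y (j, x) = 0); last by rewrite /y; case: pselect.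
  apply: cvg_near_cst; apply: nearW => n; apply/eqP; rewrite big1// => k _.
  by rewrite indicE memNset ?mul0r// => Dk; apply: hk; exists k.
- by move=> D y FD Wy; apply: phi_cvg0; exact: FB.
- by move=> i D y FD Wy; apply: le_trans (ler_norm _) _; apply: hC; exact: FB.
Qed.

Lemma scaled_ball_sq c y : 0 <= c -> B c y -> B (c * c) (fun u => y u ^+ 2).
Proof.
move=> c0 By j; have [my yc _] := By j; split.
- exact: measurable_funX.
- by move=> x; rewrite normrX expr2 ler_pM.
- under eq_integral do rewrite ger0_norm ?sqr_ge0//.
  exact: slice_sq_le.
Qed.

Lemma sq_space_mult y : Y y -> space_mult (fun u => y u ^+ 2).
Proof.
move=> [c c0 By]; split; first by move=> u; rewrite sqr_ge0.
by exists (c * c); [rewrite mulr_gt0|apply: scaled_ball_sq => //; exact: ltW].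
Qed.

Lemma quad_scale_mult y : Y y -> scale_mult (fun u => quad_mean mu tau y u.1).
Proof.
move=> [c c0 By]; exists (quad_mean mu tau y); split => //.
by exists (c * c) => j; exact: quad_mean_bound.
Qed.

(** The first summand will bound [lmod] of the set where a difference is large, the second [nmod] of
    the set of scales at which Markov's inequality gives too weak a bound for the measure. *)
Definition quad_form (n : nat) y : R :=
  \sum_(i < n) (lmod i (fun u => y u ^+ 2) + nmod i (fun u => quad_mean mu tau y u.1)).

Lemma lmod_sq_ge0 i y : Y y -> 0 <= lmod i (fun u => y u ^+ 2).
Proof. by move=> Yy; exact/(modulus_ge0 (space_modulus_axioms i))/sq_space_mult. Qed.

Lemma nmod_quad_ge0 i y : Y y -> 0 <= nmod i (fun u => quad_mean mu tau y u.1).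
Proof. by move=> Yy; exact/(modulus_ge0 (scale_modulus_axioms i))/quad_scale_mult. Qed.

Lemma quad_form_bound C n y : (forall i y, B 1 y -> `|phi i y| <= C) -> B 1 y ->
  0 <= quad_form n y <= n%:R * (C + C).
Proof.
move=> hC By; have Yy : Y y by exact: (@YW 1).
apply/andP; split.
  by apply: sumr_ge0 => i _; apply: addr_ge0; [exact: lmod_sq_ge0|exact: nmod_quad_ge0].
rewrite -[n in leRHS]card_ord mulr_natl -sumr_const; apply: ler_sum => i _.
apply: lerD.
  apply: (modulus_lub (space_modulus_axioms i)) => w Ww.
  apply: le_trans (ler_norm _) _; apply: hC.
  by apply: scaled_ball_test Ww; rewrite -(mulr1 1); exact: scaled_ball_sq.
apply: (modulus_lub (scale_modulus_axioms i)) => w Ww.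
apply: le_trans (ler_norm _) _; apply: hC.
apply: scale_mult_ball Ww => // j.
by have := quad_mean_bound tau_ge0 j ltr01 By; rewrite mulr1.
Qed.

Lemma quad_form_parallelogram n v w : Y v -> Y w ->
  4 * quad_form n (fun u => 2^-1 * (v u + w u)) + quad_form n (fun u => v u - w u)
  = 2 * quad_form n v + 2 * quad_form n w.
Proof.
move=> Yv Yw; rewrite /quad_form !mulr_sumr -!big_split/=; apply: eq_bigr => i _.
have Yh : Y (fun u => 2^-1 * (v u + w u)).
  by apply: scaled_spaceZ => //; exact: scaled_spaceD.
have Yb : Y (fun u => v u - w u).
  have YN : Y (fun u => - w u).
    by have := scaled_spaceZ tau_ge0 (-1) Yw; under eq_fun do rewrite mulN1r.
  exact: (scaled_spaceD Yv YN).
have := @modulus_parallelogram _ _ _ _ _ (space_modulus_axioms i) _ _ _ _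
  (sq_space_mult Yh) (sq_space_mult Yb) (sq_space_mult Yv) (sq_space_mult Yw).
have := @modulus_parallelogram _ _ _ _ _ (scale_modulus_axioms i) _ _ _ _
  (quad_scale_mult Yh) (quad_scale_mult Yb) (quad_scale_mult Yv) (quad_scale_mult Yw).
move=> /(_ (fun u => quad_mean_parallelogram tau_ge0 u.1 Yv Yw)) h1.
have h2 u : 4 * (2^-1 * (v u + w u)) ^+ 2 + (v u - w u) ^+ 2 = 2 * v u ^+ 2 + 2 * w u ^+ 2.
  by field.
move=> /(_ h2) {}h2; lra.
Qed.

(* Two near-minimisers of [quad_form] over the sets [S N] differ by some [z] whose quadratic mean
   is small outside a set [J] of scales that is negligible for all the functionals; so, up to
   negligible parts, [z] lives on a set [A] of small measure at every scale. *)
Lemma small_support_piece (e0 : R) (k : nat) : 0 < e0 ->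
  (forall N, exists2 y, B 1 y & forall i, (i <= N)%N -> e0 <= phi i y) ->
  exists Ai : set (I * T) * nat,
    [/\ forall j, measurable [set x | Ai.1 (j, x)],
        forall j, (mu [set x | Ai.1 (j, x)] <= (2 ^- k.+1)%:E * tau j)%E,
        forall i, (i <= k)%N -> lmod i \1_(Ai.1) <= 2 ^- k &
        e0 / 8 <= lmod Ai.2 \1_(Ai.1)].
Proof.
move=> e00 hyp.
have [C C0 hC] := uniform_boundedness tau_ge0 phi_linear phi_bounded phi_cvg0.
have e160 : 0 < e0 / 16 by rewrite divr_gt0.
have [ka hka] := scale_uniform_continuity e160.
have [e' e'0 he'] : exists2 e' : R, 0 < e' & forall y i, B 1 y ->
    (forall u, `|y u| <= e') -> `|phi i y| <= e0 / 16.
  have [e' e'0 h] := phi_small (divr_gt0 e160 C0); exists e' => // y i By ye.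
  have [z Bz ->] := h _ By ye; rewrite normrM gtr0_norm ?divr_gt0//.
  by rewrite mulrAC ler_pdivrMr// ler_wpM2l ?hC// ltW.
(* Indices up to [k] serve the piece itself, those up to [ka] make the exceptional scales negligible
   for all the functionals. *)
pose n := (maxn k ka).+1.
(* Up to the value [eta1] of the quadratic mean, Markov's inequality at height [2 * e'] bounds the
   measure by [2 ^- k.+1 * tau j]. The two terms of [eta] yield the bound [2 ^- ka] on the scales
   where [eta1] is exceeded and the bound [2 ^- k] for the moduli of [\1_A]. *)
pose eta1 : R := (2 * e') ^+ 2 * 2 ^- k.+1.
have e2 : 0 < (2 * e') ^+ 2 by rewrite exprn_gt0// mulr_gt0.
have eta10 : 0 < eta1 by rewrite mulr_gt0// invr_gt0 exprn_gt0.
pose eta := Num.min (eta1 * 2 ^- ka) ((2 * e') ^+ 2 * 2 ^- k).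
have eta0 : 0 < eta by rewrite lt_min !mulr_gt0// invr_gt0 exprn_gt0.
pose S N := [set y | B 1 y /\ forall i, (i <= N)%N -> e0 <= phi i y].
have YB y : B 1 y -> Y y by exact: YW.
have half_conv v w : (fun u => (1 - 2^-1) * v u + 2^-1 * w u) = (fun u => 2^-1 * (v u + w u) : R).
  by apply/funext => u; field.
have Sne N : S N !=set0 by have [y By hy] := hyp N; exists y.
have Sconv N v w : S N v -> S N w -> S N (fun u => 2^-1 * (v u + w u)).
  move=> [Bv hv] [Bw hw]; split.
    by rewrite -half_conv; apply: scaled_ball_conv => //; apply/andP; split; lra.
  move=> i iN; have Yv := YB _ Bv; have Yw := YB _ Bw.
  rewrite phiZ ?phiD//; last exact: scaled_spaceD.
  by have := hv i iN; have := hw i iN; lra.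
have [|||m [z0 [[Bz0 hz0] hz]]] := @decreasing_convex_near R (I * T -> R)
  (fun v w u => v u + w u) (fun v w u => v u - w u) (fun v u => 2^-1 * v u)
  (quad_form n) S (n%:R * (C + C)) _ _ Sne Sconv _ eta eta0.
- by move=> v [Bv _]; exact: quad_form_bound.
- by move=> a b ab v [Bv hv]; split => // i ia; apply: hv; exact: leq_trans ab.
- by move=> v w [Bv _] [Bw _]; apply: quad_form_parallelogram; exact: YB.
(* [z0] is fixed while [i] grows, so [phi i z0] becomes small; the element of [S i] near [z0] still
   has value at least [e0], and the difference keeps [e0 / 2]. *)
have [i mi hi] : exists2 i, (m <= i)%N & `|phi i z0| <= e0 / 2.
  have e20 : 0 < e0 / 2 by rewrite divr_gt0.
  have [M _ hM] : \forall i \near \oo, `|phi i z0| <= e0 / 2.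
    move/cvgrPdist_le : (phi_cvg0 Bz0) => /(_ _ e20); apply: filterS => i.
    by rewrite sub0r normrN.
  exists (maxn m M); first exact: leq_maxl.
  by apply: hM => /=; exact: leq_maxr.
have [z' [Bz' hz'] hq] := hz i mi.
set z := (fun u => z' u - z0 u) in hq.
have Bz : B 2 z.
  have := scaled_ballD ler01 ler01 Bz' (scaled_ballN Bz0).
  by rewrite (_ : 1 + 1 = 2).
have Yz : Y z by exists 2.
have phiz : e0 / 2 <= phi i z.
  rewrite phiB//; try exact: YB.
  by have := hz' i (leqnn _); move: hi => /ler_normlW; lra.
have mz := scaled_ball_measurable Bz.
have hlm j : (j < n)%N -> lmod j (fun u => z u ^+ 2) <= eta.
  move=> jn; apply: le_trans hq; rewrite /quad_form (bigD1 (Ordinal jn))//=.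
  rewrite -addrA lerDl addr_ge0 ?nmod_quad_ge0// sumr_ge0// => l _.
  by rewrite addr_ge0// ?lmod_sq_ge0// nmod_quad_ge0.
have hnm j : (j < n)%N -> nmod j (fun u => quad_mean mu tau z u.1) <= eta.
  move=> jn; apply: le_trans hq; rewrite /quad_form (bigD1 (Ordinal jn))//=.
  rewrite addrAC lerDr addr_ge0 ?lmod_sq_ge0// sumr_ge0// => l _.
  by rewrite addr_ge0// ?lmod_sq_ge0// nmod_quad_ge0.
pose J := [set j | eta1 < quad_mean mu tau z j].
pose iJ := \1_[set u : I * T | J u.1] : I * T -> R.
have nJ l : nmod l iJ <= e0 / 16.
  apply: hka => {}l lka.
  have ln : (l < n)%N by rewrite ltnS leq_max lka orbT.
  rewrite -(ler_pM2l eta10) -(modulusZ (scale_modulus_axioms l))//; last exact: scale_mult_indic.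
  apply: (@le_trans _ _ eta); last by rewrite ge_min lexx.
  apply: le_trans (hnm l ln); apply: (modulus_le (scale_modulus_axioms l)).
  - by apply: (mult_scale (scale_modulus_axioms l)); [exact: ltW|exact: scale_mult_indic].
  - exact: quad_scale_mult.
  - move=> u; rewrite indicE; have [/set_mem uJ|uJ] := boolP (u \in _).
      by rewrite mulr1; exact: ltW.
    by rewrite mulr0; have /andP[] := quad_mean_bound tau_ge0 u.1 (ltr0n R 2) Bz.
pose A := [set u : I * T | ~ J u.1 /\ 2 * e' < `|z u|].
have mA j : measurable [set x | A (j, x)].
  have [Jj|Jj] := pselect (J j).
    rewrite (_ : [set x | _] = set0)//; apply/seteqP; split => // x [/=].
    by move=> /(_ Jj).
  rewrite (_ : [set x | _] = [set: T] `&` (fun x => `|z (j, x)|) @^-1` `]2 * e', +oo[); last first.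
    by apply/seteqP; split => x /=; rewrite in_itv/= andbT => -[].
  have mnz : measurable_fun setT (fun x => `|z (j, x)|) by exact: measurableT_comp.
  by apply: mnz.
have Yiz : Y (fun u => ((2 * e') ^+ 2)^-1 * z u ^+ 2).
  by apply: scaled_spaceZ => //; exact: (sq_space_mult Yz).2.
have Alez u : (2 * e') ^+ 2 * \1_A u <= z u ^+ 2.
  rewrite indicE; have [/set_mem [_ uA]|uA] := boolP (u \in A).
    by rewrite mulr1 -[leRHS]real_normK ?num_real// ler_sqr ?nnegrE ?mulr_ge0// ltW.
  by rewrite mulr0 sqr_ge0.
have MA : space_mult \1_A.
  split; first by move=> u; rewrite indicE.
  have [c c0 Bc] := Yiz; exists c => //; apply: (scaled_ball_dom Bc).
    exact: slice_measurable_indic.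
  move=> u; have g0 : 0 <= ((2 * e') ^+ 2)^-1 * z u ^+ 2.
    by apply: mulr_ge0; [rewrite invr_ge0 ltW|exact: sqr_ge0].
  have i0 : 0 <= \1_A u :> R by rewrite indicE.
  by rewrite (ger0_norm g0) (ger0_norm i0) ler_pdivlMl.
exists (A, i); split => //=.
- move=> j; have [Jj|Jj] := pselect (J j).
    rewrite (_ : [set x | _] = set0) ?measure0.
      by rewrite mule_ge0// lee_fin invr_ge0 exprn_ge0.
    by apply/seteqP; split => // x [/=] /(_ Jj).
  apply: (@le_trans _ _ (mu [set x | (2 * e' < `|z (j, x)|)%R])).
    apply: le_measure; rewrite ?inE//.
      rewrite (_ : [set x | _] = [set x | A (j, x)])//.
      by apply/seteqP; split => x /=; [split|case].
    by move=> x [].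
  apply: quad_mean_markov => //; first by rewrite mulr_gt0.
  - by rewrite leNgt; apply/negP.
- move=> l lk; have ln : (l < n)%N by rewrite ltnS leq_max lk.
  rewrite -(ler_pM2l e2) -(modulusZ (space_modulus_axioms l))//.
  apply: (@le_trans _ _ eta); last by rewrite ge_min lexx orbT.
  apply: le_trans (hlm l ln); apply: (modulus_le (space_modulus_axioms l)) => //.
  - by apply: (mult_scale (space_modulus_axioms l)) => //; exact: ltW.
  - exact: sq_space_mult.
(* Halving brings [z] back to the unit ball and the height [2 * e'] down to [e']. Of
   [e0 / 4 <= phi i h], the exceptional scales and the values up to [e'] take at most [e0 / 16]
   each, which leaves [e0 / 8] for [\1_A]. *)
pose h u := 2^-1 * z u.
have Bh : B 1 h.
  have -> : 1 = `|2^-1| * 2 :> R by rewrite ger0_norm// mulVf.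
  exact: scaled_ballZ.
have Th : unit_tests h.
  by split=> [|[j x]]; [exact: scaled_ball_measurable Bh|have [] := Bh j].
have phih : e0 / 4 <= phi i h by rewrite phiZ//; lra.
pose hJ u := iJ u * h u; pose hA u := \1_A u * h u; pose hs u := h u - (hJ u + hA u).
have BhJ : B 1 hJ by exact: scale_indic_ball.
have BhA : B 1 hA.
  apply: (scaled_ball_dom Bh).
    apply: slice_measurableM; first exact: slice_measurable_indic.
    exact: scaled_ball_measurable Bh.
  by move=> u; rewrite normrM ler_piMl// indic_le1.
have hsE u : hs u = h u /\ `|h u| <= e' \/ hs u = 0.
  rewrite /hs /hJ /hA /iJ !indicE.
  have [Ju|Ju] := pselect (J u.1).
    right; rewrite mem_set// memNset; last by case.
    by rewrite mul1r mul0r addr0 subrr.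
  rewrite [u \in [set u | J u.1]]memNset// mul0r add0r.
  have [/set_mem Au|Au] := boolP (u \in A); first by right; rewrite mul1r subrr.
  left; rewrite mul0r subr0; split => //.
  have : ~ (2 * e' < `|z u|) by move=> hz1; move/negP : Au; apply; apply/mem_set.
  by move=> /negP; rewrite -leNgt /h normrM ger0_norm// ler_pdivrMl.
have Bhs : B 1 hs.
  apply: (scaled_ball_dom Bh).
    move=> j; apply: measurable_funB; first exact: (scaled_ball_measurable Bh).
    by apply: measurable_funD; [exact: (scaled_ball_measurable BhJ)|exact: (scaled_ball_measurable BhA)].
  by move=> u; have [[-> _]|->] := hsE u; rewrite ?normr0.
have h1 : `|phi i hs| <= e0 / 16.
  by apply: he' => // u; have [[-> //]|->] := hsE u; rewrite normr0 ltW.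
have h2 : `|phi i hJ| <= e0 / 16.
  apply: le_trans (nJ i).
  exact: (modulus_norm (scale_modulus_axioms i) (scale_mult_indic J) Bh).
have h3 : phi i hA <= lmod i \1_A by exact: (modulus_ub (space_modulus_axioms i)).
have h4 : phi i hs = phi i h - (phi i hJ + phi i hA).
  by rewrite phiB ?phiD//; try exact: YB; apply: scaled_spaceD; exact: YB.
move: h1 h2 => /ler_normlW h1 /ler_normlW h2; lra.
Qed.

(** The bounds [2 ^- k.+1 * tau j] for the pieces add up to [tau j], so the indicator of their union
    [E] is in the ball; the pieces then contradict the uniform continuity on its order interval. *)
Theorem weak_star_null_ball (e0 : R) : 0 < e0 ->
  ~ (forall N, exists2 y, B 1 y & forall i, (i <= N)%N -> e0 <= phi i y).
Proof.
move=> e00 hyp.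
have /choice[Ai hAi] k := small_support_piece k e00 hyp.
pose A k := (Ai k).1; pose E := \bigcup_k A k.
have mA k j : measurable [set x | A k (j, x)] by have [h _ _ _] := hAi k; exact: h.
have Ej j : [set x | E (j, x)] = \bigcup_k [set x | A k (j, x)].
  by apply/seteqP; split => x [k _ Ak]; exists k.
have mE j : measurable [set x | E (j, x)].
  by rewrite Ej; apply: bigcup_measurable => k _.
have e80 : 0 < e0 / 8 by rewrite divr_gt0.
apply: (@space_uniform_continuity E A (e0 / 8)) => //.
- apply: scaled_ball_indic => // j; rewrite Ej.
  apply: (le_trans (measure_sigma_subadditive _ _ _ (@subset_refl _ _))) => //.
    by rewrite -Ej.
  apply: (@le_trans _ _ (\sum_(0 <= k <oo) (2 ^- k.+1)%:E * tau j)%E).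
    by apply: lee_nneseries => k _ //; have [_ h _ _] := hAi k; exact: h.
  have [->|ty] := eqVneq (tau j) +oo%E; first by rewrite leey.
  have tf : tau j \is a fin_num by rewrite ge0_fin_numE// ltey.
  rewrite -(fineK tf); have ft0 : 0 <= fine (tau j) by exact: fine_ge0.
  apply: le_trans (epsilon_trick0 xpredT ft0).
  apply: lee_nneseries => k _; first by rewrite -EFinM lee_fin mulr_ge0// invr_ge0 exprn_ge0.
  by rewrite -EFinM lee_fin mulrC natrX.
- by move=> k u Au; exists k.
- by move=> k i ik; have [_ _ h _] := hAi k; exact: h.
- by move=> k; exists (Ai k).2; have [] := hAi k.
Qed.

End WeakStarNullBall.

(** * Rearrangements and growth of the fundamental function *)


Section Growth.
Variable R : realType.
Implicit Types (f psi : R -> R) (t s c : R).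

Lemma iterated_growth f (P : R -> Prop) c n t : 0 <= c ->
  (forall k, (k < n)%N -> P (2 ^+ k * t)) ->
  (forall s, P s -> c * f s <= f (2 * s)) -> c ^+ n * f t <= f (2 ^+ n * t).
Proof.
move=> c0 + h; elim: n => [|n IH] Pn; first by rewrite !expr0 !mul1r.
rewrite !exprS -!mulrA; apply: le_trans (h _ (Pn n _)) => //.
by rewrite ler_wpM2l// IH// => k kn; apply: Pn; exact: leqW.
Qed.

Lemma expr_ge2 c : 1 < c -> exists n, 2 <= c ^+ n.
Proof.
move=> c1; pose a := c - 1; have a0 : 0 < a by rewrite subr_gt0.
exists (Num.truncn a^-1).+1; have := truncnS_gt a^-1.
set n := (_.+1) => hn.
have h : 1 + n%:R * a <= c ^+ n.
  elim: (n) => [|m IH]; first by rewrite mul0r addr0.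
  rewrite exprS -natr1; apply: (@le_trans _ _ (c * (1 + m%:R * a))).
    have -> : c = 1 + a by rewrite /a; lra.
    have := ler0n R m; nra.
  by rewrite ler_wpM2l//; lra.
have : 1 <= n%:R * a by rewrite -ler_pdivrMr// mul1r ltW.
lra.
Qed.

(** Iterating the growth conditions gives the factor 2 near 0 with multiplier [2 ^+ m1] and near
    infinity with [2 ^+ m2]. For the [t] in between, which stay above [a / 2 ^+ m1], the multiplier
    [X * 2 ^+ m1 / a] carries [t] past the point [X], where [f] is already doubled. [N] dominates
    the three; [4 <= N] will give [2 <= N / 2]. *)
Lemma doubling_at_some_scale f :
  (forall t, 0 < t -> 0 < f t) -> (forall s t, 0 < s -> s <= t -> f s <= f t) ->
  liminf0_gt1 f -> liminfoo_gt1 f ->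
  exists2 N : R, 4 <= N & forall t, 0 < t -> 2 * f t <= f (N * t).
Proof.
move=> fpos fnd [c1 c11 h0] [c2 c21 hoo].
have [a a0 ha] : exists2 a, 0 < a & forall t, 0 < t < a -> c1 * f t <= f (2 * t).
  have [a /= a0 ha] := h0; exists a => // t /andP[t0 ta].
  have := ha t; rewrite /ball/= sub0r normrN gtr0_norm// => /(_ ta t0).
  by rewrite ltr_pdivlMr ?fpos// => /ltW.
have [b b0 hb] : exists2 b, 0 < b & forall t, b < t -> c2 * f t <= f (2 * t).
  have [b [_ hb]] := hoo; exists (Num.max b 1); first by rewrite lt_max ltr01 orbT.
  move=> t; rewrite gt_max => /andP[bt t1]; have t0 : 0 < t by exact: lt_trans t1.
  by have := hb t bt; rewrite ltr_pdivlMr ?fpos// => /ltW.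
have [m1 hm1] := expr_ge2 c11; have [m2 hm2] := expr_ge2 c21.
have grow0 t : 0 < t -> 2 ^+ m1 * t <= a -> 2 * f t <= f (2 ^+ m1 * t).
  move=> t0 ta; apply: (@le_trans _ _ (c1 ^+ m1 * f t)).
    by rewrite ler_wpM2r// ltW// fpos.
  apply: (iterated_growth (P := fun s => 0 < s < a)) => //; first by rewrite ltW// (lt_trans ltr01).
  move=> k km; rewrite mulr_gt0 ?exprn_gt0//=; apply: lt_le_trans ta.
  by rewrite ltr_pM2r// ltr_eXn2l// ltr1n.
have growoo t : b < t -> 2 * f t <= f (2 ^+ m2 * t).
  move=> bt; have t0 : 0 < t by exact: lt_trans bt.
  apply: (@le_trans _ _ (c2 ^+ m2 * f t)).
    by rewrite ler_wpM2r// ltW// fpos.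
  apply: (iterated_growth (P := fun s => b < s)) => //; first by rewrite ltW// (lt_trans ltr01).
  move=> k km; apply: (lt_le_trans bt); rewrite ler_peMl ?exprn_ege1// ?ler1n//.
  exact: ltW.
pose X : R := 2 ^+ m2 * (b + 1).
have X0 : 0 < X by rewrite mulr_gt0 ?exprn_gt0// addr_gt0.
have hX t : 0 < t -> t <= b -> 2 * f t <= f X.
  move=> t0 tb; apply: (@le_trans _ _ (2 * f (b + 1))).
    by rewrite ler_wpM2l// fnd//; lra.
  by apply: growoo; rewrite ltrDl.
have p1 : 0 < 2 ^+ m1 :> R by rewrite exprn_gt0.
have p2 : 0 < 2 ^+ m2 :> R by rewrite exprn_gt0.
have q0 : 0 < X * 2 ^+ m1 / a by rewrite divr_gt0// mulr_gt0.
pose N := 4 + 2 ^+ m1 + 2 ^+ m2 + X * 2 ^+ m1 / a.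
exists N; first by rewrite /N; lra.
move=> t t0; have [bt|tb] := ltP b t.
  apply: (le_trans (growoo t bt)); apply: fnd; first by rewrite mulr_gt0.
  by rewrite ler_wpM2r ?(ltW t0)// /N; lra.
have [ta|ta] := leP (2 ^+ m1 * t) a.
  apply: (le_trans (grow0 t t0 ta)); apply: fnd; first by rewrite mulr_gt0.
  by rewrite ler_wpM2r ?(ltW t0)// /N; lra.
apply: (le_trans (hX t t0 tb)); apply: fnd => //.
apply: (@le_trans _ _ (X * 2 ^+ m1 / a * t)).
  by rewrite mulrAC ler_pdivlMr// -(mulrA X); apply: ler_wpM2l; exact: ltW.
by rewrite ler_wpM2r ?(ltW t0)// /N; lra.
Qed.

(* On a finite interval [psi] is extended linearly past the midpoint; this changes it there by a
   factor at most [2] and makes the growth condition hold at infinity, too. *)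
Lemma regular_majorant (gamma : \bar R) psi :
  (0 < gamma)%E ->
  (forall t, 0 <= t -> (t%:E < gamma)%E -> 0 <= psi t) ->
  (exists t, [/\ 0 <= t, (t%:E < gamma)%E & psi t != 0]) ->
  (forall s t, 0 <= s -> s <= t -> (t%:E < gamma)%E -> psi s <= psi t) ->
  concave_on [set t | 0 <= t /\ (t%:E < gamma)%E] psi ->
  psi 0 = 0 ->
  (gamma = +oo%E /\ liminf0_gt1 psi /\ liminfoo_gt1 psi) \/
  ((gamma < +oo)%E /\ liminf0_gt1 psi) ->
  exists psi1 : R -> R, exists N : R,
  [/\ 4 <= N, forall t, 0 < t -> 0 < psi1 t,
      forall s t, 0 < s -> s <= t -> psi1 t / t <= psi1 s / s,
      forall t, 0 < t -> 2 * psi1 t <= psi1 (N * t) &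
      forall t, 0 < t -> (t%:E < gamma)%E -> 0 < psi t /\ psi t <= psi1 t <= 2 * psi t].
Proof.
move=> g0 psi_ge0 [t0 [t00 t0g psit0]] psi_nd psi_conc psi0 cond.
(* Concavity between 0 and [t] together with [psi 0 = 0]; this is the monotonicity of
   [psi t / t]. *)
have scale s t : 0 <= s -> s <= t -> 0 < t -> (t%:E < gamma)%E -> s / t * psi t <= psi s.
  move=> s0 st tp tg.
  have := psi_conc t 0 (s / t); rewrite psi0 !mulr0 !addr0 divfK ?gt_eqF//; apply.
  - by split => //; exact: ltW.
  - by split.
  - by rewrite divr_ge0//= ?(ltW tp)// ler_pdivrMr// mul1r.
have t0p : 0 < t0.
  by rewrite lt_neqAle t00 andbT; apply/eqP => e; move: psit0; rewrite -e psi0 eqxx.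
have psit0p : 0 < psi t0 by rewrite lt_neqAle eq_sym psit0 psi_ge0.
have psi_pos t : 0 < t -> (t%:E < gamma)%E -> 0 < psi t.
  move=> tp tg; have [tt|tt] := leP t t0.
    by apply: lt_le_trans (scale t t0 (ltW tp) tt t0p t0g); rewrite mulr_gt0// divr_gt0.
  by apply: (lt_le_trans psit0p); apply: psi_nd => //; exact: ltW.
have theta_ni s t : 0 < s -> s <= t -> (t%:E < gamma)%E -> psi t / t <= psi s / s.
  move=> sp st tg; have tp : 0 < t by exact: lt_le_trans st.
  have := scale s t (ltW sp) st tp tg.
  by rewrite ler_pdivlMr// (_ : s / t * psi t = psi t / t * s)//; ring.
case: cond => [[ginf [h0 hoo]]|[gfin h0]].
  have ltg t : (t%:E < gamma)%E by rewrite ginf ltry.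
  have [||N N4 hN] := @doubling_at_some_scale psi _ _ h0 hoo.
  - by move=> t tp; exact: psi_pos.
  - by move=> s t sp st; apply: psi_nd => //; exact: ltW.
  exists psi, N; split => //.
  - by move=> t tp; exact: psi_pos.
  - by move=> s t sp st; exact: theta_ni.
  - move=> t tp _; have := psi_pos t tp (ltg t) => pt; split => //; apply/andP; split => //; lra.
have gE : gamma = (fine gamma)%:E by rewrite fineK// ge0_fin_numE// ltW.
move: g0 psi_ge0 psi_nd psi_pos theta_ni gfin scale {psi_conc t0g}.
rewrite gE; set g := fine gamma; rewrite !lte_fin => g0 psi_ge0 psi_nd psi_pos theta_ni _ _.
pose t1 := g / 2; have t1p : 0 < t1 by rewrite divr_gt0.
have t1g : (t1%:E < g%:E)%E by rewrite lte_fin /t1; lra.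
have psit1 : 0 < psi t1 by exact: psi_pos.
pose psi1 t := if t <= t1 then psi t else psi t1 * (t / t1).
have psi1_pos t : 0 < t -> 0 < psi1 t.
  move=> tp; rewrite /psi1; case: ifPn => [tt|_]; last by rewrite mulr_gt0// divr_gt0.
  by apply: psi_pos => //; apply: le_lt_trans t1g; rewrite lee_fin.
have psi1_nd s t : 0 < s -> s <= t -> psi1 s <= psi1 t.
  move=> sp st; rewrite /psi1; have [ss|ss] := leP s t1; have [tt|tt] := leP t t1.
  - by apply: psi_nd => //; [exact: ltW|apply: le_lt_trans t1g; rewrite lee_fin].
  - apply: (@le_trans _ _ (psi t1)); first by apply: psi_nd => //; exact: ltW.
    by rewrite ler_peMr ?(ltW psit1)// ler_pdivlMr// mul1r ltW.
  - by have := lt_le_trans ss (le_trans st tt); rewrite ltxx.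
  - by rewrite ler_wpM2l ?(ltW psit1)// ler_wpM2r// invr_ge0 ltW.
have lin t : 0 < t -> psi t1 * (t / t1) / t = psi t1 / t1.
  by move=> tp; field; rewrite !gt_eqF.
have theta1_ni s t : 0 < s -> s <= t -> psi1 t / t <= psi1 s / s.
  move=> sp st; have tp : 0 < t by exact: lt_le_trans st.
  rewrite /psi1; have [tt|tt] := leP t t1; have [ss|ss] := leP s t1.
  - by apply: theta_ni => //; apply: le_lt_trans t1g; rewrite lee_fin.
  - by have := lt_le_trans ss (le_trans st tt); rewrite ltxx.
  - by rewrite lin//; exact: theta_ni.
  - by rewrite !lin.
have [||||N N4 hN] := @doubling_at_some_scale psi1.
- exact: psi1_pos.
- exact: psi1_nd.
- have [c c1 h] := h0; exists c => //; near=> t.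
  have t2 : 2 * t <= t1.
    rewrite -ler_pdivlMl// mulrC; near: t; apply: nbhs_right_le.
    by rewrite divr_gt0.
  have tp : 0 < t by near: t; exact: nbhs_right_gt.
  rewrite /psi1 t2 (_ : t <= t1); last by lra.
  by near: t.
(* The linear part doubles exactly, so any constant strictly between 1 and 2 serves. *)
- exists (3 / 2); first by lra.
  near=> t; have tt : t1 < t by near: t; apply: nbhs_pinfty_gt; exact: num_real.
  have tp : 0 < t by exact: lt_trans tt.
  rewrite /psi1 !leNgt tt (_ : t1 < 2 * t)/=; last by lra.
  have -> : psi t1 * (2 * t / t1) / (psi t1 * (t / t1)) = 2.
    by field; rewrite !gt_eqF.
  lra.
exists psi1, N; split => // t tp tg; split; first exact: psi_pos.
have pt := psi_pos t tp tg; rewrite /psi1; case: ifPn => [tt|].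
  by apply/andP; split => //; lra.
rewrite -ltNge => tt; apply/andP; split.
  have := theta_ni t1 t t1p (ltW tt) tg; rewrite ler_pdivrMr//.
  by rewrite mulrAC -mulrA.
apply: (@le_trans _ _ (psi t1 * 2)).
  rewrite ler_wpM2l ?(ltW psit1)// ler_pdivrMr// /t1.
  by move: tg; rewrite lte_fin; lra.
by rewrite mulrC ler_wpM2l// psi_nd// ltW.
Unshelve. all: by end_near.
Qed.

End Growth.


(** The integral of a nonnegative function is a supremum over the simple functions below it, hence
    monotone on arbitrary functions. It is applied to rearrangements without discussing their
    measurability. *)
Lemma ge0_le_integral_nonmeasurable d (T : measurableType d) (R : realType)
    (mu : {measure set T -> \bar R}) (D : set T) (f g : T -> \bar R) :
  (forall x, D x -> (0 <= f x)%E) -> (forall x, D x -> (f x <= g x)%E) ->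
  (\int[mu]_(x in D) f x <= \int[mu]_(x in D) g x)%E.
Proof.
move=> f0 fg; rewrite !ge0_integralE//; last by move=> x Dx; exact: le_trans (f0 x Dx) (fg x Dx).
apply: ereal_sup_le => _ [h /= hf <-]; exists h => // x.
apply: (le_trans (hf x)); rewrite /patch; case: ifPn => // /set_mem; exact: fg.
Qed.

(** * The norm in terms of distribution functions *)

Section Rearrangement.
Context {R : realType} {d : measure_display} {T : measurableType d}.
Variables (mu : {measure set T -> \bar R}) (psi psi1 : R -> R) (N : R).
Hypotheses (N4 : 4 <= N) (psi1_gt0 : forall t, 0 < t -> 0 < psi1 t)
  (theta_ni : forall s t, 0 < s -> s <= t -> psi1 t / t <= psi1 s / s)
  (psi1_doubling : forall t, 0 < t -> 2 * psi1 t <= psi1 (N * t))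
  (psi_psi1 : forall t, 0 < t -> (t%:E < mu setT)%E ->
     0 < psi t /\ psi t <= psi1 t <= 2 * psi t).

(* Distributional form of [drearr mu g t <= k * theta t] with [theta t = psi1 t / t]. *)
Definition dist_le (k : R) (g : T -> R) := forall t a : R, 0 < t -> k * (psi1 t / t) < a ->
  (mu [set x | (a < `|g x|)%R] <= t%:E)%E.

Lemma measurable_gt_norm (f : T -> R) (a : R) : measurable_fun setT f ->
  measurable [set x | a < `|f x|].
Proof.
move=> mf; rewrite (_ : [set x | _] = [set: T] `&` (fun x => `|f x|) @^-1` `]a, +oo[).
  have mnf : measurable_fun setT (fun x => `|f x|) by exact: measurableT_comp.
  by apply: mnf.
by apply/seteqP; split => x /=; rewrite in_itv/= andbT => //; case.
Qed.

Lemma drearr_ge0 f t : (0 <= drearr mu f t)%E.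
Proof. by apply: le_ereal_inf_tmp => _ [s [s0 _] <-]; rewrite lee_fin. Qed.

Lemma drearr_ni f s t : s <= t -> (drearr mu f t <= drearr mu f s)%E.
Proof.
move=> st; apply: le_ereal_inf => _ [a [a0 h] <-]; exists a => //; split => //.
by apply: (le_trans h); rewrite lee_fin.
Qed.

Lemma lebesgue_measure_oo (t : R) : 0 <= t ->
  lebesgue_measure [set s : R | (0 < s < t)%R] = t%:E.
Proof.
move=> t0; rewrite (_ : [set s | _] = `]0, t[%classic); last first.
  by apply/seteqP; split => s /=; rewrite in_itv.
rewrite lebesgue_measure_itv/= lte_fin; case: ifPn => [_|]; first by rewrite sube0.
by rewrite -leNgt => t0'; congr EFin; apply/eqP; rewrite eq_le t0.
Qed.

Lemma measurable_oo (t : R) : measurable [set s : R | (0 < s < t)%R].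
Proof.
by rewrite (_ : [set s | _] = `]0, t[%classic)//.
Qed.

(** As the rearrangement decreases, [t] times its value at [t] is at most its integral over
    [(0, t)], hence at most [psi t]. From the total measure on, the bound is trivial. *)
Lemma Mnorm_le1_dist f : measurable_fun setT f -> (Mnorm mu psi f <= 1)%E -> dist_le 1 f.
Proof.
move=> mf nf t a t0; rewrite mul1r => ta.
have [tg|] := ltP (t%:E) (mu setT); last first.
  by move=> gt; apply: le_trans gt; apply: le_measure; rewrite ?inE//; exact: measurable_gt_norm.
have [pt /andP[pp1 _]] := psi_psi1 t0 tg.
have : (drearr mu f t <= (psi t / t)%:E)%E.
  have : ((psi t)^-1%:E * (drearr mu f t * t%:E) <= 1)%E.
    apply: le_trans nf; apply: (@le_trans _ _ ((psi t)^-1%:E *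
      \int[lebesgue_measure]_(s in [set s : R | (0 < s < t)%R]) drearr mu f s)%E); last first.
      by apply: ereal_sup_ubound; exists t.
    apply: lee_wpmul2l; first by rewrite lee_fin invr_ge0 ltW.
    rewrite -(lebesgue_measure_oo (ltW t0)) -integral_cst; last exact: measurable_oo.
    apply: ge0_le_integral_nonmeasurable => s /=; first by rewrite drearr_ge0.
    by move=> /andP[_ /ltW]; exact: drearr_ni.
  case: (drearr mu f t) (drearr_ge0 f t) => [r| |]//.
    by move=> _; rewrite -!EFinM !lee_fin ler_pdivlMr// ler_pdivrMl// mulr1.
  by move=> _; rewrite gt0_mulye// gt0_muley ?lte_fin ?invr_gt0.
move=> hd; have : (drearr mu f t < a%:E)%E.
  apply: (le_lt_trans hd); rewrite lte_fin; apply: le_lt_trans ta.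
  by rewrite ler_wpM2r// invr_ge0 ltW.
move=> /ereal_inf_lt[_ [s [s0 hs] <-]]; rewrite lte_fin => sa.
apply: le_trans hs; apply: le_measure; rewrite ?inE//; try exact: measurable_gt_norm.
by move=> x /=; exact: lt_trans.
Qed.

Lemma psi1_iter t k : 0 < t -> psi1 (t / N ^+ k) <= 2 ^- k * psi1 t.
Proof.
move=> t0; have N0 : 0 < N by exact: lt_le_trans N4.
elim: k => [|k IH]; first by rewrite !expr0 invr1 mulr1 mul1r.
have p0 : 0 < t / N ^+ k.+1 by rewrite divr_gt0// exprn_gt0.
have := psi1_doubling p0.
have -> : N * (t / N ^+ k.+1) = t / N ^+ k.
  by rewrite exprS; field; rewrite ?expf_neq0// gt_eqF.
move=> h; rewrite [2 ^+ k.+1]exprS invfM -mulrA ler_pdivlMl//; exact: le_trans IH.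
Qed.

Lemma geometric_piece (s t : R) : 0 < s < t -> exists k : nat, t / N ^+ k.+1 <= s < t / N ^+ k.
Proof.
move=> /andP[s0 st]; have N0 : 0 < N by exact: lt_le_trans N4.
have [k hk] : exists k, t / N ^+ k.+1 <= s.
  exists (Num.truncn (t / s)); rewrite ler_pdivrMr ?exprn_gt0// mulrC -ler_pdivrMr//.
  apply/ltW; apply: (lt_le_trans (truncnS_gt _)).
  apply: (@le_trans _ _ (2 ^+ (Num.truncn (t / s)).+1)).
    by rewrite -natrX ler_nat ltnW// ltn_expl.
  by apply: lerXn2r; rewrite ?nnegrE// ?(ltW N0)//; apply: le_trans N4; rewrite ler_nat.
have ex : exists k, t / N ^+ k.+1 <= s by exists k.
case: (ex_minnP ex) => -[|m] hm mmin; first by exists 0%N; rewrite hm expr0 divr1.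
exists m.+1; rewrite hm ltNge; apply/negP => /mmin; by rewrite ltnn.
Qed.

(** The integral of [psi1 s / s] over [(0, t)] is comparable to [psi1 t]: for [s] between
    [t / N ^+ n.+1] and [t / N ^+ n] the contribution is at most [N * psi1 (t / N ^+ n.+1)], which
    doubling makes geometric in [n]. The factor 2 is the loss between [psi1] and [psi]. *)
Lemma Mnorm_dist k f : 0 <= k -> dist_le k f -> (Mnorm mu psi f <= (2 * N * k)%:E)%E.
Proof.
move=> k0 df; have N0 : 0 < N by exact: lt_le_trans N4.
have th_gt0 s : 0 < s -> 0 < psi1 s / s by move=> s0; rewrite divr_gt0// psi1_gt0.
have th_ge0 s : 0 < s -> 0 <= psi1 s / s by move=> /th_gt0/ltW.
have dr s : 0 < s -> (drearr mu f s <= (k * (psi1 s / s))%:E)%E.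
  move=> s0; apply/lee_addgt0Pr => e e0; apply: ereal_inf_lbound.
  exists (k * (psi1 s / s) + e) => //; split.
    by apply: addr_ge0 (ltW e0); apply: mulr_ge0 => //; exact: th_ge0.
  by apply: df => //; rewrite ltrDl.
apply: ge_ereal_sup => _ [t [t0 tg] <-].
have [pt /andP[_ p1p]] := psi_psi1 t0 tg.
pose c n := k * (psi1 (t / N ^+ n.+1) / (t / N ^+ n.+1)).
have tN n : 0 < t / N ^+ n by rewrite divr_gt0// exprn_gt0.
have c0 n : 0 <= c n by apply: mulr_ge0 => //; exact: th_ge0.
(* Full intervals from 0 replace the disjoint pieces: points are counted repeatedly, but the bounds
   still sum geometrically. *)
pose A n := [set s : R | (0 < s < t / N ^+ n)%R].
have hI : (\int[lebesgue_measure]_(s in [set s : R | (0 < s < t)%R]) drearr mu f s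
    <= (N * k * psi1 t)%:E)%E.
  apply: (@le_trans _ _ (\int[lebesgue_measure]_(s in [set s : R | (0 < s < t)%R])
      (\sum_(n <oo) (c n)%:E * (\1_(A n) s)%:E))%E).
    apply: ge0_le_integral_nonmeasurable => s /=; first by rewrite drearr_ge0.
    move=> st; have [n /andP[n1 n2]] := geometric_piece st.
    have [s0 _] := andP st.
    apply: (le_trans (dr s s0)); apply: (@le_trans _ _ ((c n)%:E * (\1_(A n) s)%:E)%E).
      rewrite indicE mem_set ?mule1; last by rewrite /A/= s0.
      by rewrite lee_fin ler_wpM2l// theta_ni.
    have pos m : (0 <= (c m)%:E * (\1_(A m) s)%:E)%E by rewrite -EFinM lee_fin mulr_ge0.
    apply: le_trans (nneseries_lim_ge n.+1 (fun m _ _ => pos m)).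
    by rewrite big_nat_recr//= leeDr// sume_ge0.
  rewrite integral_nneseries//; first last.
  - by move=> n s _; rewrite -EFinM lee_fin mulr_ge0.
  - move=> n; apply: emeasurable_funM => //; apply/measurable_EFinP.
    by apply: measurable_indic; exact: measurable_oo.
  - exact: measurable_oo.
  have N1 : 0 <= N * k * psi1 t by rewrite !mulr_ge0 ?(ltW N0) ?(ltW (psi1_gt0 t0)).
  apply: le_trans (epsilon_trick0 xpredT N1).
  apply: lee_nneseries => [n _ _|n _].
    by apply: integral_ge0 => s _; rewrite -EFinM lee_fin mulr_ge0.
  have mo := measurable_oo t.
  rewrite ge0_integralZl//; [|apply/measurable_EFinP/measurable_indic; exact: measurable_oo|by rewrite lee_fin].
  rewrite integral_indic; [|exact: measurable_oo|exact: measurable_oo].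
  apply: (@le_trans _ _ ((c n)%:E * (t / N ^+ n)%:E)%E).
    apply: lee_wpmul2l; first by rewrite lee_fin.
    rewrite -(lebesgue_measure_oo (ltW (tN n))); apply: le_measure; rewrite ?inE.
    + by apply: measurableI; exact: measurable_oo.
    + exact: measurable_oo.
    + exact: subIsetl.
  rewrite -EFinM lee_fin /c.
  have -> : k * (psi1 (t / N ^+ n.+1) / (t / N ^+ n.+1)) * (t / N ^+ n)
     = N * k * psi1 (t / N ^+ n.+1).
    by rewrite exprS; field; rewrite ?expf_neq0 ?gt_eqF.
  rewrite -[leRHS]mulrA ler_wpM2l//; first by rewrite mulr_ge0// ltW.
  by rewrite natrX [leRHS]mulrC; exact: psi1_iter.
apply: (@le_trans _ _ ((psi t)^-1%:E * (N * k * psi1 t)%:E)%E).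
  by apply: lee_wpmul2l => //; rewrite lee_fin invr_ge0 ltW.
rewrite -EFinM lee_fin ler_pdivrMl//.
have : N * k * psi1 t <= N * k * (2 * psi t) by rewrite ler_wpM2l// mulr_ge0// ltW.
lra.
Qed.

Lemma dist_leZ k g : 0 < k -> dist_le k g -> dist_le 1 (fun x => k^-1 * g x).
Proof.
move=> k0 dg t a t0; rewrite mul1r => ta.
rewrite (_ : [set x | _] = [set x | k * a < `|g x|]).
  by apply: dg => //; rewrite ltr_pM2l.
by apply/funext => x /=; rewrite normrM gtr0_norm ?invr_gt0// ltr_pdivlMl.
Qed.

End Rearrangement.

(** * Synthesis of functions from their slices *)


Lemma ge0_markov d (T : measurableType d) (R : realType) (mu : {measure set T -> \bar R})
    (f : T -> \bar R) (r : R) : 0 < r -> measurable_fun setT f -> (forall x, (0 <= f x)%E) ->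
  (r%:E * mu [set x | (r%:E <= f x)%E] <= \int[mu]_x f x)%E.
Proof.
move=> r0 mf f0; set A := [set x | _].
have mA : measurable A by rewrite -(setTI A); exact: emeasurable_fun_c_infty.
have mi : measurable_fun setT (EFin \o (\1_A : T -> R)).
  by apply/measurable_EFinP; exact: measurable_indic.
rewrite -(setIT A) -integral_indic// -ge0_integralZl//; last by rewrite lee_fin ltW.
apply: ge0_le_integral => //.
- by move=> x _; rewrite -EFinM lee_fin mulr_ge0// ltW.
- exact: emeasurable_funM.
- move=> x _; rewrite indicE; have [/set_mem xA|xA] := boolP (x \in A); first by rewrite mule1.
  by rewrite mule0.
Qed.

Section IntSums.
Variable R : realType.

(** The pairs [Posz k], [Negz k] with [k < n] enumerate the integers from [- n] to [n - 1], so a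
    bound by increments of [V] telescopes. *)
Lemma telescope_int (F V : int -> R) n : (forall j, F j <= V (j + 1) - V j) ->
  \sum_(k < n) (F (Posz k) + F (Negz k)) <= V n%:Z - V (- n%:Z).
Proof.
move=> h; elim: n => [|n IH]; first by rewrite big_ord0 oppr0 subrr.
rewrite big_ord_recr/=; have := h (Posz n); have := h (Negz n).
have -> : Negz n + 1 = - n%:Z by rewrite NegzE -addn1 PoszD opprD subrK.
have -> : Posz n + 1 = n.+1%:Z by rewrite -addn1 PoszD.
rewrite NegzE; lra.
Qed.

Lemma sum_low_powers (b : R) (J : int) n : 2 <= b ->
  \sum_(k < n) ((if Posz k <= J then b ^ Posz k else 0) +
                (if Negz k <= J then b ^ Negz k else 0)) <= b ^ (J + 1).
Proof.
move=> b2; have b0 : 0 < b by exact: lt_le_trans b2.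
pose F j := if j <= J then b ^ j else 0.
(* Up to [J] the increment of [V] is [b ^ (j + 1) - b ^ j], at least [b ^ j] because [2 <= b];
   beyond [J] it is 0. *)
pose V (j : int) := b ^ (Num.min j (J + 1)).
have V0 j : 0 < V j by rewrite exprz_gt0.
apply: (@le_trans _ _ (V n%:Z - V (- n%:Z))).
  apply: (@telescope_int F V) => j; rewrite /F /V; case: ifPn => [jJ|].
    rewrite !min_l ?lerD2r//; last by rewrite (le_trans jJ)// lerDl.
    rewrite expfzDr ?gt_eqF// expr1z; have := exprz_gt0 j b0; nra.
  rewrite -ltNge => Jj; rewrite !min_r ?subrr ?lerD2r// ?(ltW Jj)//.
  by rewrite lezD1.
apply: (@le_trans _ _ (V n%:Z)); first by rewrite gerBl ltW.
rewrite /V ler_weXz2l//; first by rewrite (le_trans _ b2)// ler1n.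
by rewrite ge_min lexx orbT.
Qed.

Lemma sum_high_powers (J : int) n :
  \sum_(k < n) ((if Posz k <= J then 0 else (2 : R) ^ (- Posz k)) +
                (if Negz k <= J then 0 else (2 : R) ^ (- Negz k))) <= 2 ^ (- J).
Proof.
pose F j : R := if j <= J then 0 else 2 ^ (- j).
pose V (j : int) : R := - 2 ^ (1 - Num.max j (J + 1)).
have V0 j : V j < 0 by rewrite oppr_lt0 exprz_gt0.
apply: (@le_trans _ _ (V n%:Z - V (- n%:Z))).
  apply: (@telescope_int F V) => j; rewrite /F /V; case: ifPn => [jJ|].
    by rewrite !max_r ?subrr ?lerD2r// (le_trans jJ)// lerDl.
  rewrite -ltNge => Jj; rewrite !max_l ?lerD2r ?(ltW Jj) ?lezD1//.
  have -> : 1 - (j + 1) = - j :> int by ring.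
  have -> : (2 : R) ^ (1 - j) = 2 * 2 ^ (- j) by rewrite expfzDr// expr1z.
  lra.
apply: (@le_trans _ _ (- V (- n%:Z))); first by rewrite gerDr ltW.
rewrite /V opprK ler_weXz2l ?ler1n//.
rewrite lerBlDr -lerBlDl opprK addrC.
by rewrite le_max lexx orbT.
Qed.

Lemma int_scale (b v : R) : 2 <= b -> 0 < v -> exists j : int, b ^ j < v <= b ^ (j + 1).
Proof.
move=> b2 v0; have b0 : 0 < b by exact: lt_le_trans b2.
have big (w : R) : exists n : nat, w < b ^+ n.
  exists (Num.truncn w).+1; apply: (lt_le_trans (truncnS_gt _)).
  apply: (@le_trans _ _ (2 ^+ (Num.truncn w).+1)).
    by rewrite -natrX ler_nat ltnW// ltn_expl.
  by apply: lerXn2r; rewrite ?nnegrE// ltW.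
have [m hm] := big v^-1; have [n hn] := big v.
have bm : b ^ (- m%:Z) < v.
  rewrite -exprnN -[ltRHS]invrK ltf_pV2 ?posrE ?invr_gt0 ?exprn_gt0//.
have ex : exists n : nat, v <= b ^ (n%:Z - m%:Z).
  exists (n + m)%N; rewrite PoszD addrK; exact: ltW.
case: (ex_minnP ex) => -[|k] hk kmin.
  by move: hk; rewrite sub0r leNgt bm.
exists (k%:Z - m%:Z); rewrite addrAC -[X in X + 1]/(k%:Z) -PoszD addn1 hk andbT ltNge.
by apply/negP => /kmin; rewrite ltnn.
Qed.

End IntSums.


Section Synthesis.
Context {R : realType} {d : measure_display} {T : measurableType d}.
Variables (mu : {measure set T -> \bar R}) (psi1 : R -> R) (N : R).
Hypotheses (N4 : 4 <= N) (psi1_gt0 : forall t, 0 < t -> 0 < psi1 t)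
  (theta_ni : forall s t, 0 < s -> s <= t -> psi1 t / t <= psi1 s / s)
  (psi1_doubling : forall t, 0 < t -> 2 * psi1 t <= psi1 (N * t)).
Local Notation b := (N / 2).
Local Notation theta t := (psi1 t / t).
Implicit Types (y z : int * T -> R) (f : T -> R).

(* The largest measure of [|f| > b ^ j] for [f] with rearrangement at most [theta]. *)
Definition level (j : int) : \bar R :=
  ereal_sup [set t%:E | t in [set t : R | t = 0 \/ 0 < t /\ b ^ j <= theta t]].

Local Notation B := (scaled_ball mu level).
Local Notation Y := (scaled_space mu level).

Let b2 : 2 <= b. Proof. by rewrite ler_pdivlMr// -natrM. Qed.
Let b0 : 0 < b. Proof. exact: lt_le_trans b2. Qed.
Let N0 : 0 < N. Proof. exact: lt_le_trans N4. Qed.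
Let th0 t : 0 < t -> 0 < theta t. Proof. by move=> t0; rewrite divr_gt0// psi1_gt0. Qed.

Lemma level_ge0 j : (0 <= level j)%E.
Proof. by apply: ereal_sup_ubound; exists 0 => //; left. Qed.

Lemma theta_iter t m : 0 < t -> theta t <= b ^+ m * theta (N ^+ m * t).
Proof.
move=> t0; elim: m => [|m IH]; first by rewrite !expr0 !mul1r.
apply: (le_trans IH); rewrite exprSr -mulrA ler_wpM2l ?exprn_ge0 ?(ltW b0)//.
have u0 : 0 < N ^+ m * t by rewrite mulr_gt0// exprn_gt0.
have := psi1_doubling u0; rewrite mulrA -exprS => h.
rewrite ler_pdivrMr//.
have -> : b * theta (N ^+ m.+1 * t) * (N ^+ m * t) = psi1 (N ^+ m.+1 * t) / 2.
  by rewrite exprS; field; rewrite ?expf_neq0 ?gt_eqF.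
by rewrite ler_pdivlMr// mulrC.
Qed.

(** If [t] exceeded [s / N ^+ m], then [theta] at [N ^+ m * t] would be at most [theta s], below
    [b ^ K], and returning to [t] costs only the factor [b ^+ m]. As [b = N / 2], height times level
    gains [2 ^- m]. *)
Lemma level_decay s K (m : nat) : 0 < s -> theta s < b ^ K ->
  (level (K + m%:Z) <= (s / N ^+ m)%:E)%E.
Proof.
move=> s0 sK; apply: ge_ereal_sup => _ [t [->|[t0 ht]] <-]; rewrite lee_fin.
  by rewrite divr_ge0 ?exprn_ge0 ?ltW.
rewrite ler_pdivlMr ?exprn_gt0// mulrC leNgt; apply/negP => h.
have := theta_ni s0 (ltW h); rewrite leNgt => /negP; apply.
apply: (lt_le_trans sK); move: ht; rewrite expfzDr ?gt_eqF// -exprnP => ht.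
by have := le_trans ht (theta_iter m t0); rewrite [b ^ K * _]mulrC ler_pM2l// exprn_gt0.
Qed.

Lemma dist_level f j : measurable_fun setT f -> dist_le mu psi1 1 f ->
  (mu [set x | (b ^ j < `|f x|)%R] <= level j)%E.
Proof.
move=> mf df; have [->|ly] := eqVneq (level j) +oo%E; first by rewrite leey.
have lf : level j \is a fin_num by rewrite ge0_fin_numE ?level_ge0// ltey.
apply/lee_addgt0Pr => e e0; rewrite -(fineK lf) -EFinD.
have l0 : 0 <= fine (level j) by rewrite fine_ge0// level_ge0.
apply: df; first by rewrite ltr_wpDl.
rewrite mul1r ltNge; apply/negP => h.
have : ((fine (level j) + e)%:E <= level j)%E.
  by apply: ereal_sup_ubound; exists (fine (level j) + e) => //; right; rewrite ltr_wpDl.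
by rewrite -{2}(fineK lf) lee_fin gerDl leNgt e0.
Qed.

(** Pairing the scales [k] and [- k - 1] turns a sum over the integers into a series over the
    naturals. *)
Definition synth_term y (k : nat) x : R :=
  b ^ (Posz k + 1) * y (Posz k, x) + b ^ (Negz k + 1) * y (Negz k, x).

Definition synth_absterm y (k : nat) x : R :=
  b ^ (Posz k + 1) * `|y (Posz k, x)| + b ^ (Negz k + 1) * `|y (Negz k, x)|.

Definition synth_dom y : set T := [set x | (\sum_(k <oo) (synth_absterm y k x)%:E < +oo)%E].

(* The sum of [b ^ (j + 1) * y_j] over all integers [j], and [0] where it does not converge
   absolutely. *)
Definition synth y (x : T) : R :=
  \1_(synth_dom y) x * limn (series (fun k => synth_term y k x)).

Let bj j : 0 < b ^ j. Proof. exact: exprz_gt0. Qed.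

Lemma synth_absterm_ge0 y k x : 0 <= synth_absterm y k x.
Proof. by rewrite addr_ge0// mulr_ge0// ltW. Qed.

Lemma synth_term_le y k x : `|synth_term y k x| <= synth_absterm y k x.
Proof.
apply: (le_trans (ler_normD _ _)); rewrite !normrM.
by rewrite (gtr0_norm (bj _)) (gtr0_norm (bj (Negz k + 1))).
Qed.

Lemma synth_cvg y x : synth_dom y x -> cvgn (series (fun k => synth_term y k x)).
Proof.
move=> yx; apply: normed_cvg; apply: (series_le_cvg _ _ (synth_term_le y ^~ x)).
- by move=> n; exact: normr_ge0.
- by move=> n; exact: synth_absterm_ge0.
- by apply: nnseries_is_cvg => // k; exact: synth_absterm_ge0.
Qed.

Lemma measurable_synth_absterm y k : slice_measurable y ->
  measurable_fun setT (fun x => (synth_absterm y k x)%:E).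
Proof.
move=> my; apply/measurable_EFinP; apply: measurable_funD; apply: measurable_funM => //;
  exact: measurableT_comp.
Qed.

Lemma measurable_synth_dom y : slice_measurable y -> measurable (synth_dom y).
Proof.
move=> my; rewrite -(setTI (synth_dom y)); apply: emeasurable_fun_infty_o => //.
apply: ge0_emeasurable_sum => k; first by move=> x _ _; rewrite lee_fin synth_absterm_ge0.
by move=> _; exact: measurable_synth_absterm.
Qed.

Lemma measurable_synth y : slice_measurable y -> measurable_fun setT (synth y).
Proof.
move=> my.
apply: (@measurable_fun_cvg _ _ _ setT
  (fun n x => \1_(synth_dom y) x * series (fun k => synth_term y k x) n)).
  move=> n; apply: measurable_funM; first exact/measurable_indic/measurable_synth_dom.
  apply: measurable_sum => k; apply: measurable_funD; exact: measurable_funM.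
move=> x _; rewrite /synth indicE; have [/set_mem yx|yx] := boolP (x \in _).
  by rewrite mul1r; under eq_fun do rewrite mul1r; exact: synth_cvg.
by rewrite mul0r; under eq_fun do rewrite mul0r; exact: cvg_cst.
Qed.

Lemma synth_linear a y z x : synth_dom y x -> synth_dom z x ->
  synth_dom (fun u => a * y u + z u) x ->
  synth (fun u => a * y u + z u) x = a * synth y x + synth z x.
Proof.
move=> yx zx wx; rewrite /synth !indicE !mem_set// !mul1r.
have -> : series (fun k => synth_term (fun u => a * y u + z u) k x) =
    (fun n => a * series (fun k => synth_term y k x) n + series (fun k => synth_term z k x) n).
  apply/funext => n; rewrite /series/= mulr_sumr -big_split/=.
  by apply: eq_bigr => k _; rewrite /synth_term; ring.
apply/cvg_lim => //; apply: cvgD; last exact: synth_cvg.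
by apply: cvgM; [exact: cvg_cst|exact: synth_cvg].
Qed.

Definition high_part y (J : int) (j : int) x : R :=
  if j <= J then 0 else b ^ (j + 1) * `|y (j, x)|.

Definition high_sum y (J : int) x : \bar R :=
  (\sum_(k <oo) (high_part y J (Posz k) x + high_part y J (Negz k) x)%:E)%E.

Lemma high_part_ge0 y J j x : 0 <= high_part y J j x.
Proof. by rewrite /high_part; case: ifP => // _; rewrite mulr_ge0// ltW. Qed.

Lemma high_sum_ge0 y J x : (0 <= high_sum y J x)%E.
Proof. by apply: nneseries_ge0 => k _ _; rewrite lee_fin addr_ge0// high_part_ge0. Qed.

Lemma synth_partial_le y J e x n : 0 <= e -> (forall u, `|y u| <= e) ->
  ((\sum_(k < n) synth_absterm y k x)%:E <= (e * b ^ (J + 2))%:E + high_sum y J x)%E.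
Proof.
move=> e0 ye.
have part j : b ^ (j + 1) * `|y (j, x)| <=
    e * b * (if j <= J then b ^ j else 0) + high_part y J j x.
  rewrite /high_part; case: ifP => _; last by rewrite mulr0 add0r.
  rewrite addr0 expfzDr ?gt_eqF// expr1z mulrC -mulrA [b * _]mulrC.
  by rewrite ler_wpM2r// ltW// mulr_gt0.
apply: (@le_trans _ _ ((e * b ^ (J + 2)) +
    \sum_(k < n) (high_part y J (Posz k) x + high_part y J (Negz k) x))%:E%E).
  rewrite lee_fin; apply: (@le_trans _ _ (\sum_(k < n)
      (e * b * ((if Posz k <= J then b ^ Posz k else 0) + (if Negz k <= J then b ^ Negz k else 0))
       + (high_part y J (Posz k) x + high_part y J (Negz k) x)))).
    apply: ler_sum => k _; apply: (le_trans (lerD (part (Posz k)) (part (Negz k)))).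
    by rewrite addrACA mulrDr.
  rewrite big_split/= lerD2r -mulr_sumr.
  have -> : e * b ^ (J + 2) = e * b * b ^ (J + 1).
    by rewrite -[2]/(1 + 1) addrA [b ^ (_ + 1)]expfzDr ?gt_eqF// expr1z; ring.
  by apply: ler_wpM2l; [rewrite mulr_ge0// ltW|exact: sum_low_powers].
rewrite EFinD leeD2l// -sumEFin -(big_mkord xpredT
  (fun k => (high_part y J (Posz k) x + high_part y J (Negz k) x)%:E)).
by apply: nneseries_lim_ge => k _ _; rewrite lee_fin addr_ge0// high_part_ge0.
Qed.

Lemma synth_norm_le y J e x : 0 <= e -> (forall u, `|y u| <= e) ->
  (`|synth y x|%:E <= (e * b ^ (J + 2))%:E + high_sum y J x)%E.
Proof.
move=> e0 ye; have s0 : (0 <= (e * b ^ (J + 2))%:E + high_sum y J x)%E.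
  by rewrite adde_ge0 ?high_sum_ge0// lee_fin mulr_ge0// ltW.
rewrite /synth indicE; have [/set_mem yx|yx] := boolP (x \in _); last by rewrite mul0r normr0.
rewrite mul1r; have /cvg_norm sc := synth_cvg yx.
have hs := synth_partial_le J x _ e0 ye.
move: s0 hs; case: (_ + _)%E => [r| |]// _ hs; last by rewrite leey.
rewrite lee_fin; apply: (cvgr_to_le sc); apply: nearW => n.
rewrite -lee_fin; apply: le_trans (hs n); rewrite lee_fin /series/= big_mkord.
apply: (le_trans (ler_norm_sum _ _ _)); apply: ler_sum => k _; exact: synth_term_le.
Qed.

Lemma synth_dom_high y J e x : 0 <= e -> (forall u, `|y u| <= e) ->
  (high_sum y J x < +oo)%E -> synth_dom y x.
Proof.
move=> e0 ye hy; rewrite /synth_dom/=.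
apply: (@le_lt_trans _ _ ((e * b ^ (J + 2))%:E + high_sum y J x)%E); last first.
  by rewrite lte_add_pinfty// ltry.
apply: lime_le.
  by apply: is_cvg_nneseries => k _ _; rewrite lee_fin synth_absterm_ge0.
by apply: nearW => n; rewrite big_mkord sumEFin; exact: synth_partial_le.
Qed.

Lemma measurable_high_part y J j : slice_measurable y ->
  measurable_fun setT (high_part y J j).
Proof.
move=> my; have [jJ|jJ] := boolP (j <= J).
  rewrite (_ : high_part y J j = cst 0); first exact: measurable_cst.
  by apply/funext => x; rewrite /high_part jJ.
rewrite (_ : high_part y J j = (fun x => b ^ (j + 1) * `|y (j, x)|)).
  by apply: measurable_funM => //; exact: measurableT_comp.
by apply/funext => x; rewrite /high_part (negbTE jJ).
Qed.

Lemma measurable_high_sum y J : slice_measurable y -> measurable_fun setT (high_sum y J).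
Proof.
move=> my; apply: ge0_emeasurable_sum => k.
  by move=> x _ _; rewrite lee_fin addr_ge0// high_part_ge0.
by move=> _; apply/measurable_EFinP; apply: measurable_funD; exact: measurable_high_part.
Qed.

(** At the scale [j = K + m] the height [b ^ (j + 1)] times the level is at most
    [s * b ^ (K + 1) * 2 ^- m]. The scales kept are those with [m >= L], and their geometric sum is
    the factor [2 * 2 ^- L]. *)
Lemma integral_high_sum y c s K (L : nat) : 0 < c -> 0 < s -> theta s < b ^ K ->
  slice_measurable y -> (forall j, (\int[mu]_x `|y (j, x)|%:E <= c%:E * level j)%E) ->
  (\int[mu]_x high_sum y (K + L%:Z - 1) x <= (s * (2 * c * 2 ^- L * b ^ (K + 1)))%:E)%E.
Proof.
move=> c0 s0 sK my iy; set J := K + L%:Z - 1.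
have mh j : measurable_fun setT (fun x => (high_part y J j x)%:E).
  by apply/measurable_EFinP; exact: measurable_high_part.
pose D := c * s * b ^ (K + 1) * 2 ^ K.
have D0 : 0 <= D by rewrite !mulr_ge0 ?(ltW c0) ?(ltW s0) ?(ltW (bj _)) ?(ltW (exprz_gt0 _ _)).
have ih j : (\int[mu]_x (high_part y J j x)%:E <= (D * (if j <= J then 0 else 2 ^ (- j)))%:E)%E.
  rewrite /high_part; case: ifPn => [_|]; first by rewrite integral0 mulr0.
  rewrite -ltNge => Jj.
  have [m jE] : exists m : nat, j = K + m%:Z.
    exists `|j - K|%N; rewrite gez0_abs ?subrKC// subr_ge0.
    have : K + L%:Z <= j by rewrite -lezD1 /J subrK in Jj.
    by apply: le_trans; rewrite lerDl.
  under eq_integral do rewrite EFinM.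
  rewrite ge0_integralZl//; [|exact: measurable_norm_EFin|by rewrite lee_fin ltW].
  apply: (@le_trans _ _ ((b ^ (j + 1))%:E * (c%:E * (s / N ^+ m)%:E))%E).
    apply: lee_wpmul2l; first by rewrite lee_fin ltW.
    apply: (le_trans (iy j)); apply: lee_wpmul2l; first by rewrite lee_fin ltW.
    by rewrite jE; exact: level_decay.
  rewrite -!EFinM lee_fin le_eqVlt; apply/orP; left; apply/eqP.
  rewrite /D jE opprD !expfzDr ?gt_eqF// -exprnN -!exprnP -[2 ^ (- K)]invr_expz.
  have -> : N ^+ m = b ^+ m * 2 ^+ m by rewrite -exprMn divfK.
  have := exprn_gt0 m b0; have := exprn_gt0 m (ltr0n R 2); have := exprz_gt0 K (ltr0n R 2).
  move: (b ^+ m) (b ^ K) (2 ^ K) (2 ^+ m) => p q r t r0 t0 p0; field.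
  by rewrite !gt_eqF.
rewrite /high_sum integral_nneseries//; first last.
- by move=> k x _; rewrite lee_fin addr_ge0// high_part_ge0.
- by move=> k; under eq_fun do rewrite EFinD; exact: emeasurable_funD.
apply: lime_le.
  apply: is_cvg_nneseries => k _ _; apply: integral_ge0 => x _.
  by rewrite lee_fin addr_ge0// high_part_ge0.
apply: nearW => n; rewrite big_mkord.
apply: (@le_trans _ _ (D * \sum_(k < n) ((if Posz k <= J then 0 else 2 ^ (- Posz k)) +
                (if Negz k <= J then 0 else 2 ^ (- Negz k))))%:E%E).
  rewrite mulr_sumr -sumEFin; apply: lee_sum => k _.
  under eq_integral do rewrite EFinD.
  rewrite ge0_integralD//; try by move=> x _; rewrite lee_fin high_part_ge0.
  by rewrite mulrDr EFinD; apply: leeD; exact: ih.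
rewrite lee_fin; apply: (@le_trans _ _ (D * 2 ^ (- J))).
  by rewrite ler_wpM2l//; exact: sum_high_powers.
rewrite le_eqVlt; apply/orP; left; apply/eqP; rewrite /D /J !opprD opprK !expfzDr ?gt_eqF//.
rewrite expr1z -exprnN -[2 ^ (- K)]invr_expz.
have := exprn_gt0 L (ltr0n R 2); have := exprz_gt0 K (ltr0n R 2).
move: (b ^ K) (2 ^ K) (2 ^+ L) => p q r q0 r0; field.
by rewrite !gt_eqF.
Qed.

End Synthesis.


Section SynthesisEstimates.
Context {R : realType} {d : measure_display} {T : measurableType d}.
Variables (mu : {measure set T -> \bar R}) (psi1 : R -> R) (N : R).
Hypotheses (N4 : 4 <= N) (psi1_gt0 : forall t, 0 < t -> 0 < psi1 t)
  (theta_ni : forall s t, 0 < s -> s <= t -> psi1 t / t <= psi1 s / s)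
  (psi1_doubling : forall t, 0 < t -> 2 * psi1 t <= psi1 (N * t)).
Local Notation b := (N / 2).
Local Notation theta t := (psi1 t / t).
Local Notation B := (scaled_ball mu (level psi1 N)).
Local Notation Y := (scaled_space mu (level psi1 N)).
Local Notation synth := (synth N).
Implicit Types (y z : int * T -> R) (f : T -> R).

Let b2 : 2 <= b. Proof. by rewrite ler_pdivlMr// -natrM. Qed.
Let b0 : 0 < b. Proof. exact: lt_le_trans b2. Qed.
Let th0 t : 0 < t -> 0 < theta t. Proof. by move=> t0; rewrite divr_gt0// psi1_gt0. Qed.

(** The cube collects one power of [b] for the width of the scale of [theta s], one for the strict
    inequality and one for the exponent [K + 1]. *)
Lemma scale_above s : 0 < s -> exists K : int, theta s < b ^ K /\ b ^ (K + 1) <= b ^+ 3 * theta s.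
Proof.
move=> s0; have [j /andP[j1 j2]] := int_scale b2 (th0 s0).
exists (j + 1 + 1); split.
  apply: (le_lt_trans j2); rewrite [ltRHS]expfzDr ?gt_eqF// expr1z.
  by rewrite ltr_pMr ?exprz_gt0// (lt_le_trans _ b2)// ltr1n.
have -> : b ^ (j + 1 + 1 + 1) = b ^+ 3 * b ^ j.
  by rewrite !expfzDr ?gt_eqF// !expr1z; move: (b ^ j) => p; ring.
by rewrite ler_wpM2l ?exprn_ge0 ?(ltW b0)// ltW.
Qed.

(* The scales up to [b ^ L] times [theta t] are bounded by the supremum of [y], the others are
   controlled by the Markov inequality. *)
Lemma synth_dist y e c (L : nat) : 0 <= e -> 0 < c -> slice_measurable y ->
  (forall u, `|y u| <= e) ->
  (forall j, (\int[mu]_x `|y (j, x)|%:E <= c%:E * level psi1 N j)%E) ->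
  dist_le mu psi1 (e * b ^+ (L + 3) + 2 * c * 2 ^- L * b ^+ 3) (synth y).
Proof.
move=> e0 c0 my ye iy t a t0 ha.
have [K [tK Kt]] := scale_above t0.
pose J := K + L%:Z - 1.
pose r := 2 * c * 2 ^- L * b ^+ 3 * theta t.
have L0 : 0 < 2 ^- L :> R by rewrite invr_gt0 exprn_gt0.
have r0 : 0 < r.
  by apply: mulr_gt0 (th0 t0); apply: mulr_gt0 (exprn_gt0 _ b0); apply: mulr_gt0 L0; lra.
(* [J + 2] is [(K + 1) + L], which together with the cube from [scale_above] gives the exponent
   [L + 3]. *)
have low : e * b ^ (J + 2) <= e * b ^+ (L + 3) * theta t.
  rewrite -mulrA ler_wpM2l//.
  have -> : J + 2 = (K + 1) + L%:Z by rewrite /J; ring.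
  rewrite expfzDr ?gt_eqF// -exprnP exprD -mulrA mulrC ler_wpM2l//.
  by rewrite exprn_ge0 ?(ltW b0).
have mh := measurable_high_sum N4 J my.
have := ge0_markov mu r0 mh (high_sum_ge0 N4 y J).
move=> /le_trans /(_ (integral_high_sum N4 theta_ni psi1_doubling L c0 t0 tK my iy)).
set A := [set x | (r%:E <= _)%E] => hA.
have mA : measurable A by rewrite -(setTI A); exact: emeasurable_fun_c_infty.
have mAt : (mu A <= t%:E)%E.
  rewrite -(@lee_pmul2l _ r%:E)//; apply: (le_trans hA).
  rewrite -EFinM lee_fin [leRHS]mulrC ler_wpM2l ?(ltW t0)//.
  rewrite /r -[leRHS]mulrA ler_wpM2l//.
  by apply: mulr_ge0 (ltW L0); lra.
apply: le_trans mAt; apply: le_measure; rewrite ?inE//.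
  by apply: measurable_gt_norm; exact: measurable_synth.
move=> x /= ax; rewrite /A/= leNgt; apply/negP => hr.
have := synth_norm_le N4 J x e0 ye.
rewrite leNgt => /negP; apply.
have hf : high_sum N y J x \is a fin_num.
  by rewrite ge0_fin_numE ?high_sum_ge0//; exact: lt_trans hr (ltry _).
move: hr; rewrite -(fineK hf) lte_fin -EFinD lte_fin => hr.
apply: le_lt_trans ax; apply: ltW; apply: le_lt_trans ha.
rewrite mulrDl -/r; lra.
Qed.

(** Already for [s = 1] and [L = 0] the part at high scales is integrable, hence finite almost
    everywhere; the low part converges everywhere because [y] is bounded. *)
Lemma synth_dom_conull y : Y y -> mu (~` synth_dom N y) = 0%E.
Proof.
move=> [c c0 By].
have my : slice_measurable y by move=> j; have [] := By j.
have ye u : `|y u| <= c by case: u => j x; have [] := By j.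
have [K [tK _]] := scale_above ltr01.
have hi := integral_high_sum N4 theta_ni psi1_doubling 0 c0 ltr01 tK my
  (fun j => let: And3 _ _ h := By j in h).
set J := K + _ - 1 in hi.
have mh := measurable_high_sum N4 J my.
have h0 x := high_sum_ge0 N4 y J x.
have ih : mu.-integrable setT (high_sum N y J).
  apply/integrableP; split => //.
  under eq_integral do rewrite gee0_abs//.
  by apply: (le_lt_trans hi); rewrite ltry.
have mD : measurable (~` synth_dom N y) by apply: measurableC; exact: measurable_synth_dom.
apply/negligibleP => //.
have := integrable_ae measurableT ih.
apply: negligibleS => x /= yx; apply: contra_not yx => /(_ I) hx.
apply: (synth_dom_high N4 (ltW c0) ye (J := J)).
by rewrite -ge0_fin_numE.
Qed.

Lemma dist_le_null f : measurable_fun setT f -> mu [set x | f x != 0] = 0%E ->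
  dist_le mu psi1 0 f.
Proof.
move=> mf f0 t a t0; rewrite mul0r => a0.
apply: (@le_trans _ _ (mu [set x | f x != 0])); last by rewrite f0 lee_fin ltW.
apply: le_measure; rewrite ?inE//.
- exact: measurable_gt_norm.
- rewrite (_ : [set x | _] = [set: T] `&` f @^-1` (~` [set 0])).
    by apply: mf => //; exact: measurableC.
  by apply/seteqP; split => x /=; [move=> /eqP h; split|case=> _ /eqP].
- by move=> x /= ax; rewrite -normr_gt0; exact: lt_trans ax.
Qed.

(* Slicing a function by the size of its values inverts [synth]. *)
Lemma synth_decomposition f : measurable_fun setT f -> dist_le mu psi1 1 f ->
  exists2 y, B 1 y & synth y = f.
Proof.
move=> mf df.
pose y (u : int * T) : R :=
  \1_[set x | b ^ u.1 < `|f x| <= b ^ (u.1 + 1)] u.2 * (f u.2 / b ^ (u.1 + 1)).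
have bj j : 0 < b ^ j by exact: exprz_gt0.
have mS j : measurable [set x | b ^ j < `|f x| <= b ^ (j + 1)].
  rewrite (_ : [set x | _] = [set x | b ^ j < `|f x|] `\` [set x | b ^ (j + 1) < `|f x|]).
    by apply: measurableD; exact: measurable_gt_norm.
  apply/seteqP; split => x /=; first by move=> /andP[h1 h2]; split => //; apply/negP; rewrite -leNgt.
  by move=> [h1 /negP]; rewrite -leNgt => h2; exact/andP.
have yE j x : y (j, x) = \1_[set x | b ^ j < `|f x| <= b ^ (j + 1)] x * (f x / b ^ (j + 1)) by [].
have y1 j x : `|y (j, x)| <= \1_[set x | b ^ j < `|f x|] x.
  rewrite yE !indicE; have [h|h] := boolP (b ^ j < `|f x| <= b ^ (j + 1)); last first.
    by rewrite memNset ?mul0r ?normr0//; exact/negP.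
  have /andP[h1 h2] := h.
  by rewrite !mem_set// mul1r normrM normfV (gtr0_norm (bj _)) ler_pdivrMr// mul1r.
exists y.
  move=> j; split.
  - rewrite (_ : (fun x => y (j, x)) = (fun x => \1_[set x | b ^ j < `|f x| <= b ^ (j + 1)] x
      * (f x * (b ^ (j + 1))^-1))); last by apply/funext.
    apply: measurable_funM; first exact: measurable_indic.
    exact: measurable_funM.
  - move=> x; apply: (le_trans (y1 j x)); rewrite indicE lern1; exact: leq_b1.
  - rewrite mul1e; apply: le_trans (dist_level N j mf df).
    have mg := measurable_gt_norm (b ^ j) mf.
    rewrite -[X in (_ <= mu X)%E]setIT -integral_indic//.
    apply: ge0_le_integral_nonmeasurable => x _; first by rewrite lee_fin.
    by rewrite lee_fin.
apply/funext => x.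
have [k0 hk0] : exists k0 : nat, forall k,
    synth_term N y k x = (k == k0)%:R * f x /\ synth_absterm N y k x = (k == k0)%:R * `|f x|.
  have [fx0|fx0] := eqVneq (f x) 0.
    exists 0%N => k; rewrite /synth_term /synth_absterm !yE fx0 normr0.
    by rewrite !mul0r !mulr0 !normr0 !mulr0 addr0.
  have nfx0 : 0 < `|f x| by rewrite normr_gt0.
  have [j0 hj0] := int_scale b2 nfx0.
  have yj j : b ^ (j + 1) * y (j, x) = (j == j0)%:R * f x.
    rewrite yE indicE; have [->|jj0] := eqVneq j j0.
      by rewrite mem_set// !mul1r mulrC divfK// gt_eqF.
    rewrite memNset ?mul0r ?mulr0//= => hj; move/eqP : jj0; apply.
    move: hj hj0 => /andP[h1 h2] /andP[h3 h4].
    have b1 : 1 < b by apply: lt_le_trans b2; rewrite ltr1n.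
    have := lt_le_trans h1 h4; have := lt_le_trans h3 h2.
    rewrite !ltr_eXz2l// !ltzD1 => ? ?.
    by apply/eqP; rewrite eq_le; apply/andP.
  have ynj j : b ^ (j + 1) * `|y (j, x)| = (j == j0)%:R * `|f x|.
    rewrite -{1}(gtr0_norm (bj (j + 1))) -normrM yj normrM; congr (_ * _).
    by rewrite ger0_norm.
  (* The scales [Posz k] and [Negz k] share the [k]-th term of the series, so only the index under
     the constructor matters. *)
  exists (match j0 with Posz k => k | Negz k => k end) => k.
  rewrite /synth_term /synth_absterm !yj !ynj.
  case: j0 {hj0 yj ynj} => m /=.
    by rewrite eqz_nat !mul0r !addr0.
  by rewrite !mul0r !add0r (_ : (Negz k == Negz m) = (k == m)).
have xdom : synth_dom N y x.
  apply: (@le_lt_trans _ _ (`|f x|%:E)); last exact: ltry.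
  apply: lime_le.
    by apply: is_cvg_nneseries => k _ _; rewrite lee_fin synth_absterm_ge0.
  apply: nearW => n; rewrite big_mkord sumEFin lee_fin.
  apply: (@le_trans _ _ (\sum_(k < n) (val k == k0)%:R * `|f x|)).
    by apply: ler_sum => k _; rewrite (hk0 k).2.
  rewrite -mulr_suml ler_piMl//; have [k0n|k0n] := ltnP k0 n.
    rewrite (bigD1 (Ordinal k0n))//= eqxx big1 ?addr0// => k kk.
    by rewrite (_ : (val k == k0) = false)//; apply/negbTE; apply: contra kk.
  rewrite big1// => k _; rewrite (_ : (val k == k0) = false)//.
  by apply/negbTE; rewrite neq_ltn (leq_trans (ltn_ord k) k0n).
rewrite /synth indicE mem_set// mul1r; apply/cvg_lim => //.
apply: cvg_near_cst; exists k0.+1 => // n /= k0n; apply/eqP.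
rewrite /series/= big_mkord (bigD1 (Ordinal k0n))//= (hk0 k0).1 eqxx mul1r big1 ?addr0//.
move=> k kk; rewrite (hk0 k).1 (_ : (val k == k0) = false) ?mul0r//.
by apply/negbTE; apply: contra kk.
Qed.

End SynthesisEstimates.

(** * Duality for Marcinkiewicz spaces *)


Section MarcinkiewiczDual.
Context {R : realType} {d : measure_display} {T : measurableType d}.
Variables (mu : {measure set T -> \bar R}) (psi psi1 : R -> R) (N : R).
Hypotheses (mu_gt0 : (0 < mu setT)%E)
  (N4 : 4 <= N) (psi1_gt0 : forall t, 0 < t -> 0 < psi1 t)
  (theta_ni : forall s t, 0 < s -> s <= t -> psi1 t / t <= psi1 s / s)
  (psi1_doubling : forall t, 0 < t -> 2 * psi1 t <= psi1 (N * t))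
  (psi_psi1 : forall t, 0 < t -> (t%:E < mu setT)%E ->
     0 < psi t /\ psi t <= psi1 t <= 2 * psi t).
Local Notation b := (N / 2).
Local Notation B := (scaled_ball mu (level psi1 N)).
Local Notation Y := (scaled_space mu (level psi1 N)).
Local Notation synth := (synth N).
Implicit Types (y z : int * T -> R) (f g : T -> R) (p q : (T -> R) -> R).

Let b2 : 2 <= b. Proof. by rewrite ler_pdivlMr// -natrM. Qed.
Let b0 : 0 < b. Proof. exact: lt_le_trans b2. Qed.
Let N0 : 0 < N. Proof. exact: lt_le_trans N4. Qed.

Lemma Mnorm_ge0 f : (0 <= Mnorm mu psi f)%E.
Proof.
have [t t0 tg] : exists2 t : R, 0 < t & (t%:E < mu setT)%E.
  have [->|gy] := eqVneq (mu setT) +oo%E; first by exists 1 => //; rewrite ltry.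
  have gf : mu setT \is a fin_num by rewrite ge0_fin_numE// ltey.
  exists (fine (mu setT) / 2); first by rewrite divr_gt0// fine_gt0// mu_gt0 ltey.
  rewrite -[ltRHS](fineK gf) lte_fin gtr_pMr ?fine_gt0 ?mu_gt0 ?ltey//.
  by rewrite invf_lt1// ltr1n.
apply: (@le_trans _ _ (((psi t)^-1)%:E *
  (\int[lebesgue_measure]_(s in [set s : R | (0 < s < t)%R]) drearr mu f s))%E).
  rewrite mule_ge0// ?lee_fin ?invr_ge0.
    by have [/ltW] := psi_psi1 t0 tg.
  by apply: integral_ge0 => s _; exact: drearr_ge0.
by apply: ereal_sup_ubound; exists t.
Qed.

Lemma fine_Mnorm_dist k f : 0 <= k -> dist_le mu psi1 k f ->
  (Mnorm mu psi f < +oo)%E /\ 0 <= fine (Mnorm mu psi f) <= 2 * N * k.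
Proof.
move=> k0 /(Mnorm_dist N4 psi1_gt0 theta_ni psi1_doubling psi_psi1 k0) h.
have hy : (Mnorm mu psi f < +oo)%E by exact: le_lt_trans h (ltry _).
split => //; rewrite fine_ge0 ?Mnorm_ge0//=.
by rewrite -lee_fin fineK// ge0_fin_numE ?Mnorm_ge0.
Qed.

(** Elements of the dual act on functions rather than on classes. The difference of two
    representatives has norm 0, and boundedness makes the values agree. *)
Lemma dual_eq_ae p f g : Mdual mu psi p -> Mspace mu psi f -> Mspace mu psi g ->
  mu [set x | f x != g x] = 0%E -> p f = p g.
Proof.
move=> [plin [C pC]] [mf _] Mg fg0; have [mg _] := Mg.
have mh : measurable_fun setT (fun x => f x - g x) by exact: measurable_funB.
have dh : dist_le mu psi1 0 (fun x => f x - g x).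
  apply: dist_le_null => //; rewrite -[RHS]fg0; congr (mu _).
  by apply/seteqP; split => x /=; rewrite subr_eq0.
have [hy h0] := fine_Mnorm_dist (lexx 0) dh.
have Mh : Mspace mu psi (fun x => f x - g x) := conj mh hy.
have nh : fine (Mnorm mu psi (fun x => f x - g x)) = 0.
  by apply/eqP; rewrite eq_le andbC; move: h0; rewrite mulr0.
have := plin 1 _ _ Mh Mg.
rewrite (_ : (1 \*: (fun x => f x - g x) \+ g) = f).
  have := pC _ Mh; rewrite nh mulr0 normr_le0 => /eqP ->.
  by rewrite mulr0 add0r.
by apply/funext => x /=; rewrite scale1r subrK.
Qed.

Lemma measurable_neq f g : measurable_fun setT f -> measurable_fun setT g ->
  measurable [set x | f x != g x].
Proof.
move=> mf mg; rewrite (_ : [set x | _] = [set x | 0 < `|f x - g x|]).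
  by apply: measurable_gt_norm; exact: measurable_funB.
by apply/seteqP; split => x /=; rewrite normr_gt0 subr_eq0.
Qed.

Lemma dist_le_ae k f g : measurable_fun setT f -> measurable_fun setT g ->
  mu [set x | f x != g x] = 0%E -> dist_le mu psi1 k f -> dist_le mu psi1 k g.
Proof.
move=> mf mg fg0 df t a t0 ha; apply: le_trans (df t a t0 ha).
have ma f' := measurable_gt_norm (f := f') a.
apply: (@le_trans _ _ (mu ([set x | f x != g x] `|` [set x | (a < `|f x|)%R]))).
  apply: le_measure; rewrite ?inE; [exact: ma|apply: measurableU; [exact: measurable_neq|exact: ma]|].
  by move=> x /= ax; have [->|] := eqVneq (f x) (g x); [right|left].
apply: (le_trans (measureU2 _ _ _)); [exact: measurable_neq|exact: ma|].
by rewrite -[X in (X + _)%E]/(mu [set x | f x != g x]) fg0 add0e.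
Qed.

Lemma synth_dist_space y : Y y -> exists2 k, 0 <= k & dist_le mu psi1 k (synth y).
Proof.
move=> [c c0 By].
have my : slice_measurable y by move=> j; have [] := By j.
have ye u : `|y u| <= c by case: u => j x; have [] := By j.
have iy j : (\int[mu]_x `|y (j, x)|%:E <= c%:E * level psi1 N j)%E by have [] := By j.
have sd := synth_dist N4 psi1_gt0 theta_ni psi1_doubling (L := 0%N) (ltW c0) c0 my ye iy.
eexists; last exact: sd.
have b3 n : 0 <= b ^+ n by exact: exprn_ge0 (ltW b0).
by rewrite expr0 invr1 mulr1; apply: addr_ge0; apply: mulr_ge0 (b3 _); lra.
Qed.

Lemma scaled_space_measurable y : Y y -> slice_measurable y.
Proof. by move=> [c _ By] j; have [] := By j. Qed.

Lemma synth_space y : Y y -> Mspace mu psi (synth y).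
Proof.
move=> Yy; have my := scaled_space_measurable Yy.
split; first exact: measurable_synth.
by have [k k0 dk] := synth_dist_space Yy; exact: (fine_Mnorm_dist k0 dk).1.
Qed.

Lemma synth_bound : exists2 C : R, 0 <= C & forall y, B 1 y ->
  fine (Mnorm mu psi (synth y)) <= C.
Proof.
pose k : R := 1 * b ^+ (0 + 3) + 2 * 1 * 2 ^- 0 * b ^+ 3.
have k0 : 0 <= k.
  have b3 n : 0 <= b ^+ n by exact: exprn_ge0 (ltW b0).
  by rewrite /k expr0 invr1 mulr1; apply: addr_ge0; apply: mulr_ge0 (b3 _); lra.
exists (2 * N * k); first by rewrite !mulr_ge0// ltW.
move=> y By.
have my : slice_measurable y by move=> j; have [] := By j.
have ye u : `|y u| <= 1 by case: u => j x; have [] := By j.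
have iy j : (\int[mu]_x `|y (j, x)|%:E <= 1%:E * level psi1 N j)%E by have [] := By j.
have sd := synth_dist N4 psi1_gt0 theta_ni psi1_doubling (L := 0%N) ler01 ltr01 my ye iy.
by have [_ /andP[]] := fine_Mnorm_dist k0 sd.
Qed.

(** [synth] is shown linear only where the series converge, that is, off a null set. Linearity of
    [p] is therefore applied to the exact remainder [g], which [dual_eq_ae] exchanges for
    [synth z]. *)
Lemma dual_synth_linear p a y z : Mdual mu psi p -> Y y -> Y z ->
  p (synth (fun u => a * y u + z u)) = a * p (synth y) + p (synth z).
Proof.
move=> dp Yy Yz; have [plin _] := dp.
have l0 := level_ge0 psi1 N.
have Yw : Y (fun u => a * y u + z u).
  by apply: scaled_spaceD => //; exact: scaled_spaceZ.
have Sy := synth_space Yy; have Sz := synth_space Yz; have Sw := synth_space Yw.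
have mS w : Y w -> measurable_fun setT (synth w).
  by move=> /scaled_space_measurable mw; exact: measurable_synth.
pose g x := synth (fun u => a * y u + z u) x - a * synth y x.
have mg : measurable_fun setT g.
  by apply: measurable_funB; [exact: mS|apply: measurable_funM => //; exact: mS].
have gz : mu [set x | synth z x != g x] = 0%E.
  apply/negligibleP; first by apply: measurable_neq => //; exact: mS.
  have ng w : Y w -> mu.-negligible (~` synth_dom N w).
    move=> Yw'; apply/negligibleP; last exact: (synth_dom_conull N4 psi1_gt0 theta_ni psi1_doubling Yw').
    by apply: measurableC; apply: measurable_synth_dom => //; exact: scaled_space_measurable.
  apply: negligibleS (negligibleU (negligibleU (ng _ Yy) (ng _ Yz)) (ng _ Yw)).
  move=> x /= gx; apply: contrapT => /not_orP[/not_orP[/contrapT h1 /contrapT h2] /contrapT h3].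
  by move/eqP : gx; apply; rewrite /g synth_linear// addrC addKr.
have [k k0 dk] := synth_dist_space Yz.
have dg := dist_le_ae (mS _ Yz) mg gz dk.
have Sg : Mspace mu psi g by split => //; exact: (fine_Mnorm_dist k0 dg).1.
rewrite (dual_eq_ae dp Sz Sg gz) -plin//; congr p.
by apply/funext => x /=; rewrite /g addrC subrK.
Qed.

Lemma Mspace0 : Mspace mu psi (fun=> 0).
Proof.
have m0 : measurable_fun setT (fun _ : T => 0 : R) by exact: measurable_cst.
split => //; apply: (fine_Mnorm_dist (lexx 0) _).1.
apply: dist_le_null => //; rewrite (_ : [set x | _] = set0) ?measure0//.
by apply/seteqP; split => x //=; rewrite eqxx.
Qed.

Lemma dual0 p : Mdual mu psi p -> p (fun=> 0) = 0.
Proof.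
move=> [plin _]; have := plin 1 _ _ Mspace0 Mspace0.
rewrite (_ : (1 \*: (fun=> 0) \+ (fun=> 0)) = (fun=> 0)); first lra.
by apply/funext => x /=; rewrite scaler0 addr0.
Qed.

Lemma dualZ p a f : Mdual mu psi p -> Mspace mu psi f -> p (fun x => a * f x) = a * p f.
Proof.
move=> dp Mf; have [plin _] := dp.
rewrite -[RHS]addr0 -(dual0 dp) -(plin a _ _ Mf Mspace0); congr p.
by apply/funext => x /=; rewrite addr0.
Qed.

(** [L] is chosen first, to bring the high scales below [e / 2], and then the bound on [y], to do
    the same for the low ones. So [e^-1 * synth y] has rearrangement at most [theta], and slicing it
    anew gives [z], which need not be a multiple of [y]. *)
Lemma synth_small (e : R) : 0 < e -> exists2 e' : R, 0 < e' &
  forall y, B 1 y -> (forall u, `|y u| <= e') ->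
  exists2 z, B 1 z & forall p, Mdual mu psi p -> p (synth y) = e * p (synth z).
Proof.
move=> e0; have b30 : 0 < b ^+ 3 by exact: exprn_gt0.
have [L hL] : exists L : nat, 2 * 1 * 2 ^- L * b ^+ 3 <= e / 2.
  pose L := (Num.truncn (4 * b ^+ 3 / e)).+1; exists L.
  have L0 : 0 < 2 ^+ L :> R by rewrite exprn_gt0.
  have : 4 * b ^+ 3 / e < 2 ^+ L.
    by apply: (lt_le_trans (truncnS_gt _)); rewrite -natrX ler_nat ltnW// ltn_expl.
  rewrite ltr_pdivrMr// => h.
  by rewrite mulr1 mulrAC ler_pdivrMr//; lra.
have bL0 : 0 < b ^+ (L + 3) by exact: exprn_gt0.
exists (e / 2 / b ^+ (L + 3)); first by rewrite !divr_gt0.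
move=> y By ye.
have Yy : Y y by exists 1.
have my := scaled_space_measurable Yy.
have iy j : (\int[mu]_x `|y (j, x)|%:E <= 1%:E * level psi1 N j)%E by have [] := By j.
have e'0 : 0 <= e / 2 / b ^+ (L + 3) by rewrite ltW// !divr_gt0.
have sd := synth_dist N4 psi1_gt0 theta_ni psi1_doubling (L := L) e'0 ltr01 my ye iy.
have de : dist_le mu psi1 e (synth y).
  move=> t a t0 ha; apply: sd => //; apply: le_lt_trans ha.
  rewrite ler_wpM2r//; first by rewrite divr_ge0 ?(ltW t0)// ltW// psi1_gt0.
  by rewrite divfK ?gt_eqF//; lra.
have mg : measurable_fun setT (fun x => e^-1 * synth y x).
  by apply: measurable_funM => //; exact: measurable_synth.
have [z Bz zE] := synth_decomposition N4 mg (dist_leZ e0 de).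
have Sz : Mspace mu psi (synth z) by apply: synth_space; exists 1.
exists z => // p dp; rewrite -(dualZ e dp Sz); congr p.
by apply/funext => x; rewrite zE mulrA divff ?gt_eqF// mul1r.
Qed.

Lemma dual_add p q a : Mdual mu psi p -> Mdual mu psi q -> Mdual mu psi (a \*: p \+ q).
Proof.
move=> [plin [C pC]] [qlin [D qD]]; split.
  by move=> c f g Mf Mg /=; rewrite plin// qlin// /GRing.scale/=; ring.
exists (`|a| * C + D) => f Mf /=; apply: (le_trans (ler_normD _ _)).
rewrite mulrDl -mulrA; apply: lerD; last exact: qD.
by rewrite normrM ler_wpM2l// pC.
Qed.

Lemma dual_zero : Mdual mu psi (fun=> 0).
Proof.
split; first by move=> c f g _ _; rewrite mulr0 addr0.
by exists 0 => f _; rewrite normr0 mul0r.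
Qed.

(** The unit ball of the space lies in the image of [B 1] under [synth]. Finiteness of the supremum
    has to be shown on the way, as [fine] sends infinite values to 0. *)
Lemma dualnorm_bound p M : 0 <= M -> Mdual mu psi p ->
  (forall y, B 1 y -> `|p (synth y)| <= M) -> 0 <= Mdualnorm mu psi p <= M.
Proof.
move=> M0 dp hM; rewrite /Mdualnorm; set S := ereal_sup _.
have SM : (S <= M%:E)%E.
  apply: ge_ereal_sup => _ [f [[mf _] nf] <-]; rewrite lee_fin.
  have [y By <-] := synth_decomposition N4 mf (Mnorm_le1_dist psi_psi1 mf nf).
  exact: hM.
have S0 : (0 <= S)%E.
  apply: ereal_sup_ubound; exists (fun=> 0); last by rewrite (dual0 dp) normr0.
  split; first exact: Mspace0.
  have d0 : dist_le mu psi1 0 (fun=> 0 : R).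
    apply: dist_le_null => //; rewrite (_ : [set x | _] = set0) ?measure0//.
    by apply/seteqP; split => x //=; rewrite eqxx.
  have := Mnorm_dist N4 psi1_gt0 theta_ni psi1_doubling psi_psi1 (lexx 0) d0.
  by move=> /le_trans; apply; rewrite lee_fin mulr0.
rewrite fine_ge0//= -lee_fin fineK// ge0_fin_numE//.
exact: le_lt_trans SM (ltry _).
Qed.

Lemma dual_synth_bounded p : Mdual mu psi p ->
  exists C : R, forall y, B 1 y -> `|p (synth y)| <= C.
Proof.
move=> [_ [C pC]]; have [D D0 hD] := synth_bound; exists (`|C| * D) => y By.
have Sy : Mspace mu psi (synth y) by apply: synth_space; exists 1.
have [_ h] := Sy.
apply: (le_trans (pC _ Sy)); apply: (@le_trans _ _ (`|C| * fine (Mnorm mu psi (synth y)))).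
  by rewrite ler_wpM2r ?ler_norm// fine_ge0// Mnorm_ge0.
by rewrite ler_wpM2l// hD.
Qed.

(** * Bidual elements and Helly's theorem *)

Section Bidual.
Variable Phi : ((T -> R) -> R) -> R.
Hypothesis bPhi : Mbidual mu psi Phi.

Lemma bidual0 : Phi (fun=> 0) = 0.
Proof.
have [Plin _] := bPhi; have := Plin 1 _ _ dual_zero dual_zero.
rewrite (_ : (1 \*: (fun=> 0) \+ (fun=> 0)) = (fun=> 0)); first lra.
by apply/funext => x /=; rewrite scaler0 addr0.
Qed.

Lemma bidual_sum (n : nat) (u : 'I_n -> R) (chi : 'I_n -> (T -> R) -> R) (r : seq 'I_n) :
  (forall i, Mdual mu psi (chi i)) ->
  Mdual mu psi (fun f => \sum_(i <- r) u i * chi i f) /\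
  Phi (fun f => \sum_(i <- r) u i * chi i f) = \sum_(i <- r) u i * Phi (chi i).
Proof.
move=> dchi; have [Plin _] := bPhi; elim: r => [|i r [IH1 IH2]].
  have -> : (fun f => \sum_(i <- [::]) u i * chi i f) = (fun=> 0).
    by apply/funext => f; rewrite big_nil.
  by split; [exact: dual_zero|rewrite big_nil bidual0].
have -> : (fun f => \sum_(i <- i :: r) u i * chi i f) =
    (u i \*: chi i \+ (fun f => \sum_(i <- r) u i * chi i f)).
  by apply/funext => f; rewrite big_cons.
by split; [exact: dual_add|rewrite Plin// IH2 big_cons].
Qed.

Lemma bidual_bound : exists2 C : R, 0 < C & forall p M, 0 <= M -> Mdual mu psi p ->
  (forall y, B 1 y -> `|p (synth y)| <= M) -> `|Phi p| <= C * M.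
Proof.
have [_ [C hC]] := bPhi; exists (`|C| + 1); first by rewrite ltr_wpDl.
move=> p M M0 dp hM; have /andP[n0 nM] := dualnorm_bound M0 dp hM.
apply: (le_trans (hC _ dp)); apply: (@le_trans _ _ (`|C| * Mdualnorm mu psi p)).
  by rewrite ler_wpM2r// ler_norm.
by rewrite ler_pM// lerDl.
Qed.

(** On a combination of the [chi i], [Phi] is at most [C] times the supremum over the ball; this is
    the hypothesis of [helly_approx] for the values scaled by [C]. An error below [e / 2] in each
    coordinate leaves [e / 2], hence the constant [e / 2 / C]. *)
Lemma bidual_helly (chi : nat -> (T -> R) -> R) (e : R) : 0 < e ->
  (forall i, Mdual mu psi (chi i)) ->
  (forall y, B 1 y -> chi i (synth y) @[i --> \oo] --> 0) ->
  (forall i, e <= Phi (chi i)) ->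
  exists2 e0 : R, 0 < e0 &
    forall n, exists2 y, B 1 y & forall i, (i <= n)%N -> e0 <= chi i (synth y).
Proof.
move=> e0 dchi chi0 Phie; have [C C0 hC] := bidual_bound.
have l0 := level_ge0 psi1 N.
have chilin i a y z : Y y -> Y z ->
    chi i (synth (fun u => a * y u + z u)) = a * chi i (synth y) + chi i (synth z).
  exact: dual_synth_linear.
have chiZ i a y : Y y -> chi i (synth (fun u => a * y u)) = a * chi i (synth y).
  exact: (scaled_functionalZ l0 (phi := fun i y => chi i (synth y)) chilin).
have [D D0 hD] := @uniform_boundedness _ _ _ mu _ _ l0 (fun i y => chi i (synth y)) chilin
  (fun i => dual_synth_bounded (dchi i)) chi0.
exists (e / 2 / C); first by rewrite !divr_gt0.
move=> n.
pose S := [set s : 'I_n.+1 -> R | exists2 y, B 1 y & s = (fun i => C * chi i (synth y))].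
have B0 : B 1 (fun=> 0) by exact: scaled_ball0.
have e2 : 0 < (e / 2) ^+ 2 by rewrite exprn_gt0// divr_gt0.
have [||||_ [y By ->] hy] := @helly_approx _ _ S (fun i => Phi (chi i)) (C * D) _ _ _ _ _ e2.
- by exists (fun i => C * chi i (synth (fun=> 0))); exists (fun=> 0).
- move=> _ i [y By ->]; rewrite normrM gtr0_norm// ler_pM2l//; exact: hD.
- move=> _ _ t [y By ->] [z Bz ->] t01.
  exists (fun u => (1 - t) * y u + t * z u); first exact: scaled_ball_conv.
  have Yy : Y y := ex_intro2 _ _ 1 ltr01 By.
  have Yz : Y z := ex_intro2 _ _ 1 ltr01 Bz.
  have Ytz := scaled_spaceZ l0 t Yz.
  by apply/funext => i; rewrite (chilin i (1 - t) _ _ Yy Ytz) (chiZ i t _ Yz); ring.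
- move=> u c c0.
  pose p f := \sum_i u i * chi i f.
  have [dp Pp] := bidual_sum u (index_enum 'I_n.+1) (fun i : 'I_n.+1 => dchi i).
  pose Q := [set `|p (synth y)| | y in B 1].
  have Qub : has_ubound Q.
    have [M hM] := dual_synth_bounded dp.
    by exists M => _ [y By <-]; exact: hM.
  have Qne : Q !=set0 by exists `|p (synth (fun=> 0))|; exists (fun=> 0).
  have hQ y : B 1 y -> `|p (synth y)| <= sup Q by move=> By; apply: ub_le_sup => //; exists y.
  have Q0 : 0 <= sup Q by exact: le_trans (normr_ge0 _) (hQ _ B0).
  have PQ : \sum_i u i * Phi (chi i) <= C * sup Q.
    by rewrite -Pp; apply: le_trans (ler_norm _) _; exact: hC.
  have [_ [y By <-] hy] := sup_adherent (divr_gt0 c0 C0) (conj Qne Qub).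
  (* The supremum is over absolute values; the symmetry of the ball absorbs the sign. *)
  have [z Bz pz] : exists2 z, B 1 z & p (synth z) = `|p (synth y)|.
    have [p0|p0] := leP 0 (p (synth y)); first by exists y => //; rewrite ger0_norm.
    exists (fun u => - y u); first exact: scaled_ballN.
    rewrite ltr0_norm//.
    have plin a y1 z1 : Y y1 -> Y z1 ->
        p (synth (fun u => a * y1 u + z1 u)) = a * p (synth y1) + p (synth z1).
      exact: dual_synth_linear.
    have := @scaled_functionalZ _ _ _ mu _ _ l0 (fun (_ : nat) y => p (synth y))
      (fun _ => plin) 0%N (-1) y (ex_intro2 _ _ 1 ltr01 By).
    by under eq_fun do rewrite mulN1r; rewrite mulN1r.
  exists (fun i => C * chi i (synth z)); first by exists z.
  apply: (le_trans PQ).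
  have -> : \sum_i u i * (C * chi i (synth z)) = C * p (synth z).
    by rewrite /p mulr_sumr; apply: eq_bigr => i _; ring.
  rewrite pz; move: hy; rewrite ltrBlDr -(ltr_pM2l C0) mulrDr [C * (c / C)]mulrC divfK ?gt_eqF//.
  exact: ltW.
exists y => // i ile; have ilt : (i < n.+1)%N by [].
have hi : `|Phi (chi i) - C * chi i (synth y)| < e / 2.
  rewrite -ltr_sqr ?nnegrE ?divr_ge0 ?(ltW e0)// real_normK ?num_real//.
  apply: le_lt_trans hy; rewrite (bigD1 (Ordinal ilt))//= lerDl.
  by apply: sumr_ge0 => j _; rewrite sqr_ge0.
rewrite ler_pdivrMr// mulrC; have := Phie i; move: hi => /ltr_normlW; lra.
Qed.

End Bidual.

Lemma Marcinkiewicz_Grothendieck : Mpsi_Grothendieck mu psi.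
Proof.
move=> phis phi dphis dphi wphi Phi bPhi; have [Plin _] := bPhi.
pose chi n := (-1) \*: phi \+ phis n.
have dchi n : Mdual mu psi (chi n) by exact: dual_add.
have Pchi n : Phi (chi n) = Phi (phis n) - Phi phi by rewrite Plin// mulN1r addrC.
have chi0 f : Mspace mu psi f -> chi n f @[n --> \oo] --> 0.
  move=> Mf; rewrite -(subrr (phi f)).
  rewrite (_ : (fun n => chi n f) = (fun n => phis n f - phi f)).
    by apply: cvgB; [exact: wphi|exact: cvg_cst].
  by apply/funext => n; rewrite /chi /= scaleN1r addrC.
apply: contrapT => ncv.
have [e e0 he] : exists2 e : R, 0 < e &
    forall m : nat, exists2 n, (m <= n)%N & e <= `|Phi (chi n)|.
  apply: contrapT => h; apply: ncv; apply/cvgrPdist_lt => e e0.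
  apply: contrapT => h'; apply: h; exists e => // m.
  apply: contrapT => h''; apply: h'; exists m => // n /= mn.
  rewrite distrC -Pchi ltNge; apply/negP => hn; apply: h''; by exists n.
have /choice[nu hnu] m : exists n, (m <= n)%N /\ e <= `|Phi (chi n)|.
  by have [n h1 h2] := he m; exists n.
(* Signs make the values of [Phi] at least [e]; the zero functional is added to match the form of
   [dual_add] and of the linearity of [Phi]. *)
pose s m : R := if 0 <= Phi (chi (nu m)) then 1 else -1.
pose chi' m := s m \*: chi (nu m) \+ (fun=> 0).
have dchi' m : Mdual mu psi (chi' m) := dual_add (s m) (dchi (nu m)) dual_zero.
have Pchi' m : e <= Phi (chi' m).
  rewrite (Plin (s m) _ _ (dchi (nu m)) dual_zero) (bidual0 bPhi) addr0; apply: (le_trans (hnu m).2); rewrite /s; case: ifPn => [h|].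
    by rewrite mul1r ger0_norm.
  by rewrite -ltNge => h; rewrite mulN1r ltr0_norm.
have l0 := level_ge0 psi1 N.
have chi'0 y : B 1 y -> chi' m (synth y) @[m --> \oo] --> 0.
  move=> By; have Sy : Mspace mu psi (synth y) by apply: synth_space; exists 1.
  apply/cvgrPdist_lt => c c0; have /cvgrPdist_lt /(_ _ c0) [M _ hM] := chi0 _ Sy.
  exists M => // m /= Mm; have := hM (nu m) (leq_trans Mm (hnu m).1).
  rewrite !sub0r !normrN /chi' /= addr0 normrZ.
  by rewrite (_ : `|s m| = 1) ?mul1r// /s; case: ifP; rewrite ?normrN normr1.
have [e1 e10 hN] := bidual_helly bPhi e0 dchi' chi'0 Pchi'.
apply: (@weak_star_null_ball _ _ _ mu _ _ l0 (fun m y => chi' m (synth y)) _ _ chi'0 _ e1 e10 hN).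
- by move=> i a y z; exact: dual_synth_linear.
- by move=> i; exact: dual_synth_bounded.
- move=> c c0; have [c' c'0 hc] := synth_small c0; exists c' => // y By yc.
  by have [z Bz hz] := hc y By yc; exists z => // i; exact: hz.
Qed.

End MarcinkiewiczDual.

Theorem theorem6p3 (R : realType) (d : measure_display) (T : measurableType d)
  (mu : {measure set T -> \bar R}) (psi : R -> R) :
  sigma_finite setT mu ->
  (0 < mu setT)%E ->
  (* psi : [0, gamma) -> [0, oo) *)
  (forall t, 0 <= t -> (t%:E < mu setT)%E -> 0 <= psi t) ->
  (* non-zero *)
  (exists t, [/\ 0 <= t, (t%:E < mu setT)%E & psi t != 0]) ->
  (* increasing (non-decreasing) on [0, gamma) *)
  (forall s t, 0 <= s -> s <= t -> (t%:E < mu setT)%E -> psi s <= psi t) ->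
  (* concave on [0, gamma) *)
  concave_on [set t | 0 <= t /\ (t%:E < mu setT)%E] psi ->
  (* continuous on (0, gamma) *)
  (forall t, 0 < t -> (t%:E < mu setT)%E -> {for t, continuous psi}) ->
  psi 0 = 0 ->
  ((* condition (A) *)
   (mu setT = +oo%E /\ liminf0_gt1 psi /\ liminfoo_gt1 psi) \/
   (* condition (B) *)
   ((mu setT < +oo)%E /\ liminf0_gt1 psi)) ->
  Mpsi_Grothendieck mu psi.
Proof.
move=> _ mu0 psi_ge0 psi_neq0 psi_nd psi_concave _ psi0 cond.
have [psi1 [N [N4 psi1_gt0 theta_ni doubling psi_psi1]]] :=
  regular_majorant mu0 psi_ge0 psi_neq0 psi_nd psi_concave psi0 cond.
exact: (Marcinkiewicz_Grothendieck mu0 N4 psi1_gt0 theta_ni doubling psi_psi1).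
Qed.
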